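(* Let $\alpha\ge0$ and $s=3\alpha+2$. Then for all nonzero $f\in L^2_\alpha(\mathbb{K})$ and all measurable sets $E\subset\widehat{\mathbb{K}}$ such that $0<\gamma_\alpha(E)<+\infty$, $$\left\|\mathcal{F}_{LB}(f)\,\chi_E\right\|_{\gamma_\alpha,2}<C_\alpha\ \gamma_\alpha(E)^{\frac{1}{2(3\alpha+2)}}\ \|f\|_{\alpha,2}^{\frac{3\alpha+1}{3\alpha+2}}\ \big\|\,|(x,t)|^s f\,\big\|_{\alpha,2}^{\frac{1}{3\alpha+2}},$$ where $$C_\alpha=(3\alpha+2)^2\,(3\alpha+1)^{-\frac{1}{2(3\alpha+2)}-1}\left(\frac{B\left(\frac{\alpha+1}{2},\frac{2\alpha+1}{2}\right)}{4^{\alpha+1}\pi\,\Gamma(\alpha+1)}\right)^{\frac{1}{2(3\alpha+2)}}$$ and $B$ is the Euler beta function. (The norm $\||(x,t)|^s f\|_{\alpha,2}$ may be infinite.)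
   Context: Fix $\alpha\ge 0$. Let $\mathbb{K}=[0,+\infty)\times[0,+\infty)$, with points $(x,t)$, and $\widehat{\mathbb{K}}=[0,+\infty)\times\mathbb{N}$ (with $0\in\mathbb{N}$), with points $(\lambda,m)$. $\chi_E$ is the indicator function of $E$. Measure on $\mathbb{K}$: $dm_\alpha(x,t)=\frac{1}{\pi\Gamma(\alpha+1)}x^{2\alpha+1}t^{2\alpha}\,dx\,dt$. $L^p_\alpha(\mathbb{K})$ denotes $L^p(\mathbb{K},m_\alpha)$ with norm $\|\cdot\|_{\alpha,p}$. Homogeneous norm: $|(x,t)|=(x^4+4t^2)^{1/4}$. Laguerre-Bessel transform: for $(\lambda,m)\in\widehat{\mathbb{K}}$ put $\varphi_{(\lambda,m)}(x,t)=j_{\alpha-\frac12}(\lambda t)\,\mathcal{L}_m^\alpha(\lambda x^2)$, where $j_\nu(z)=\Gamma(\nu+1)\sum_{k\ge0}\frac{(-1)^k}{k!\,\Gamma(\nu+k+1)}(z/2)^{2k}$ is the normalized Bessel function, $\mathcal{L}_m^\alpha(z)=e^{-z/2}L_m^\alpha(z)/L_m^\alpha(0)$, and $L_m^\alpha$ is the Laguerre polynomial of degree $m$ and order $\alpha$. For $f\in L^1_\alpha(\mathbb{K})$, $$\mathcal{F}_{LB}(f)(\lambda,m)=\int_{\mathbb{K}}f(x,t)\,\varphi_{(\lambda,m)}(x,t)\,dm_\alpha(x,t).$$ Measure on $\widehat{\mathbb{K}}$: $\gamma_\alpha$ is given by $$\int_{\widehat{\mathbb{K}}} g\,d\gamma_\alpha=c_\alpha\sum_{m=0}^\infty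 L_m^\alpha(0)\int_0^{+\infty} g(\lambda,m)\,\lambda^{3\alpha+1}\,d\lambda ,$$ where $c_\alpha>0$ is the normalizing constant for which the Plancherel formula $\|f\|_{\alpha,2}=\|\mathcal{F}_{LB}(f)\|_{\gamma_\alpha,2}$ holds for all $f\in L^1_\alpha(\mathbb{K})\cap L^2_\alpha(\mathbb{K})$ (namely $c_\alpha=\frac{2\pi}{2^{2\alpha-1}\Gamma(\alpha+\frac12)^2}$); here $\|\cdot\|_{\gamma_\alpha,2}$ is the norm of $L^2(\widehat{\mathbb{K}},\gamma_\alpha)$. On $L^2_\alpha(\mathbb{K})$, $\mathcal{F}_{LB}$ denotes the resulting isometric extension to $L^2_\alpha(\mathbb{K})\to L^2(\widehat{\mathbb{K}},\gamma_\alpha)$. *)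

(* Defs.v *)
From HB Require Import structures.
From mathcomp Require Import all_boot all_order all_algebra.
From mathcomp Require Import complex.
From mathcomp Require Import all_classical all_reals all_analysis.
From mathcomp Require Import measurable_realfun.

Set Implicit Arguments.
Unset Strict Implicit.
Unset Printing Implicit Defensive.

Import Order.TTheory GRing.Theory Num.Theory.
Import numFieldNormedType.Exports.

Local Open Scope classical_set_scope.
Local Open Scope ring_scope.
Local Open Scope complex_scope.

Section special_functions.
Context {R : realType}.
Implicit Types (a b alpha nu z : R) (m k : nat).

Definition Gamma a : R :=
  \int[lebesgue_measure]_(x in `]0, +oo[) (x `^ (a - 1) * expR (- x)).

Definition Beta a b : R :=
  \int[lebesgue_measure]_(x in `]0, 1[) (x `^ (a - 1) * (1 - x) `^ (b - 1)).

Definition bessel_coef nu z k : R :=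
  (-1) ^+ k / (k`!%:R * Gamma (nu + k%:R + 1)) * (z / 2) ^+ (2 * k).

(* The normalized Bessel function j_nu, with j_nu(0) = 1. *)
Definition bessel_j nu z : R :=
  Gamma (nu + 1) * limn (series (bessel_coef nu z)).

(* The coefficient of 'X^k is (-1)^k binom(m + alpha, m - k) / k!. *)
Definition laguerre alpha m : {poly R} :=
  \poly_(k < m.+1) ((-1) ^+ k * Gamma (m%:R + alpha + 1) /
    (Gamma (k%:R + alpha + 1) * (m - k)`!%:R * k`!%:R)).

Definition laguerre_fun alpha m z : R :=
  expR (- (z / 2)) * (laguerre alpha m).[z] / (laguerre alpha m).[0].

Lemma Gamma_ge0 a : 0 <= Gamma a.
Proof.
by apply: Rintegral_ge0 => x _; rewrite mulr_ge0 ?powR_ge0 ?expR_ge0.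
Qed.

Lemma laguerre0_ge0 alpha m : 0 <= (laguerre alpha m).[0].
Proof.
rewrite horner_coef0 coef_poly /= expr0 mul1r.
by rewrite divr_ge0 ?mulr_ge0 ?Gamma_ge0 ?ler0n.
Qed.

End special_functions.

Section power_measure.
Context {R : realType}.
Variable b : R.

(* The measure x^b dx on the half-line [0, +oo[. *)
Definition power_measure (A : set (measurableTypeR R)) : \bar R :=
  (\int[lebesgue_measure]_(x in A `&` `[0%R, +oo[) (x `^ b)%:E)%E.

Let power0 : power_measure set0 = 0%E.
Proof. by rewrite /power_measure set0I integral_set0. Qed.

Let power_ge0 A : (0 <= power_measure A)%E.
Proof. by apply: integral_ge0 => x _; rewrite lee_fin powR_ge0. Qed.

Let power_sigma_additive : semi_sigma_additive power_measure.
Proof.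
move=> F mF tF mUF; rewrite /power_measure setI_bigcupl ge0_integral_bigcup //=.
- by apply: is_cvg_ereal_nneg_natsum_cond => n _ _; exact: power_ge0.
- by move=> n; exact: measurableI.
- by apply: measurable_funTS; apply/measurable_EFinP; exact: measurable_powR.
- by move=> x _; rewrite lee_fin powR_ge0.
- exact: trivIset_setIr.
Qed.

HB.instance Definition _ := isMeasure.Build _ _ _ power_measure
  power0 power_ge0 power_sigma_additive.

End power_measure.

Section measure_K.
Context {R : realType}.
Variable alpha : R.

Definition KK : set (measurableTypeR R * measurableTypeR R) :=
  [set z : R * R | 0 <= z.1 /\ 0 <= z.2].

Lemma measurable_KK : measurable KK.
Proof.
have -> : KK = `[0, +oo[%classic `*` `[0, +oo[%classic.
  by apply/seteqP; split => -[x t] /=; rewrite !in_itv /= !andbT.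
exact: measurableX.
Qed.

Definition K_density (z : R * R) : R :=
  (pi * Gamma (alpha + 1))^-1 *
  (z.1 `^ (2 * alpha + 1) * z.2 `^ (2 * alpha)).

Lemma K_density_ge0 z : 0 <= K_density z.
Proof.
rewrite /K_density mulr_ge0 ?mulr_ge0 ?powR_ge0 //.
by rewrite invr_ge0 mulr_ge0 ?Gamma_ge0 ?pi_ge0.
Qed.

Lemma measurable_K_density :
  measurable_fun [set: measurableTypeR R * measurableTypeR R] K_density.
Proof.
apply: measurable_funM => //; apply: measurable_funM.
  by apply: (measurableT_comp (measurable_powR _)).
by apply: (measurableT_comp (measurable_powR _)).
Qed.

(* The measure m_alpha, seen as a measure on R^2 concentrated on KK:
   a function on KK is represented by any measurable extension to R^2. *)
Definition mK (A : set (measurableTypeR R * measurableTypeR R)) : \bar R :=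
  (\int[lebesgue_measure \x lebesgue_measure]_(z in A `&` KK)
     (K_density z)%:E)%E.

Let mK0 : mK set0 = 0%E.
Proof. by rewrite /mK set0I integral_set0. Qed.

Let mK_ge0 A : (0 <= mK A)%E.
Proof. by apply: integral_ge0 => z _; rewrite lee_fin K_density_ge0. Qed.

Let mK_sigma_additive : semi_sigma_additive mK.
Proof.
move=> F mF tF mUF; rewrite /mK setI_bigcupl ge0_integral_bigcup //=.
- by apply: is_cvg_ereal_nneg_natsum_cond => n _ _; exact: mK_ge0.
- by move=> n; apply: measurableI => //; exact: measurable_KK.
- by apply: measurable_funTS; apply/measurable_EFinP; exact: measurable_K_density.
- by move=> z _; rewrite lee_fin K_density_ge0.
- exact: trivIset_setIr.
Qed.

HB.instance Definition _ := isMeasure.Build _ _ _ mK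
  mK0 mK_ge0 mK_sigma_additive.

End measure_K.

Section measure_Khat.
Context {R : realType}.
Variable alpha : R.

Definition Khat : set (measurableTypeR R * nat) :=
  [set lm : R * nat | 0 <= lm.1].

(* The constant c_alpha for which the Laguerre-Bessel transform is an isometry
   from L^2(mK) to L^2(gammaK). *)
Definition plancherel_cst : R :=
  2 * pi / (2 `^ (2 * alpha - 1) * Gamma (alpha + 2^-1) ^+ 2).

Lemma plancherel_cst_ge0 : 0 <= plancherel_cst.
Proof.
by rewrite divr_ge0 ?mulr_ge0 ?pi_ge0 ?powR_ge0 ?exprn_ge0 ?Gamma_ge0.
Qed.

(* The measure gamma_alpha, concentrated on Khat. *)
Definition gammaK (A : set (measurableTypeR R * nat)) : \bar R :=
  (plancherel_cst%:E * \sum_(0 <= m <oo)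
     ((laguerre alpha m).[0]%R%:E *
      power_measure (3 * alpha + 1) [set l : R | A (l, m)]))%E.

Let pair_nat_measurable m :
  measurable_fun [set: measurableTypeR R]
    (pair^~ m : measurableTypeR R -> measurableTypeR R * nat).
Proof. exact: pair2_measurable. Qed.

Let push m : {measure set (measurableTypeR R * nat) -> \bar R} :=
  measure_function_pushforward__canonical__measure_function_Measure
    (power_measure (3 * alpha + 1)) (pair_nat_measurable m).

Let slice m : {measure set (measurableTypeR R * nat) -> \bar R} :=
  mscale (NngNum (laguerre0_ge0 alpha m)) (push m).

Let gammaKE : gammaK = mscale (NngNum plancherel_cst_ge0) (mseries slice 0).
Proof. by []. Qed.

Let gammaK0 : gammaK set0 = 0%E.
Proof. by rewrite gammaKE measure0. Qed.

Let gammaK_ge0 A : (0 <= gammaK A)%E.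
Proof. by rewrite gammaKE measure_ge0. Qed.

Let gammaK_sigma_additive : semi_sigma_additive gammaK.
Proof. by rewrite gammaKE; exact: measure_semi_sigma_additive. Qed.

HB.instance Definition _ := isMeasure.Build _ _ _ gammaK
  gammaK0 gammaK_ge0 gammaK_sigma_additive.

End measure_Khat.

Section laguerre_bessel.
Context {R : realType}.
Variable alpha : R.

Definition cmod (w : R[i]) : R := ComplexField.Normc.normc w.

(* The norm of the complex-valued Lebesgue space L^p(mu), in [0, +oo]. *)
Definition cLnorm d (T : measurableType d) (mu : {measure set T -> \bar R})
    (p : \bar R) (f : T -> R[i]) : \bar R :=
  ('N[mu]_p[EFin \o (cmod \o f)])%E.

Definition cLp d (T : measurableType d) (mu : {measure set T -> \bar R})
    (p : \bar R) (f : T -> R[i]) : Prop :=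
  [/\ measurable_fun setT (fun x => complex.Re (f x)),
      measurable_fun setT (fun x => complex.Im (f x)) &
      (cLnorm mu p f < +oo)%E].

Definition hnorm (z : R * R) : R := (z.1 ^+ 4 + 4 * z.2 ^+ 2) `^ 4^-1.

Definition LB_kernel (lm : R * nat) (z : R * R) : R :=
  bessel_j (alpha - 2^-1) (lm.1 * z.2) *
  laguerre_fun alpha lm.2 (lm.1 * z.1 ^+ 2).

Definition LB1 (f : R * R -> R[i]) (lm : R * nat) : R[i] :=
  (\int[mK alpha]_z (complex.Re (f z) * LB_kernel lm z)) +i*
  (\int[mK alpha]_z (complex.Im (f z) * LB_kernel lm z)).

(* g represents the image of f under the (isometric) continuous extension
   of LB1 from L^1 `&` L^2 to L^2; it is determined up to a null set. *)
Definition is_LB2 (f : R * R -> R[i]) (g : R * nat -> R[i]) : Prop :=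
  cLp (gammaK alpha) 2%:E g /\
  exists2 u : nat -> R * R -> R[i],
    forall n, cLp (mK alpha) 1%:E (u n) /\ cLp (mK alpha) 2%:E (u n) &
    (cLnorm (mK alpha) 2%:E (fun z => u n z - f z) @[n --> \oo] --> 0%E) /\
    (cLnorm (gammaK alpha) 2%:E (fun lm => LB1 (u n) lm - g lm)
       @[n --> \oo] --> 0%E).

Definition C_alpha : R :=
  (3 * alpha + 2) ^+ 2 *
  (3 * alpha + 1) `^ (- (2 * (3 * alpha + 2))^-1 - 1) *
  (Beta ((alpha + 1) / 2) ((2 * alpha + 1) / 2) /
   (4 `^ (alpha + 1) * pi * Gamma (alpha + 1)))
    `^ (2 * (3 * alpha + 2))^-1.

End laguerre_bessel.

(* Main.v *)
(* Bessel's inequality for Laguerre functions in x and for the Hankel transform in t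
   shows that the Laguerre-Bessel transform does not increase L^2 norms, and its kernel
   is bounded by 1. Splitting f over the homogeneous ball U of radius r, and bounding
   the inner part by Cauchy-Schwarz, gives
     ||F(f) 1_E|| <= (gamma(E) m(U))^(1/2) ||f|| + r^(-s) || |.|^s f ||,
   where m(U) <= const * r^(2s). Optimizing in r yields
     ||F(f) 1_E||^2 <= 4 (const * gamma(E))^(1/2) ||f|| || |.|^s f ||,
   and interpolating with ||F(f) 1_E|| <= ||f|| gives the exponent 1/s. The resulting
   constant is strictly below C_alpha thanks to the lower bound
   B(a, b) >= 2 * 4^(-(a + b)), obtained by restricting the integral to [1/4, 3/4]. *)

Require Import Defs.
From HB Require Import structures.
From mathcomp Require Import all_boot all_order all_algebra.
From mathcomp Require Import complex ring lra.
From mathcomp Require Import all_classical all_reals all_analysis.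
From mathcomp Require Import measurable_realfun.

Set Implicit Arguments.
Unset Strict Implicit.
Unset Printing Implicit Defensive.

Import Order.TTheory GRing.Theory Num.Theory.
Import numFieldNormedType.Exports.

Local Open Scope classical_set_scope.
Local Open Scope ring_scope.

(** * Laguerre polynomials *)

(** Laguerre orthogonality is the only source of the L2 bounds. Against Gaussian weights it is a
    finite identity between Pochhammer symbols, and the generating function carries it over to the
    Hankel transform in a scaling limit. For fixed l the Laguerre functions in x have scale l, so
    Bessel's inequality there costs l^(-(alpha+1)); times the weight l^(3 alpha+1) of [gammaK] this
    leaves l^(2 alpha), the Hankel weight, and the accumulated constants collapse to the constant of
    [mK]. The kernel bound is proved factor by factor: a Fock space norm for Laguerre polynomials of
    order 0, nonnegative connection coefficients to reach order alpha, and a decreasing energy for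
    the Bessel function. The L2 transform is accessible only through approximants in L1 and L2.
    Hence the ball cuts the approximants, on which the transform is an integral, and the limit is
    taken in the resulting inequality. [Gamma], [Beta] and the transform are real-valued integrals,
    equal to 0 when the extended integral is infinite, so finiteness must be settled before they can
    be bounded below or computed. *)

Section binomial_sums.
Context {R : comPzRingType}.
Implicit Types (a : R) (f : nat -> R).

(** Symbolically (S + a)^n f at 0, with S the shift of sequences: a = -1 gives the n-th finite
    difference, and a = -y expands (z - y)^n below. *)
Definition binsum a n f : R := \sum_(i < n.+1) 'C(n, i)%:R * a ^+ (n - i) * f i.

Lemma binsum0 a f : binsum a 0 f = f 0%N.
Proof. by rewrite /binsum big_ord1 bin0 expr0 !mul1r. Qed.

Lemma binsumS a n f :
  binsum a n.+1 f = binsum a n (fun i => f i.+1) + a * binsum a n f.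
Proof.
rewrite /binsum big_ord_recl big_ord_recr /= mulr_sumr [in RHS]big_ord_recr /=.
rewrite [X in _ + X = _](_ : _ = \sum_(i < n) ('C(n, i)%:R * a ^+ (n - i) * f i.+1
   + a * ('C(n, i.+1)%:R * a ^+ (n - i.+1) * f i.+1)) + f n.+1); last first.
  congr (_ + _); last by rewrite /bump /= add1n binn subnn expr0 !mul1r.
  apply: eq_bigr => i _; rewrite /bump /= add1n subSS binS natrD.
  have -> : (n - i = (n - i.+1).+1)%N by rewrite subnSK.
  by rewrite exprS; ring.
rewrite big_split /= [X in _ = _ + X]big_ord_recl /= !binn !subnn !bin0 !subn0 exprS.
have -> : \sum_(i < n) a * ('C(n, bump 0 i)%:R * a ^+ (n - bump 0 i) * f (bump 0 i)) =
  \sum_(i < n) a * ('C(n, i.+1)%:R * a ^+ (n - i.+1) * f i.+1).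
  by apply: eq_bigr => i _; rewrite /bump /= add1n.
by ring.
Qed.
End binomial_sums.

Section pochhammer.
Context {R : realFieldType}.
Implicit Types (a b x y : R) (n k : nat).

Definition poch b n : R := \prod_(i < n) (b + i%:R).

Lemma poch0 b : poch b 0 = 1.
Proof. by rewrite /poch big_ord0. Qed.

Lemma pochSr b n : poch b n.+1 = poch b n * (b + n%:R).
Proof. by rewrite /poch big_ord_recr. Qed.

Lemma pochS b n : poch b n.+1 = b * poch (b + 1) n.
Proof.
rewrite /poch big_ord_recl /= addr0; congr (_ * _); apply: eq_bigr => i _.
by rewrite /bump /= natrD; ring.
Qed.

Lemma pochD b n k : poch b (n + k) = poch b n * poch (b + n%:R) k.
Proof.
elim: k => [|k IH]; first by rewrite addn0 poch0 mulr1.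
by rewrite addnS !pochSr IH natrD; ring.
Qed.

Lemma poch1 n : poch 1 n = n`!%:R.
Proof.
by elim: n => [|n IH]; rewrite ?poch0// pochSr IH factS natrM mulrC -natr1 addrC.
Qed.

Lemma poch_ge0 b n : 0 <= b -> 0 <= poch b n.
Proof. by move=> b0; apply: prodr_ge0 => i _; rewrite addr_ge0. Qed.

Lemma poch_gt0 b n : 0 < b -> 0 < poch b n.
Proof. by move=> b0; apply: prodr_gt0 => i _; rewrite ltr_pwDl. Qed.

Lemma fact_neq0 n : n`!%:R != 0 :> R.
Proof. by rewrite pnatr_eq0 -lt0n fact_gt0. Qed.

Lemma binE n k : (k <= n)%N -> 'C(n, k)%:R = n`!%:R / (k`!%:R * (n - k)`!%:R) :> R.
Proof.
move=> kn; rewrite -(bin_fact kn) !natrM mulfK// mulf_neq0 ?fact_neq0//.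
Qed.

(** The m-th finite difference of a monic polynomial of degree k <= m in i. One difference lowers
    the degree: (x+1)_(k+1) - (x)_(k+1) = (k+1) (x+1)_k. *)
Lemma binsum_poch b m k : (k <= m)%N ->
  binsum (-1) m (fun i => poch (b + i%:R) k) = (m == k)%:R * k`!%:R.
Proof.
elim: m b k => [|m IH] b k; first by rewrite leqn0 => /eqP ->; rewrite binsum0 poch0 mul1r.
rewrite binsumS mulN1r.
case: k => [_|k km].
  have -> : binsum (-1) m (fun i => poch (b + i.+1%:R) 0) =
            binsum (-1) m (fun i => poch (b + i%:R) 0 : R).
    by apply: eq_bigr => i _; rewrite !poch0.
  by rewrite subrr mul0r.
transitivity (k.+1%:R * binsum (-1) m (fun i => poch (b + 1 + i%:R) k : R)).
  rewrite /binsum -sumrB mulr_sumr; apply: eq_bigr => i _.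
  have -> : b + i.+1%:R = b + i%:R + 1 by rewrite -natr1; ring.
  have -> : b + 1 + i%:R = b + i%:R + 1 by ring.
  by rewrite (pochS (b + i%:R)) (pochSr (b + i%:R + 1)) -natr1; ring.
by rewrite IH// eqSS factS natrM; ring.
Qed.

(** Compares coefficients in (1-T)^(-x) (1-T)^(-y) = (1-T)^(-(x+y)). The induction multiplies by n+1
    = (n+1-i) + i, the coefficient form of the product rule for T d/dT. *)
Lemma poch_vandermonde x y n :
  \sum_(i < n.+1) poch x (n - i) / (n - i)`!%:R * (poch y i / i`!%:R) =
  poch (x + y) n / n`!%:R.
Proof.
elim: n => [|n IH]; first by rewrite big_ord1 !poch0 divrr ?mulr1 ?unitfE ?oner_neq0.
have rS z k : poch z k.+1 / k.+1`!%:R * k.+1%:R = (z + k%:R) * (poch z k / k`!%:R).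
  rewrite pochSr factS natrM; field; by rewrite fact_neq0 addrC natr1 pnatr_eq0.
apply: (mulIf (_ : n.+1%:R != 0)); first by rewrite pnatr_eq0.
rewrite rS -IH mulr_suml.
transitivity (\sum_(i < n.+2) ((n.+1 - i)%:R * (poch x (n.+1 - i) / (n.+1 - i)`!%:R) * (poch y i / i`!%:R))
  + \sum_(i < n.+2) (poch x (n.+1 - i) / (n.+1 - i)`!%:R * (poch y i / i`!%:R * i%:R))).
  rewrite -big_split /=; apply: eq_bigr => i _.
  have -> : n.+1%:R = (n.+1 - i)%:R + i%:R :> R by rewrite -natrD subnK// -ltnS.
  ring.
rewrite big_ord_recr /= subnn !mul0r addr0 [X in _ + X]big_ord_recl /= !mulr0 add0r.
rewrite -big_split mulr_sumr /=; apply: eq_bigr => i _.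
rewrite /bump /= add1n subSS rS subSn -1?ltnS// [(_ - _).+1%:R * _]mulrC rS.
have -> : n%:R = (n - i)%:R + i%:R :> R by rewrite -natrD subnK// -ltnS.
ring.
Qed.

End pochhammer.

Section laguerre_polynomials.
Context {R : realFieldType}.
Implicit Types (b y : R) (m n k : nat).

Definition lag_coef b n i : R :=
  (-1) ^+ i * poch b n / (poch b i * (n - i)`!%:R * i`!%:R).

(* The Laguerre polynomial of degree n and order b - 1. *)
Definition lag b n y : R := \sum_(i < n.+1) lag_coef b n i * y ^+ i.

Lemma lag_at0 b n : lag b n 0 = poch b n / n`!%:R.
Proof.
rewrite /lag big_ord_recl /= big1 ?addr0; last by move=> i _; rewrite exprS mul0r mulr0.
by rewrite /lag_coef !expr0 poch0 fact0 subn0 !mul1r !mulr1.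
Qed.

Lemma lag_coef_bin b n i : 0 < b -> (i <= n)%N ->
  lag_coef b n i * poch b i = (-1) ^+ i * 'C(n, i)%:R * (poch b n / n`!%:R).
Proof.
move=> b0 lin; rewrite binE// /lag_coef; field.
by rewrite !fact_neq0 lt0r_neq0 ?poch_gt0.
Qed.

(** Up to the factor Gamma(b), (b)_j is the j-th moment of y^(b-1) e^(-y), so this is orthogonality
    of the Laguerre polynomial of degree m to y^k for k < m. It reduces to a finite difference of a
    polynomial of degree k. *)
Lemma sum_lag_coef_poch b m k : 0 < b -> (k <= m)%N ->
  \sum_(i < m.+1) lag_coef b m i * poch b (i + k) =
  (m == k)%:R * (-1) ^+ m * poch b m.
Proof.
move=> b0 km.
transitivity ((-1) ^+ m * (poch b m / m`!%:R) * binsum (-1) m (fun i => poch (b + i%:R) k)).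
  rewrite /binsum mulr_sumr; apply: eq_bigr => i _.
  have im : (i <= m)%N by rewrite -ltnS.
  (* The signs (-1)^i and (-1)^(m-i) are reduced to parities, so that four cases settle them. *)
  rewrite pochD mulrA lag_coef_bin// -signr_odd -[X in X * _ * (_ * _ * _)]signr_odd.
  rewrite -[X in _ * (_ * X * _)]signr_odd oddB//.
  by case: (odd m); case: (odd i); rewrite /= ?expr0 ?expr1; ring.
rewrite binsum_poch//; case: eqP => [->|_]; last by rewrite !mul0r mulr0.
field; exact: fact_neq0.
Qed.

(** Integration is replaced by the moment functional y^j -> (b)_j. By symmetry n <= m, and then
    every power y^j with j < m is annihilated, which leaves only j = n = m. *)
Lemma lag_orthogonality b m n : 0 < b ->
  \sum_(i < m.+1) \sum_(j < n.+1) lag_coef b m i * lag_coef b n j * poch b (i + j) =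
  (m == n)%:R * (poch b n / n`!%:R).
Proof.
move=> b0; wlog nm : m n / (n <= m)%N => [hw|].
  case/orP: (leq_total n m) => [|mn]; first exact: hw.
  case: (eqVneq m n) => [->|mn']; first by rewrite hw// eqxx.
  rewrite exchange_big /=; have := hw _ _ mn.
  rewrite [n == m]eq_sym (negbTE mn') !mul0r => h; rewrite -[RHS]h.
  by apply: eq_bigr => i _; apply: eq_bigr => j _; rewrite addnC; ring.
rewrite exchange_big /= big_ord_recr /= [X in X + _]big1 => [|j _].
  rewrite add0r; transitivity (lag_coef b n n * ((m == n)%:R * (-1) ^+ m * poch b m)).
    rewrite -sum_lag_coef_poch// mulr_sumr; apply: eq_bigr => i _; ring.
  case: eqP => [->|_]; last by rewrite !mul0r mulr0.
  rewrite /lag_coef subnn fact0 mul1r.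
  transitivity (((-1) ^+ n) ^+ 2 * (poch b n / n`!%:R)).
    by field; rewrite fact_neq0 lt0r_neq0 ?poch_gt0.
  by rewrite sqrr_sign.
transitivity (lag_coef b n j * \sum_(i < m.+1) lag_coef b m i * poch b (i + j)).
  by rewrite mulr_sumr; apply: eq_bigr => i _; ring.
have jm : (j < m)%N by apply: leq_trans nm.
by rewrite sum_lag_coef_poch ?(ltnW jm)// gtn_eqF// !mul0r mulr0.
Qed.

(** The generating function (1-T)^(-b) exp(-yT/(1-T)) acquires the factor (1-T)^(-a) when b becomes
    a + b. For a >= 0 the coefficients (a)_(n-k)/(n-k)! are nonnegative, so bounds for order b - 1
    propagate. Power by power in y, this is Vandermonde's identity after factoring (b)_k = (b)_i
    (b+i)_(k-i). *)
Lemma lag_connection (a b : R) n y : 0 < b -> 0 <= a ->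
  lag (a + b) n y = \sum_(k < n.+1) poch a (n - k) / (n - k)`!%:R * lag b k y.
Proof.
move=> b0 a0.
have ab0 : 0 < a + b by rewrite ltr_wpDl.
transitivity (\sum_(k < n.+1) \sum_(i < n.+1 | (i <= k)%N)
    poch a (n - k) / (n - k)`!%:R * (lag_coef b k i * y ^+ i)); last first.
  apply: eq_bigr => k _; rewrite /lag mulr_sumr.
  by rewrite (big_ord_widen n.+1 (fun i => poch a (n - k) / (n - k)`!%:R * (lag_coef b k i * y ^+ i))).
rewrite (exchange_big_dep predT)//=; apply: eq_bigr => i _.
transitivity (\sum_(k < n.+1 | (i <= k)%N) (poch a (n - k) / (n - k)`!%:R *
    (poch (b + i%:R) (k - i) / (k - i)`!%:R)) * ((-1) ^+ i / i`!%:R * y ^+ i)); last first.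
  apply: eq_bigr => k ik;
  have -> : lag_coef b k i = (-1) ^+ i * (poch b i * poch (b + i%:R) (k - i)) /
      (poch b i * (k - i)`!%:R * i`!%:R) by rewrite -pochD subnKC.
  by field; rewrite !fact_neq0 lt0r_neq0 ?poch_gt0.
rewrite -mulr_suml.
have lin : (i <= n)%N by rewrite -ltnS.
have -> : \sum_(k < n.+1 | (i <= k)%N) poch a (n - k) / (n - k)`!%:R *
    (poch (b + i%:R) (k - i) / (k - i)`!%:R) = poch (a + (b + i%:R)) (n - i) / (n - i)`!%:R.
  rewrite -poch_vandermonde.
  rewrite -(big_mkord (fun k => (i <= k)%N) (fun k => poch a (n - k) / (n - k)`!%:R *
    (poch (b + i%:R) (k - i) / (k - i)`!%:R))).
  rewrite -(big_mkord xpredT (fun j => poch a (n - i - j) / (n - i - j)`!%:R *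
    (poch (b + i%:R) j / j`!%:R))).
  rewrite (@big_cat_nat _ _ _ i)//=; last by rewrite ltnW.
  rewrite big_nat_cond big_pred0 ?Monoid.mul1m; last first.
    by move=> k; case: ltnP; rewrite ?andbF.
  rewrite -{1}[val i]add0n big_addn subSn//= big_nat_cond [in RHS]big_nat_cond.
  apply: eq_big => k; first by rewrite leq_addl.
  by move=> _; rewrite addnK addnC subnDA.
have -> : lag_coef (a + b) n i = (-1) ^+ i * (poch (a + b) i * poch (a + b + i%:R) (n - i)) /
    (poch (a + b) i * (n - i)`!%:R * i`!%:R) by rewrite -pochD subnKC.
rewrite addrA.
by field; rewrite !fact_neq0 lt0r_neq0 ?poch_gt0.
Qed.

End laguerre_polynomials.

Lemma cvg_series_expR {R : realType} (x : R) :
  series (exp_coeff x) @ \oo --> expR x.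
Proof. exact: is_cvg_series_exp_coeff. Qed.

(** * Bargmann-Fock bound for Laguerre polynomials of order 0 *)

Section fock.
Context {R : realType}.
Variable y : R.

(** The coefficient of z^k in z^j e^(yz). *)
Definition fock_shift k j : R := if (j <= k)%N then y ^+ (k - j) / (k - j)`!%:R else 0.

(* The coefficient of z^k in (z - y)^n e^(yz). In the Bargmann-Fock norm
   \sum_k k! |c_k|^2, multiplication by z - y is, up to the factor e^(yz), a
   creation operator, whence norm n! e^(y^2); the coefficient of z^n is the
   Laguerre polynomial L_n(y^2), so that L_n(y^2)^2 <= e^(y^2). *)
Definition fock n k : R := binsum (- y) n (fock_shift k).

Lemma fock0 k : fock 0 k = y ^+ k / k`!%:R.
Proof. by rewrite /fock binsum0 /fock_shift leq0n subn0. Qed.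

Lemma fockS0 n : fock n.+1 0 = - y * fock n 0.
Proof. by rewrite /fock binsumS /binsum big1 ?add0r// => i _; rewrite mulr0. Qed.

Lemma fockSS n k : fock n.+1 k.+1 = fock n k - y * fock n k.+1.
Proof.
rewrite /fock binsumS mulNr; congr (_ - _); apply: eq_bigr => i _.
Qed.

Lemma fock0_lowering k : k.+1%:R * fock 0 k.+1 = y * fock 0 k.
Proof.
rewrite !fock0 factS natrM exprS; field; by rewrite fact_neq0 addrC natr1 pnatr_eq0.
Qed.

(** The operator d/dz - y annihilates e^(yz), hence maps (z-y)^(n+1) e^(yz) to (n+1) (z-y)^n e^(yz);
    read on the coefficient of z^k. *)
Lemma fock_lowering n k :
  k.+1%:R * fock n.+1 k.+1 - y * fock n.+1 k = n.+1%:R * fock n k.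
Proof.
elim: n k => [|n IH] k.
  rewrite fockSS mulrBr mul1r; case: k => [|k].
    by rewrite fockS0; have := fock0_lowering 0; rewrite !mul1r => ->; ring.
  rewrite fockSS [k.+2%:R * (y * _)]mulrCA fock0_lowering -natr1.
  have := fock0_lowering k; lra.
rewrite fockSS mulrBr [k.+1%:R * (y * _)]mulrCA.
have -> : k.+1%:R * fock n.+1 k.+1 = y * fock n.+1 k + n.+1%:R * fock n k.
  by rewrite -IH; ring.
case: k => [|k]; first by rewrite !fockS0 -[n.+2%:R]natr1; ring.
rewrite (fockSS n.+1 k) -[n.+2%:R]natr1 -[k.+2%:R]natr1 mulrDl mul1r.
have := IH k; rewrite fockSS => h.
have -> : (k.+1%:R) * (fock n k - y * fock n k.+1) =
   y * fock n.+1 k + n.+1%:R * fock n k by rewrite -h; ring.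
by ring.
Qed.

Lemma fock_diag n : fock n n = lag 1 n (y ^+ 2).
Proof.
rewrite /fock /binsum /lag (reindex_inj rev_ord_inj) /=; apply: eq_bigr => i _.
have im : (i <= n)%N by rewrite -ltnS.
rewrite /fock_shift subSS leq_subr subKn// bin_sub// binE// /lag_coef !poch1.
have -> : (y ^+ 2) ^+ i = y ^+ i * y ^+ i by rewrite -expr2 -!exprM mulnC.
by rewrite (exprNn y); field; rewrite !fact_neq0.
Qed.

Definition fock_norm n K : R := \sum_(k < K) k`!%:R * fock n k ^+ 2.

Lemma fock_norm_recr n K : fock_norm n K.+1 = fock_norm n K + K`!%:R * fock n K ^+ 2.
Proof. by rewrite /fock_norm big_ord_recr. Qed.

(** Multiplication by z and d/dz are adjoint for the Fock norm, and their commutator produces the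
    factor n+1. Truncating the sum at K leaves the boundary term. *)
Lemma fock_normS n K : fock_norm n.+1 K.+1 =
  n.+1%:R * fock_norm n K.+1 - K.+1`!%:R * fock n.+1 K.+1 * fock n K.
Proof.
have low k : k.+1%:R * fock n.+1 k.+1 = n.+1%:R * fock n k + y * fock n.+1 k.
  by rewrite -fock_lowering; ring.
elim: K => [|K IH].
  have := low 0; rewrite /fock_norm !big_ord1 !fact0 !mul1r => ->.
  by rewrite fockS0; ring.
rewrite fock_norm_recr IH [fock_norm n K.+2]fock_norm_recr [K.+2`!]factS natrM [K.+2%:R * _]mulrC -[in RHS](mulrA K.+1`!%:R).
by rewrite low fockSS; ring.
Qed.

(** A crude growth bound, whose purpose is to make the boundary term of [fock_normS] tend to 0. *)
Lemma fock_bound n : exists A B : R, [/\ 0 <= A, 0 <= B &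
  forall k, `|fock n k| <= A * (B ^+ k / k`!%:R)].
Proof.
elim: n => [|n [A [B [A0 B0 h]]]].
  exists 1, `|y|; split => // k.
  by rewrite fock0 mul1r normrM normrX normfV normr_nat.
(* Passing from k to k+1 costs a factor k+1 <= 2^(k+1), absorbed by the 2; the 1 added to B gives
   B^k <= (B+1)^(k+1). *)
exists (A * (1 + `|y|)), (2 * (B + 1)); split.
- by rewrite mulr_ge0// addr_ge0.
- by rewrite mulr_ge0// addr_ge0.
move=> k.
have B1 : B <= 2 * (B + 1) by lra.
case: k => [|k].
  rewrite fockS0 expr0 fact0 divr1 mulr1 normrM normrN.
  have := h 0%N; rewrite expr0 fact0 divr1 mulr1 => h0.
  apply: le_trans (ler_wpM2l (normr_ge0 y) h0) _.
  by rewrite mulrC ler_wpM2l// lerDr.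
rewrite fockSS (le_trans (ler_normB _ _))// normrM mulrDr mulrDl mulr1 lerD//.
  apply: le_trans (h k) _; rewrite ler_wpM2l//.
  rewrite factS natrM invfM mulrA ler_wpM2r ?invr_ge0//.
  rewrite ler_pdivlMr ?ltr0n// exprMn mulrC.
  rewrite ler_pM// ?exprn_ge0//.
    by rewrite -natrX ler_nat ltnW// ltn_expl.
  rewrite exprS (@le_trans _ _ ((B+1) ^+ k))//.
    by rewrite lerXn2r// ?nnegrE//; lra.
  by rewrite ler_peMl ?exprn_ge0//; lra.
apply: le_trans (ler_wpM2l (normr_ge0 y) (h k.+1)) _.
rewrite mulrCA -mulrA ler_wpM2l// ler_wpM2l// ler_wpM2r ?invr_ge0//.
by rewrite lerXn2r// nnegrE// mulr_ge0// addr_ge0.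
Qed.

Lemma cvg_fock_norm n : fock_norm n K @[K --> \oo] --> n`!%:R * expR (y ^+ 2).
Proof.
elim: n => [|n IH].
  rewrite fact0 mul1r.
  have -> : fock_norm 0 = series (exp_coeff (y ^+ 2)).
    apply/funext => K; rewrite /fock_norm /series /= big_mkord; apply: eq_bigr => i _.
    by rewrite fock0 /exp_coeff /= -exprM mulnC exprM; field; rewrite fact_neq0.
  exact: cvg_series_expR.
rewrite -(cvg_shiftn 1) /=.
have -> : (fun K => fock_norm n.+1 (K + 1)) =
   (fun K => n.+1%:R * fock_norm n (K + 1) - K.+1`!%:R * fock n.+1 K.+1 * fock n K).
  by apply/funext => K; rewrite addn1 fock_normS.
rewrite factS natrM -mulrA -[n.+1%:R * (_ * _)]subr0.
apply: cvgB.
  apply: cvgM; first exact: cvg_cst.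
  by rewrite (cvg_shiftn 1 (fock_norm n)).
have [A [B [A0 B0 hA]]] := fock_bound n.
have [A' [B' [A'0 B'0 hA']]] := fock_bound n.+1.
(* Inserting both growth bounds, the factorial (K+1)! cancels, and the boundary term is dominated by
   a multiple of the K-th term of the series of exp(B B'). *)
apply/norm_cvg0P.
apply: (@squeeze_cvgr _ _ _ _ (cst 0) (fun K => A * A' * B' * exp_coeff (B * B') K)).
- apply: nearW => K; rewrite normr_ge0 /= !normrM ger0_norm//.
  apply: (@le_trans _ _ (K.+1`!%:R * (A' * (B' ^+ K.+1 / K.+1`!%:R)) * (A * (B ^+ K / K`!%:R)))).
    by rewrite ler_pM// ?mulr_ge0// ler_wpM2l.
  rewrite /exp_coeff /= exprMn exprS le_eqVlt; apply/orP; left; apply/eqP.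
  by field; rewrite !fact_neq0.
- exact: cvg_cst.
- have := cvgM (cvg_cst (A * A' * B')) (@cvg_exp_coeff R (B * B')); rewrite mulr0; exact.
Qed.

Lemma fock_diag_le n : fock n n ^+ 2 <= expR (y ^+ 2).
Proof.
have f0 : 0 < n`!%:R :> R by rewrite ltr0n fact_gt0.
rewrite -(ler_pM2l f0); apply: (@le_trans _ _ (fock_norm n n.+1)).
  rewrite fock_norm_recr lerDr sumr_ge0// => i _.
  by rewrite mulr_ge0// sqr_ge0.
have cf := @cvg_fock_norm n; rewrite -(cvg_lim (@Rhausdorff R) cf).
apply: nondecreasing_cvgn_le; last by apply/cvg_ex; eexists; exact: cf.
apply/nondecreasing_seqP => K; rewrite fock_norm_recr lerDl.
by rewrite mulr_ge0// sqr_ge0.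
Qed.

End fock.

Lemma lag1_le {R : realType} n (x : R) : 0 <= x -> `|lag 1 n x| <= expR (x / 2).
Proof.
move=> x0; rewrite -(@ler_pXn2r _ 2)// ?nnegrE// ?expR_ge0// real_normK ?num_real//.
have := @fock_diag_le _ (Num.sqrt x) n; rewrite fock_diag sqr_sqrtr// => h.
by rewrite [expR _ ^+ 2]expr2 -expRD -splitr.
Qed.

(* L_n^a is a combination with nonnegative coefficients of the L_k^0, which
   reduces the bound to order 0. *)
Lemma lag_le {R : realType} (a : R) n (x : R) : 0 <= a -> 0 <= x ->
  `|lag (a + 1) n x| <= expR (x / 2) * lag (a + 1) n 0.
Proof.
move=> a0 x0; rewrite !lag_connection// mulr_sumr (le_trans (ler_norm_sum _ _ _))//.
apply: ler_sum => k _; rewrite normrM ger0_norm ?divr_ge0 ?poch_ge0//.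
rewrite lag_at0 poch1 divff ?fact_neq0// mulr1 mulrC ler_wpM2r ?lag1_le//.
by rewrite divr_ge0 ?poch_ge0.
Qed.

Lemma EFin_tonelli d1 d2 (T1 : measurableType d1) (T2 : measurableType d2)
    (R : realType) (m1 : {sigma_finite_measure set T1 -> \bar R})
    (m2 : {sigma_finite_measure set T2 -> \bar R}) (f : T1 -> T2 -> R) :
  measurable_fun setT (fun z : T1 * T2 => f z.1 z.2) -> (forall x y, 0 <= f x y) ->
  (\int[m1]_x \int[m2]_y (f x y)%:E = \int[m2]_y \int[m1]_x (f x y)%:E)%E.
Proof.
move=> mf f0; apply: (fubini_tonelli (fun z => (f z.1 z.2)%:E)) => [|z].
  exact/measurable_EFinP.
by rewrite lee_fin.
Qed.

(** * Gaussian moments and the Gamma function *)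

Section gaussian_moments.
Context {R : realType}.
Implicit Types (a b c e u x : R).
Notation mu := (@lebesgue_measure R).

Lemma gt0_continuous_powR a x : 0 < x -> {for x, continuous (fun y : R => y `^ a)}.
Proof.
move=> x0; apply: differentiable_continuous; apply/derivable1_diffP.
by apply: (@derivable_powR R 1 a); rewrite in_itv/= x0.
Qed.

Lemma ge0_continuous_powR a u : 0 <= a -> 0 <= u ->
  {within `[0, u], continuous (@powR R ^~ a : R -> R)}.
Proof.
rewrite !le_eqVlt => /predU1P[<- _|a0 /predU1P[<-|u0]].
- rewrite (_ : (fun x : R => x `^ 0) = cst 1); last by apply/funext => x; rewrite powRr0.
  exact/continuous_subspaceT/cst_continuous.
- by rewrite set_itv1; exact: continuous_subspace1.
- apply/continuous_within_itvP => //; split.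
  + by move=> x; rewrite in_itv/= => /andP[x0 _]; exact: gt0_continuous_powR.
  + by rewrite powR0 ?gt_eqF//; exact: powR_cvg0.
  + by apply: cvg_at_left_filter; exact: gt0_continuous_powR.
Qed.

Lemma integral_powR c u : 0 <= c -> 0 <= u ->
  (\int[mu]_(x in `[0%R, u]) ((c + 1) * x `^ c)%:E = (u `^ (c + 1))%:E)%E.
Proof.
move=> c0; rewrite le_eqVlt => /predU1P[<-|u0].
  by rewrite set_itv1 integral_set1 powR0// gt_eqF// ltr_wpDl.
rewrite (@continuous_FTC2 _ _ (@powR R ^~ (c + 1)))//.
- by rewrite powR0 ?sube0// gt_eqF// ltr_wpDl.
- move=> x; apply: cvgM; [exact: cvg_cst|exact: (ge0_continuous_powR c0 (ltW u0))].
- split.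
  + by move=> x; rewrite in_itv/= => /andP[x0 _]; apply: derivable_powR; rewrite in_itv/= x0.
  + rewrite powR0 ?gt_eqF ?ltr_wpDl//. apply: powR_cvg0. by rewrite ltr_wpDl.
  + by apply: cvg_at_left_filter; exact: gt0_continuous_powR.
- move=> x; rewrite in_itv/= => /andP[x0 _].
  rewrite powR_derive1 ?in_itv/= ?x0//. by rewrite addrK.
Qed.

Lemma is_derive_gauss e x :
  is_derive x 1 (fun x => expR (- (e * x ^+ 2))) (- (2 * e * x) * expR (- (e * x ^+ 2))).
Proof.
apply: is_derive_eq; rewrite /GRing.scale /=.
by rewrite !mulr1; ring.
Qed.

Lemma continuous_gauss e : continuous (fun x => expR (- (e * x ^+ 2))).
Proof.
move=> x; apply: differentiable_continuous; apply/derivable1_diffP.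
by have h := is_derive_gauss e x; apply: ex_derive.
Qed.

Lemma cvg_gauss_tail e : 0 < e -> expR (- (e * x ^+ 2)) @[x --> +oo] --> (0 : R).
Proof.
move=> e0; have := @cvg_gauss_fun R => h.
have -> : (fun x => expR (- (e * x ^+ 2))) = gauss_fun \o (fun x => x * Num.sqrt e).
  by apply/funext => x /=; rewrite /gauss_fun exprMn sqr_sqrtr ?ltW// mulrC.
apply: (cvg_comp _ _ _ h).
by apply: gt0_cvgMly; rewrite ?sqrtr_gt0//; exact: cvg_id.
Qed.

Lemma integral_gauss_tail e u : 0 < e -> 0 <= u ->
  (\int[mu]_(x in `[u, +oo[) (x * expR (- (e * x ^+ 2)))%:E =
   (expR (- (e * u ^+ 2)) / (2 * e))%:E)%E.
Proof.
move=> e0 u0; pose F x := - (expR (- (e * x ^+ 2)) / (2 * e)).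
have dF x : is_derive x 1 F (x * expR (- (e * x ^+ 2))).
  have h := is_derive_gauss e x; apply: is_derive_eq.
  by rewrite /GRing.scale /= mulr0 add0r; field; rewrite gt_eqF.
rewrite (@ge0_continuous_FTC2y _ _ F _ 0)//.
- by rewrite sub0e EFinN oppeK.
- by move=> x ux; rewrite mulr_ge0 ?expR_ge0// (le_trans u0).
- apply: continuous_subspaceT => x; apply: cvgM; [exact: cvg_id|exact: continuous_gauss].
- rewrite -oppr0 -(mul0r (2 * e)^-1).
  by apply: cvgN; apply: cvgM; [exact: cvg_gauss_tail|exact: cvg_cst].
- apply: cvg_at_right_filter; apply: differentiable_continuous.
  by apply/derivable1_diffP; have [] := dF u.
- by move=> x _; rewrite derive1E; have [_] := dF x.
Qed.

Definition gauss_moment c e : \bar R :=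
  (\int[mu]_(x in `[0%R, +oo[) (x `^ c * expR (- (e * x ^+ 2)))%:E)%E.

Lemma measurable_gauss e : measurable_fun [set: R] (fun x => expR (- (e * x ^+ 2))).
Proof. by apply: continuous_measurable_fun; exact: continuous_gauss. Qed.

Lemma measurable_powR_gauss c e :
  measurable_fun [set: R] (fun x => x `^ c * expR (- (e * x ^+ 2))).
Proof. by apply: measurable_funM; [exact: measurable_powR|exact: measurable_gauss]. Qed.

(** Integration by parts done with Tonelli: write x^(c+1) as the integral of (c+1) u^c over 0 <= u
    <= x, then integrate in x first, where x e^(-e x^2) has an explicit primitive. The region is
    encoded in [psi]. *)
Lemma gauss_momentS c e : 0 <= c -> 0 < e ->
  gauss_moment (c + 2) e = (((c + 1) / (2 * e))%:E * gauss_moment c e)%E.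
Proof.
move=> c0 e0.
pose psi x u := if (0 <= u) && (u <= x) then
  (c + 1) * u `^ c * (x * expR (- (e * x ^+ 2))) else 0.
have psi0 x u : 0 <= psi x u.
  rewrite /psi; case: ifPn => // /andP[z2 z1].
  by rewrite !mulr_ge0 ?powR_ge0 ?expR_ge0 ?addr_ge0// (le_trans z2).
have mpsi : measurable_fun [set: R * R] (fun z => psi z.1 z.2).
  apply: measurable_fun_ifT => //.
    by apply: measurable_and; apply: measurable_fun_ler.
  apply: measurable_funM.
    apply: measurable_funM => //.
    by apply: (measurableT_comp (measurable_powR _)).
  by apply: measurable_funM => //; apply: (measurableT_comp (measurable_gauss e)).
transitivity (\int[mu]_x \int[mu]_u (psi x u)%:E)%E.
  rewrite /gauss_moment integral_mkcond; apply: eq_integral => x _.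
  rewrite patchE mem_setE in_itv/= andbT; case: ifPn => x0; last first.
    rewrite integral0_eq// => u _; rewrite /psi; case: ifPn => // /andP[u0 ux].
    by rewrite (le_trans u0 ux) in x0.
  transitivity (\int[mu]_(u in `[0%R, x]) ((x * expR (- (e * x ^+ 2)))%:E * ((c + 1) * u `^ c)%:E))%E.
    rewrite ge0_integralZl_EFin//.
    - rewrite integral_powR// -EFinM; congr EFin.
      have -> : x `^ (c + 2) = x `^ (c + 1) * x.
        rewrite -[X in _ * X]powRr1// -powRD; first by congr (_ `^ _); ring.
        by apply/implyP; rewrite gt_eqF// addr_gt0// ltr_wpDl.
      by ring.
    - by move=> u; rewrite /= in_itv/= => /andP[u0 _]; rewrite lee_fin mulr_ge0 ?powR_ge0 ?addr_ge0.
    - apply: measurable_funTS; apply/measurable_EFinP; apply: measurable_funM => //; exact: measurable_powR.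
    - by rewrite mulr_ge0 ?expR_ge0.
  rewrite integral_mkcond; apply: eq_integral => u _.
  by rewrite patchE mem_setE in_itv/= /psi; case: ifPn => // _; rewrite -EFinM mulrC.
rewrite EFin_tonelli// /gauss_moment -ge0_integralZl_EFin//; last 3 first.
- by move=> u _; rewrite lee_fin mulr_ge0 ?powR_ge0 ?expR_ge0.
- by apply: measurable_funTS; apply/measurable_EFinP; exact: measurable_powR_gauss.
- by rewrite divr_ge0 ?addr_ge0// mulr_ge0// ltW.
rewrite [in RHS]integral_mkcond; apply: eq_integral => u _.
rewrite patchE mem_setE in_itv/= andbT; case: ifPn => u0; last first.
  by rewrite integral0_eq// => x _; rewrite /psi (negbTE u0).
transitivity (\int[mu]_(x in `[u, +oo[) (((c + 1) * u `^ c)%:E * (x * expR (- (e * x ^+ 2)))%:E))%E.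
  rewrite [RHS]integral_mkcond; apply: eq_integral => x _.
  by rewrite patchE mem_setE in_itv/= andbT /psi u0/=; case: ifPn.
rewrite ge0_integralZl_EFin//.
- by rewrite integral_gauss_tail// -!EFinM; congr EFin; field; rewrite gt_eqF.
- by move=> x; rewrite /= in_itv/= andbT => ux; rewrite lee_fin mulr_ge0 ?expR_ge0// (le_trans u0).
- by apply: measurable_funTS; apply/measurable_EFinP; apply: measurable_funM => //; exact: measurable_gauss.
- by rewrite mulr_ge0 ?powR_ge0// addr_ge0.
Qed.

Lemma gauss_moment1 e : 0 < e -> gauss_moment 1 e = ((2 * e)^-1)%:E.
Proof.
move=> e0; transitivity (\int[mu]_(x in `[0%R, +oo[) (x * expR (- (e * x ^+ 2)))%:E)%E.
  by apply: eq_integral => x; rewrite mem_setE in_itv/= andbT => x0; rewrite powRr1.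
by rewrite integral_gauss_tail// expr2 !mulr0 oppr0 expR0 div1r.
Qed.

(** The recursion starting at exponent 1 reaches the odd exponents; for any other c, x^c is at most
    1 on [0, 1] and at most an odd power beyond 1. *)
Lemma gauss_moment_lty c e : 0 <= c -> 0 < e -> (gauss_moment c e < +oo)%E.
Proof.
move=> c0 e0.
have odd_lty k : (gauss_moment (1 + (2 * k)%:R) e < +oo)%E.
  elim: k => [|k IH]; first by rewrite muln0 addr0 gauss_moment1// ltry.
  rewrite mulnS natrD [2 + _]addrC addrA gauss_momentS// ?addr_ge0//.
  by rewrite lte_mul_pinfty// lee_fin divr_ge0 ?addr_ge0// mulr_ge0// ltW.
pose k := (Num.trunc c).+1.
have ck : c <= 1 + (2 * k)%:R.
  have : c < k%:R by rewrite -truncn_lt_nat.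
  by rewrite natrM; lra.
apply: (@le_lt_trans _ _ (\int[mu]_(x in `[0%R, +oo[) (\1_(`[0, 1]) x)%:E +
    gauss_moment (1 + (2 * k)%:R) e)%E).
  have mG b : measurable_fun (`[0%R, +oo[ : set R) (fun x => (x `^ b * expR (- (e * x ^+ 2)))%:E).
    by apply: measurable_funTS; apply/measurable_EFinP; exact: measurable_powR_gauss.
  have G0 b x : `[0%R, +oo[%classic x -> (0 <= (x `^ b * expR (- (e * x ^+ 2)))%:E)%E.
    by move=> _; rewrite lee_fin mulr_ge0 ?powR_ge0 ?expR_ge0.
  have m1 : measurable_fun (`[0%R, +oo[ : set R) (fun x : R => (\1_(`[0, 1]) x : R)%:E).
    by apply: measurable_funTS; apply/measurable_EFinP; exact: measurable_indic.
  have i0 (x : R) : `[0%R, +oo[%classic x -> (0 <= (\1_(`[0, 1]) x : R)%:E)%E.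
    by move=> _; rewrite lee_fin.
  rewrite -ge0_integralD//; [|exact: G0|exact: mG].
  apply: ge0_le_integral => //.
  - exact: G0.
  - exact: mG.
  - by apply: emeasurable_funD; [exact: m1|exact: mG].
  move=> x; rewrite /= in_itv/= andbT => x0; rewrite lee_fin indicE mem_setE in_itv/= x0/=.
  case: (leP x 1) => x1 /=.
    rewrite (@le_trans _ _ 1)//; last by rewrite lerDl mulr_ge0 ?powR_ge0 ?expR_ge0.
    rewrite mulr_ile1 ?powR_ge0 ?expR_ge0//.
      by apply: (@le_trans _ _ (1 `^ c)); [rewrite ge0_ler_powR ?nnegrE|rewrite powR1].
    by rewrite expR_le1 oppr_le0 mulr_ge0 ?sqr_ge0// ltW.
  by rewrite add0r ler_wpM2r ?expR_ge0// ler_powR// ltW.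
rewrite lte_add_pinfty// (@le_lt_trans _ _ (mu `[0, 1]))//.
  rewrite integral_indic//; apply: le_measure; rewrite ?inE//; exact: measurableI.
by rewrite lebesgue_measure_itv/= lte01 ltry.
Qed.

Lemma gauss_moment_gt0 c e : 0 <= c -> 0 < e -> (0 < gauss_moment c e)%E.
Proof.
move=> c0 e0; apply: (@lt_le_trans _ _ (\int[mu]_(x in `[1%R, 2%R]) (expR (- (e * 4)))%:E)%E).
  rewrite integral_cst//= lebesgue_measure_itv/= lte_fin ltr1n -EFinD -EFinM lte_fin.
  by rewrite mulr_gt0 ?expR_gt0//; lra.
apply: (@le_trans _ _ (\int[mu]_(x in `[1%R, 2%R]) (x `^ c * expR (- (e * x ^+ 2)))%:E)%E).
  apply: ge0_le_integral => //.
  - by apply: measurable_funTS; apply/measurable_EFinP; exact: measurable_powR_gauss.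
  move=> x; rewrite /= in_itv/= => /andP[x1 x2]; rewrite lee_fin -[leLHS]mul1r ler_pM ?expR_ge0//.
    apply: (@le_trans _ _ (1 `^ c)); first by rewrite powR1.
    by rewrite ge0_ler_powR ?nnegrE// (le_trans _ x1).
  rewrite ler_expR lerN2 ler_pM2l//; nra.
apply: ge0_subset_integral => //.
- by apply: measurable_funTS; apply/measurable_EFinP; exact: measurable_powR_gauss.
- by move=> x _; rewrite lee_fin mulr_ge0 ?powR_ge0 ?expR_ge0.
- by move=> x; rewrite /= !in_itv/= andbT => /andP[x1 _]; rewrite (le_trans _ x1).
Qed.

End gaussian_moments.

(** * The Gamma function through Gaussian moments *)

Section gamma.
Context {R : realType}.
Implicit Types (a b c e u x : R).
Notation mu := (@lebesgue_measure R).

Lemma cvg_powRy a : 0 < a -> (x `^ a @[x --> +oo] --> +oo).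
Proof.
move=> a0; apply/cvgryPge => A; near=> x.
have x0 : 0 <= x by near: x; exact: nbhs_pinfty_ge.
have xA : `|A| `^ a^-1 <= x by near: x; exact: nbhs_pinfty_ge.
apply: (@le_trans _ _ ((`|A| `^ a^-1) `^ a)).
  by rewrite -powRrM mulVf ?gt_eqF// powRr1// ler_norm.
by rewrite ge0_ler_powR ?nnegrE ?powR_ge0 ?(ltW a0).
Unshelve. all: by end_near. Qed.

(** The substitution x = (y/e)^(1/2), performed away from 0 because the derivative of the square
    root blows up there; [gauss_momentE] then lets d tend to 0. *)
Lemma gauss_moment_subst a e (d : R) : 2^-1 <= a -> 0 < e -> 0 < d ->
  (\int[mu]_(x in `[(e `^ (- 2^-1) * d `^ 2^-1)%R, +oo[) (x `^ (2 * a - 1) * expR (- (e * x ^+ 2)))%:E =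
   (e `^ (- a) / 2)%:E * \int[mu]_(x in `[d, +oo[) (x `^ (a - 1) * expR (- x))%:E)%E.
Proof.
move=> a2 e0 d0; set k := e `^ (- 2^-1); pose F x := k * x `^ 2^-1.
have k0 : 0 < k by rewrite powR_gt0.
have dF x : 0 < x -> is_derive x 1 F (k / 2 * x `^ (- 2^-1)).
  move=> x0; have h := is_derive1_powR 2^-1 x0.
  apply: is_derive_eq; rewrite /GRing.scale /= mulrA; congr (_ * _ `^ _); lra.
have dFE x : 0 < x -> F^`()%classic x = k / 2 * x `^ (- 2^-1).
  by move=> x0; rewrite derive1E; have [_] := dF _ x0.
have cF' x : 0 < x -> {for x, continuous F^`()%classic}.
  move=> x0; rewrite /prop_for /continuous_at dFE//.
  apply: (@cvg_trans _ ((fun x => k / 2 * x `^ (- 2^-1)) @ x)).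
    by apply: near_eq_cvg; near=> y; rewrite dFE//; near: y; exact: lt_nbhsr.
  exact: (cvgM (cvg_cst _) (gt0_continuous_powR (a:=- 2^-1) x0)).
rewrite (@increasing_ge0_integration_by_substitutiony _ F).
- rewrite -ge0_integralZl_EFin//; last 3 first.
  + by move=> x _; rewrite lee_fin mulr_ge0 ?powR_ge0 ?expR_ge0.
  + apply: measurable_funTS; apply/measurable_EFinP; apply: measurable_funM.
      exact: measurable_powR.
    by apply: measurableT_comp.
  + by rewrite divr_ge0 ?powR_ge0.
  apply: eq_integral => x; rewrite mem_setE in_itv/= andbT => dx.
  have x0 : 0 < x by exact: lt_le_trans dx.
  rewrite -EFinM; congr EFin; rewrite /= [X in X * _ = _]/= [F^`()%classic]lock.
  transitivity (F x `^ (2 * a - 1) * expR (- (e * F x ^+ 2)) * (locked F^`()%classic) x); first by [].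
  rewrite -lock dFE//.
  have -> : e * F x ^+ 2 = x.
    rewrite /F exprMn /k powRN exprVn !powR12_sqrt ?ltW// !sqr_sqrtr ?ltW//.
    by rewrite mulrA mulfV ?mul1r// gt_eqF.
  rewrite /F powRM ?powR_ge0// -!(powRrM x).
  have -> : e `^ (- a) = k `^ (2 * a - 1) * k.
    rewrite -[X in _ * X]powRr1 ?ltW// -powRD; last by apply/implyP => _; rewrite gt_eqF.
    by rewrite /k -powRrM; congr (_ `^ _); lra.
  have -> : x `^ (a - 1) = x `^ (2^-1 * (2 * a - 1)) * x `^ (- 2^-1).
    rewrite -powRD; last by apply/implyP => _; rewrite gt_eqF.
    by congr (_ `^ _); lra.
  ring.
- move=> x y; rewrite !in_itv/= !andbT => dx dy xy; rewrite /F ltr_pM2l//.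
  by rewrite gt0_ltr_powR ?nnegrE// ltW// (lt_le_trans d0).
- by move=> x; rewrite in_itv/= andbT => dx; apply: cF'; exact: lt_trans dx.
- by apply/cvg_ex; exists (F^`()%classic d); apply: cvg_at_right_filter; exact: cF'.
- apply/cvg_ex; exists (k / 2 * 0).
  apply: (@cvg_trans _ ((fun x => k / 2 * x `^ (- 2^-1)) @ +oo)).
    by apply: near_eq_cvg; near=> y; rewrite dFE//; near: y; exact: nbhs_pinfty_gt.
  apply: cvgM; first exact: cvg_cst.
  have -> : (fun x => x `^ (- 2^-1)) = (fun x : R => (x `^ 2^-1)^-1).
    by apply/funext => x; rewrite powRN.
  have p0 : \forall x \near +oo, 0 < (x : R) `^ 2^-1.
    by near=> x; rewrite powR_gt0//; near: x; exact: nbhs_pinfty_gt.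
  by apply: (gtr0_cvgV0 p0).2; apply: cvg_powRy; rewrite invr_gt0.
- split; first by move=> x; rewrite in_itv/= andbT => dx; have [] := dF _ (lt_trans d0 dx).
  apply: cvg_at_right_filter; apply: differentiable_continuous.
  by apply/derivable1_diffP; have [] := dF _ d0.
- rewrite /F; apply: gt0_cvgMry => //; exact: cvg_powRy.
- have Fd0 : 0 < k * d `^ 2^-1 by rewrite mulr_gt0 ?powR_gt0.
  have cG x : 0 < x -> {for x, continuous (fun x => x `^ (2 * a - 1) * expR (- (e * x ^+ 2)))}.
    by move=> x0; apply: cvgM; [exact: gt0_continuous_powR|exact: continuous_gauss].
  apply/continuous_within_itvcyP; split.
    by move=> x; rewrite in_itv/= andbT => dx; apply: cG; exact: lt_trans dx.
  by apply: cvg_at_right_filter; exact: cG.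
- by move=> x _; rewrite mulr_ge0 ?powR_ge0 ?expR_ge0.
Unshelve. all: by end_near. Qed.

Let cvg_itv_oo (f : R -> R) (d : nat -> R) : measurable_fun setT f ->
  (forall x, 0 <= f x) -> (forall n, 0 < d n) ->
  {homo d : n m / (n <= m)%N >-> m <= n} -> (d @ \oo --> 0) ->
  ((\int[mu]_(x in `[d n, +oo[) (f x)%:E)%E @[n --> \oo] -->
   (\int[mu]_(x in `]0%R, +oo[) (f x)%:E)%E).
Proof.
move=> mf f0 d0 dd cd.
have -> : `]0%R, +oo[%classic = \bigcup_n (`[d n, +oo[%classic : set R).
  apply/seteqP; split => x /=.
    rewrite in_itv/= andbT => x0.
    have /cvgrPdist_lt /(_ _ x0)[N _ /(_ N (leqnn N))] := cd.
    by rewrite sub0r normrN ger0_norm ?ltW// => ?; exists N => //=; rewrite in_itv/= andbT ltW.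
  by move=> [n _] /=; rewrite !in_itv/= !andbT; exact: lt_le_trans.
apply: ge0_nondecreasing_set_cvg_integral => //.
- move=> n m nm; apply/subsetPset => x /=; rewrite !in_itv/= !andbT; apply: le_trans.
  exact: dd.
- by move=> n; apply: measurable_funTS; apply/measurable_EFinP.
- by move=> n x _; rewrite lee_fin.
Qed.

Lemma gauss_momentE a e : 2^-1 <= a -> 0 < e ->
  gauss_moment (2 * a - 1) e =
  ((e `^ (- a) / 2)%:E * \int[mu]_(x in `]0%R, +oo[) (x `^ (a - 1) * expR (- x))%:E)%E.
Proof.
move=> a2 e0.
pose d n : R := n.+1%:R^-1.
have d0 n : 0 < d n by rewrite invr_gt0.
have dd : {homo d : n m / (n <= m)%N >-> m <= n}.
  by move=> n m nm; rewrite lef_pV2 ?posrE// ler_nat.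
have cd : d @ \oo --> 0 by exact: cvg_harmonic.
pose d' n := e `^ (- 2^-1) * d n `^ 2^-1.
rewrite /gauss_moment -integral_itv_obnd_cbnd; last first.
  by apply: measurable_funTS; apply/measurable_EFinP; exact: measurable_powR_gauss.
have h1 : (\int[mu]_(x in `[d' n, +oo[) (x `^ (2 * a - 1) * expR (- (e * x ^+ 2)))%:E @[n --> \oo] -->
    \int[mu]_(x in `]0%R, +oo[) (x `^ (2 * a - 1) * expR (- (e * x ^+ 2)))%:E)%E.
  apply: cvg_itv_oo.
  - exact: measurable_powR_gauss.
  - by move=> x; rewrite mulr_ge0 ?powR_ge0 ?expR_ge0.
  - by move=> n; rewrite mulr_gt0 ?powR_gt0.
  - move=> n m nm; rewrite ler_wpM2l ?powR_ge0// ge0_ler_powR ?nnegrE ?(ltW (d0 _))//.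
    exact: dd.
  - rewrite -(mulr0 (e `^ (- 2^-1))); apply: cvgM; first exact: cvg_cst.
    have p0 : (0 : R) < 2^-1 by rewrite invr_gt0.
    by have /cvg_at_rightP := powR_cvg0 p0; apply.
have h2 : (\int[mu]_(x in `[d n, +oo[) (x `^ (a - 1) * expR (- x))%:E @[n --> \oo] -->
    \int[mu]_(x in `]0%R, +oo[) (x `^ (a - 1) * expR (- x))%:E)%E.
  apply: cvg_itv_oo => //.
  - apply: measurable_funM; first exact: measurable_powR.
    by apply: measurableT_comp.
  - by move=> x; rewrite mulr_ge0 ?powR_ge0 ?expR_ge0.
rewrite -(cvg_lim (@ereal_hausdorff R) h1); apply: cvg_lim => //.
under eq_fun do rewrite gauss_moment_subst//.
by apply: cvgeZl.
Qed.

Let gauss_moment_arg a : 2^-1 <= a -> 0 <= 2 * a - 1.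
Proof. by lra. Qed.

(** Since [Gamma] is the real part of an extended integral, this amounts to finiteness, which is
    inherited from the Gaussian moment at e = 1. *)
Lemma Gamma_EFin a : 2^-1 <= a ->
  (\int[mu]_(x in `]0%R, +oo[) (x `^ (a - 1) * expR (- x))%:E = (Gamma a)%:E)%E.
Proof.
move=> a2; rewrite /Gamma /Rintegral fineK//.
have := gauss_momentE a2 ltr01; rewrite powR1 => h.
have /= := gauss_moment_lty (gauss_moment_arg a2) (@ltr01 R); rewrite h.
have : (0 <= \int[mu]_(x in `]0%R, +oo[) (x `^ (a - 1) * expR (- x))%:E)%E.
  by apply: integral_ge0 => x _; rewrite lee_fin mulr_ge0 ?powR_ge0 ?expR_ge0.
case: (\int[mu]_(_ in _) _)%E => //= _.
by rewrite gt0_muley ?ltxx// lte_fin.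
Qed.

Lemma gauss_moment_Gamma a e : 2^-1 <= a -> 0 < e ->
  gauss_moment (2 * a - 1) e = (e `^ (- a) / 2 * Gamma a)%:E.
Proof. by move=> a2 e0; rewrite gauss_momentE// Gamma_EFin. Qed.

Lemma Gamma_gt0 a : 2^-1 <= a -> 0 < Gamma a.
Proof.
move=> a2; have := gauss_moment_gt0 (gauss_moment_arg a2) (@ltr01 R).
rewrite gauss_moment_Gamma// powR1 lte_fin pmulr_rgt0//.
Qed.

(** The moment recursion with c = 2a - 1 and e = 1; the condition a >= 1/2 is c >= 0. *)
Lemma GammaS a : 2^-1 <= a -> Gamma (a + 1) = a * Gamma a.
Proof.
move=> a2; have a12 : 2^-1 <= a + 1 by lra.
have := gauss_momentS (gauss_moment_arg a2) (@ltr01 R).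
have -> : 2 * a - 1 + 2 = 2 * (a + 1) - 1 by lra.
rewrite !gauss_moment_Gamma// !powR1 -EFinM => -[].
by lra.
Qed.

Lemma Gamma_poch a k : 2^-1 <= a -> Gamma (a + k%:R) = poch a k * Gamma a.
Proof.
move=> a2; elim: k => [|k IH]; first by rewrite addr0 poch0 mul1r.
rewrite -natr1 addrA GammaS; last by rewrite (le_trans a2)// lerDl.
by rewrite IH pochSr; ring.
Qed.

End gamma.

(** * Bessel functions *)

Section cauchy_product.
Context {R : realType}.
Implicit Types a c : R ^nat.

Definition conv a c n : R := \sum_(i < n.+1) a (n - i)%N * c i.

Lemma series_conv a c N : series (conv a c) N = \sum_(i < N) c i * series a (N - i)%N.
Proof.
elim: N => [|N IH]; first by rewrite /series /= big_nil big_ord0.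
rewrite seriesSr IH [in RHS]big_ord_recr /= subSnn /conv [X in _ + X]big_ord_recr /= subnn.
rewrite [series a 1]seriesSr [series a 0]big_geq// add0r [c N * _]mulrC addrA; congr (_ + _).
rewrite -big_split /=; apply: eq_bigr => i _; rewrite subSn; last exact: ltnW.
by rewrite seriesSr; ring.
Qed.

Lemma ge0_nondecreasing_series a : (forall i, 0 <= a i) -> nondecreasing_seq (series a).
Proof. by move=> a0; apply: nondecreasing_series => i _ _; exact: a0. Qed.

(** Partial sums of the product run over the triangle i + j < n, which lies in the square of side n,
    itself contained in the triangle of size 2n. *)
Lemma ge0_cvg_series_conv a c (A C : R) : (forall i, 0 <= a i) -> (forall i, 0 <= c i) ->
  series a @ \oo --> A -> series c @ \oo --> C -> series (conv a c) @ \oo --> A * C.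
Proof.
move=> a0 c0 cA cC.
have nda := ge0_nondecreasing_series a0.
have ndc := ge0_nondecreasing_series c0.
have conv0 i : 0 <= conv a c i by apply: sumr_ge0 => j _; rewrite mulr_ge0.
have ndS := ge0_nondecreasing_series conv0.
have leA n : series a n <= A.
  by rewrite -(cvg_lim (@Rhausdorff R) cA); apply: nondecreasing_cvgn_le => //; apply/cvg_ex; exists A.
have leC n : series c n <= C.
  by rewrite -(cvg_lim (@Rhausdorff R) cC); apply: nondecreasing_cvgn_le => //; apply/cvg_ex; exists C.
have s0 (b : R ^nat) n : (forall i, 0 <= b i) -> 0 <= series b n.
  by move=> b0; apply: sumr_ge0 => i _; exact: b0.
have Sle n : series (conv a c) n <= series a n * series c n.
  rewrite series_conv mulrC /series /= [X in X * _]big_mkord mulr_suml; apply: ler_sum => i _.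
  by rewrite ler_wpM2l//; apply: nda; exact: leq_subr.
have leS n : series a n * series c n <= series (conv a c) (n + n).
  rewrite series_conv big_split_ord /= ler_wpDr//.
    by apply: sumr_ge0 => i _; rewrite mulr_ge0// s0.
  rewrite mulrC /series /= [X in X * _]big_mkord mulr_suml; apply: ler_sum => i _.
  by rewrite ler_wpM2l//; apply: nda; rewrite -addnBA ?leq_addr// ltnW.
have bS n : series (conv a c) n <= A * C.
  by apply: le_trans (Sle n) _; rewrite ler_pM// s0.
have cS : cvgn (series (conv a c)).
  by apply: nondecreasing_is_cvgn => //; exists (A * C) => _ [n _ <-]; exact: bS.
suff -> : A * C = limn (series (conv a c)) by [].
apply/eqP; rewrite eq_le; apply/andP; split; last first.
  by apply: limr_le => //; apply: nearW.
have cAC : (fun n => series a n * series c n) @ \oo --> A * C by exact: cvgM.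
rewrite -(cvg_lim (@Rhausdorff R) cAC).
apply: limr_le; first by apply/cvg_ex; exists (A * C).
apply: nearW => n; apply: le_trans (leS n) _.
exact: nondecreasing_cvgn_le.
Qed.

(** Square minus triangle is bounded in absolute value by the same difference for the series of
    absolute values, which tends to 0 by the nonnegative case. *)
Lemma cvg_series_conv a c (A C : R) :
  cvgn [normed series a] -> cvgn [normed series c] ->
  series a @ \oo --> A -> series c @ \oo --> C -> series (conv a c) @ \oo --> A * C.
Proof.
move=> na nc cA cC.
pose a' i := `|a i|; pose c' i := `|c i|.
have h' : series (conv a' c') @ \oo --> limn (series a') * limn (series c').
  by apply: ge0_cvg_series_conv => // i; rewrite /a' /c'.
have hM : (fun n => series a' n * series c' n) @ \oo --> limn (series a') * limn (series c').
  exact: cvgM.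
have hd : (fun n => series a n * series c n - series (conv a c) n) @ \oo --> 0.
  apply/norm_cvg0P; apply: (@squeeze_cvgr _ _ _ _ (cst 0)
      (fun n => series a' n * series c' n - series (conv a' c') n)).
  - apply: nearW => n; rewrite normr_ge0 /= !series_conv.
    have diff (u v : R ^nat) : series u n * series v n - \sum_(i < n) v i * series u (n - i)%N =
        \sum_(i < n) v i * (series u n - series u (n - i)%N).
      rewrite mulrC {1}/series /= [X in X * _]big_mkord mulr_suml -sumrB.
      by apply: eq_bigr => i _; rewrite mulrBr.
    rewrite !diff (le_trans (ler_norm_sum _ _ _))//; apply: ler_sum => i _.
    rewrite normrM ler_wpM2l// !sub_series leq_subr.
    exact: ler_norm_sum.
  - exact: cvg_cst.
  - have := cvgB hM h'; rewrite subrr; exact.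
have h := cvgB (cvgM cA cC) hd; rewrite subr0 in h.
suff -> : series (conv a c) = (fun n => series a n * series c n -
    (series a n * series c n - series (conv a c) n)) by exact: h.
by apply/funext => n; rewrite subKr.
Qed.

End cauchy_product.

Section bessel.
Context {R : realType}.
Implicit Types b x y T : R.

Definition bes_coef b k : R := (-1) ^+ k / (k`!%:R * poch b k).

(* j_(b - 1)(z) = bes b ((z / 2)^2). *)
Definition bes b y : R := limn (pseries (bes_coef b) y).

(** Every factor of (b)_k is at least 1/2, so (b)_k >= 2^(-k) and the exponential series
    dominates. *)
Lemma bes_coef_bound b x k : 2^-1 <= b ->
  `|bes_coef b k * x ^+ k| <= exp_coeff (2 * `|x|) k.
Proof.
move=> b2; have b0 : 0 < b by rewrite (lt_le_trans _ b2).
have h : 2^-1 ^+ k <= poch b k.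
  elim: k => [|k IH]; first by rewrite expr0 poch0.
  rewrite exprSr pochSr ler_pM ?exprn_ge0//.
  by rewrite (le_trans b2)// lerDl.
rewrite /exp_coeff /= normrM normrX /bes_coef normrM normrX normrN1 expr1n mul1r.
rewrite normfV normrM normr_nat ger0_norm ?poch_ge0 ?(ltW b0)//.
rewrite exprMn [2 ^+ k * _]mulrC -mulrA [leLHS]mulrC ler_wpM2l ?exprn_ge0//.
rewrite invfM mulrC ler_wpM2r ?invr_ge0//.
rewrite -[2]invrK exprVn lef_pV2 ?posrE ?exprn_gt0 ?invr_gt0 ?poch_gt0//.
Qed.

Lemma is_cvg_normed_bes b x : 2^-1 <= b ->
  cvgn [normed series (fun k => bes_coef b k * x ^+ k)].
Proof.
move=> b2; apply: (@series_le_cvg _ _ (exp_coeff (2 * `|x|))) => //.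
- by move=> n; exact: normr_ge0.
- by move=> n; apply: exp_coeff_ge0; rewrite mulr_ge0.
- by move=> n; exact: bes_coef_bound.
- exact: is_cvg_series_exp_coeff.
Qed.

Lemma cvg_bes b x : 2^-1 <= b -> pseries (bes_coef b) x @ \oo --> bes b x.
Proof. by move=> b2; apply: normed_cvg; exact: is_cvg_normed_bes. Qed.

Lemma pseriesZ (r : R) (c : R ^nat) x :
  pseries (fun k => r * c k) x = series (r *: (fun i => c i * x ^+ i)).
Proof. by apply/funext => n; apply: eq_bigr => i _; rewrite /= -mulrA. Qed.

Lemma bes_diffs b : 0 < b ->
  pseries_diffs (bes_coef b) = fun k => (- b^-1) * bes_coef (b + 1) k.
Proof.
move=> b0; apply/funext => k; rewrite /pseries_diffs /bes_coef pochS factS natrM exprS.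
by field; rewrite fact_neq0 (addrC 1) natr1 pnatr_eq0 !gt_eqF// poch_gt0// addr_gt0.
Qed.

Lemma cvg_bes_diffs b x : 2^-1 <= b ->
  pseries (pseries_diffs (bes_coef b)) x @ \oo --> - b^-1 * bes (b + 1) x.
Proof.
move=> b2; have b12 : 2^-1 <= b + 1 by rewrite (le_trans b2)// lerDl.
have b0 : 0 < b by rewrite (lt_le_trans _ b2).
rewrite bes_diffs// pseriesZ; have h : cvgn (pseries (bes_coef (b + 1)) x).
  by apply/cvg_ex; eexists; exact: cvg_bes.
rewrite -[_ * _](lim_seriesZ _ h); exact: is_cvg_seriesZ.
Qed.

Lemma is_derive_bes b x : 2^-1 <= b -> is_derive x 1 (bes b) (- b^-1 * bes (b + 1) x).
Proof.
move=> b2; have b12 : 2^-1 <= b + 1 by rewrite (le_trans b2)// lerDl.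
have b0 : 0 < b by rewrite (lt_le_trans _ b2).
rewrite -(cvg_lim (@Rhausdorff R) (@cvg_bes_diffs b x b2)).
apply: (@pseries_snd_diffs _ _ (`|x| + 1)).
- by apply/cvg_ex; eexists; exact: cvg_bes.
- by apply/cvg_ex; eexists; exact: cvg_bes_diffs.
- have -> : pseries_diffs (pseries_diffs (bes_coef b)) =
    (fun k => - b^-1 * pseries_diffs (bes_coef (b + 1)) k).
    by rewrite (bes_diffs b0); apply/funext => k; rewrite /pseries_diffs mulrCA.
  rewrite pseriesZ; apply: is_cvg_seriesZ.
  by apply/cvg_ex; eexists; exact: cvg_bes_diffs.
- by rewrite [ltRHS]ger0_norm ?addr_ge0// ltrDl.
Qed.

Lemma bes0 b : 2^-1 <= b -> bes b 0 = 1.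
Proof.
move=> b2; apply/cvg_lim => //; rewrite -cvg_shiftS /=.
rewrite (_ : (fun n => _) = cst 1); first exact: cvg_cst.
apply/funext => n; rewrite /pseries /series /= big_nat_recl//= big1.
  by rewrite addr0 /bes_coef poch0 fact0 !expr0 !mulr1 divr1.
by move=> i _; rewrite exprS mul0r mulr0.
Qed.

(** Bessel's differential equation in disguise, because differentiating [bes] raises b by 1. *)
Lemma bes_ode b x : 2^-1 <= b ->
  x * bes (b + 2) x = b * (b + 1) * (bes (b + 1) x - bes b x).
Proof.
move=> b2; have b0 : 0 < b by rewrite (lt_le_trans _ b2).
have bn k : 2^-1 <= b + k%:R by rewrite (le_trans b2)// lerDl.
have h2 := cvg_bes (x := x) (bn 2%N); have h1 := cvg_bes (x := x) (bn 1%N).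
have h0 := cvg_bes (x := x) b2.
have H1 : (fun n => x * pseries (bes_coef (b + 2)) x n) @ \oo --> x * bes (b + 2) x.
  by apply: cvgM => //; exact: cvg_cst.
have H2 : (fun n => b * (b + 1) * (pseries (bes_coef (b + 1)) x n - pseries (bes_coef b) x n))
    @ \oo --> b * (b + 1) * (bes (b + 1) x - bes b x).
  by apply: cvgM; [exact: cvg_cst|exact: cvgB].
(* The factor x raises degrees by one, so n terms on the left match n+1 terms on the right, the
   constant terms there cancelling. *)
rewrite -cvg_shiftS /= in H2.
rewrite -(cvg_lim (@Rhausdorff R) H1) -(cvg_lim (@Rhausdorff R) H2); congr (limn _).
apply/funext; elim => [|n IH].
  by rewrite /pseries /series /= !big_nat1 big_geq// /bes_coef !poch0 mulr0 subrr mulr0.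
have pS c n' : pseries (bes_coef c) x n'.+1 = pseries (bes_coef c) x n' + bes_coef c n' * x ^+ n'.
  by rewrite /pseries seriesSr.
rewrite pS mulrDr IH [in RHS]pS [pseries _ _ n.+2 in X in _ = _ * (_ - X)]pS.
have -> : b * (b + 1) * (pseries (bes_coef (b + 1)) x n.+1 + bes_coef (b + 1) n.+1 * x ^+ n.+1 -
    (pseries (bes_coef b) x n.+1 + bes_coef b n.+1 * x ^+ n.+1)) =
  b * (b + 1) * (pseries (bes_coef (b + 1)) x n.+1 - pseries (bes_coef b) x n.+1) +
  b * (b + 1) * (bes_coef (b + 1) n.+1 - bes_coef b n.+1) * x ^+ n.+1 by ring.
congr (_ + _); suff -> : b * (b + 1) * (bes_coef (b + 1) n.+1 - bes_coef b n.+1) =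
    bes_coef (b + 2) n by rewrite exprS; ring.
have p0 : 0 < poch (b + 2) n by rewrite poch_gt0// addr_gt0.
have n0 : 0 < b + 1 + n%:R by rewrite ltr_wpDr// addr_gt0.
have pE : poch (b + 1) n.+1 = (b + 1) * poch (b + 2) n.
  by rewrite pochS; congr (_ * poch _ _); ring.
have qE : poch b n.+1 = b * ((b + 1) * poch (b + 2) n / (b + 1 + n%:R)).
  by rewrite pochS; congr (_ * _); rewrite -pE pochSr mulfK// gt_eqF.
rewrite /bes_coef pE qE factS natrM exprS; field.
by rewrite fact_neq0 (addrC 1 n%:R) natr1 pnatr_eq0 !gt_eqF// addr_gt0.
Qed.

(** With x = (t/2)^2 and j(t) = bes b x, [En] is the energy j^2 + j'^2 of the damped oscillator j''
    + ((2b-1)/t) j' + j = 0. It decreases because the damping is nonnegative for b >= 1/2, and it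
    starts at 1. *)
Lemma bes_le1 b x : 2^-1 <= b -> 0 <= x -> `|bes b x| <= 1.
Proof.
move=> b2 x0; have b0 : 0 < b by rewrite (lt_le_trans _ b2).
have b12 : 2^-1 <= b + 1 by rewrite (le_trans b2)// lerDl.
pose En y := bes b y ^+ 2 + y * (bes (b + 1) y / b) ^+ 2.
have dEn y : is_derive y 1 En ((1 - 2 * b) * (bes (b + 1) y / b) ^+ 2).
  have h1 := is_derive_bes y b2; have h2 := is_derive_bes y b12.
  apply: is_derive_eq; rewrite /GRing.scale /=.
  have ode := bes_ode y b2; have -> : b + 1 + 1 = b + 2 by ring.
  move: ode; move: (bes (b + 2) y) (bes (b + 1) y) (bes b y) => S Q P ode.
  transitivity (- 2 * P * Q / b + (Q / b) ^+ 2 - 2 * Q / (b ^+ 2 * (b + 1)) * (y * S)).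
    by field; rewrite !gt_eqF// addr_gt0.
  by rewrite ode; field; rewrite !gt_eqF// addr_gt0.
have En0 : En 0 = 1 by rewrite /En mul0r addr0 bes0// expr1n.
have Enx : En x <= 1.
  rewrite -En0; apply: (@ler0_derive1_nincry _ En 0) => //.
  - by move=> y _; rewrite derive1E; have [_ ->] := dEn y; rewrite mulr_le0_ge0 ?sqr_ge0//; lra.
  - apply: continuous_subspaceT => y; apply: differentiable_continuous.
    by apply/derivable1_diffP; have [] := dEn y.
rewrite -(@ler_pXn2r _ 2)// ?nnegrE// expr1n real_normK ?num_real//.
by apply: le_trans Enx; rewrite lerDl mulr_ge0// sqr_ge0.
Qed.

Lemma continuous_bes b : 2^-1 <= b -> continuous (bes b).
Proof.
move=> b2 x; apply: differentiable_continuous; apply/derivable1_diffP.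
by have [] := is_derive_bes x b2.
Qed.

Lemma lag_conv b T y n : 0 < b ->
  conv (exp_coeff T) (fun i => bes_coef b i * (y * T) ^+ i) n =
  T ^+ n / poch b n * lag b n y.
Proof.
move=> b0; rewrite /conv /lag mulr_sumr; apply: eq_bigr => i _.
have lin : (i <= n)%N by rewrite -ltnS.
have -> : T ^+ n = T ^+ (n - i) * T ^+ i by rewrite -exprD subnK.
rewrite /exp_coeff /= /bes_coef /lag_coef exprMn.
by field; rewrite !fact_neq0 !gt_eqF ?poch_gt0.
Qed.

Lemma cvg_lag_generating b T y : 2^-1 <= b ->
  series (fun n => T ^+ n / poch b n * lag b n y) @ \oo --> expR T * bes b (y * T).
Proof.
move=> b2; have b0 : 0 < b by rewrite (lt_le_trans _ b2).
rewrite (_ : (fun n => _) = conv (exp_coeff T) (fun i => bes_coef b i * (y * T) ^+ i)); last first.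
  by apply/funext => n; rewrite lag_conv.
apply: cvg_series_conv.
- rewrite normed_series_exp_coeff; exact: is_cvg_series_exp_coeff.
- exact: is_cvg_normed_bes.
- exact: cvg_series_expR.
- exact: cvg_bes.
Qed.

Lemma series_exp_coeff_le x n : 0 <= x -> series (exp_coeff x) n <= expR x.
Proof.
move=> x0; apply: nondecreasing_cvgn_le; last exact: is_cvg_series_exp_coeff.
by apply: ge0_nondecreasing_series => i; exact: exp_coeff_ge0.
Qed.

(** The bound does not depend on the number of terms, as dominated convergence requires; the factor
    e^T will be cancelled by the e^(-T) in front of the expansion. *)
Lemma lag_generating_bound b T y n : 2^-1 <= b -> 0 <= T -> 0 <= y ->
  `|series (fun n => T ^+ n / poch b n * lag b n y) n| <= expR T * expR (2 * (y * T)).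
Proof.
move=> b2 T0 y0; have b0 : 0 < b by rewrite (lt_le_trans _ b2).
rewrite (_ : (fun n => _) = conv (exp_coeff T) (fun i => bes_coef b i * (y * T) ^+ i)); last first.
  by apply/funext => k; rewrite lag_conv.
have yT : 0 <= y * T by rewrite mulr_ge0.
rewrite series_conv (le_trans (ler_norm_sum _ _ _))//.
apply: (@le_trans _ _ (expR T * series (exp_coeff (2 * (y * T))) n)); last first.
  by rewrite ler_wpM2l ?expR_ge0// series_exp_coeff_le// mulr_ge0.
have -> : series (exp_coeff (2 * (y * T))) n = \sum_(i < n) exp_coeff (2 * (y * T)) i.
  by rewrite /series /= big_mkord.
rewrite mulr_sumr; apply: ler_sum => i _.
rewrite normrM mulrC ler_pM//; last first.
  by have := bes_coef_bound (y * T) i b2; rewrite (ger0_norm yT).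
rewrite ger0_norm; first exact: series_exp_coeff_le.
by apply: sumr_ge0 => j _; exact: exp_coeff_ge0.
Qed.

Lemma bessel_jE b z : 2^-1 <= b -> bessel_j (b - 1) z = bes b ((z / 2) ^+ 2).
Proof.
move=> b2; have g0 := Gamma_gt0 b2.
have h : cvgn (pseries (bes_coef b) ((z / 2) ^+ 2)).
  by apply/cvg_ex; eexists; exact: cvg_bes.
rewrite /bessel_j subrK.
have -> : bessel_coef (b - 1) z = (Gamma b)^-1 *: (fun i => bes_coef b i * ((z / 2) ^+ 2) ^+ i).
  apply/funext => k; rewrite /bessel_coef /bes_coef addrAC subrK Gamma_poch// exprM /=.
  rewrite [RHS]/GRing.scale /= [RHS]/GRing.scale /=.
  by field; rewrite fact_neq0 !gt_eqF// poch_gt0// (lt_le_trans _ b2).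
by rewrite (lim_seriesZ _ h) /GRing.scale /= mulrA mulfV ?mul1r// gt_eqF.
Qed.

Lemma laguerre_horner a n z : - 2^-1 <= a -> (@laguerre R a n).[z] = lag (a + 1) n z.
Proof.
move=> a2; have a1 : 2^-1 <= a + 1 by lra.
rewrite /laguerre horner_poly; apply: eq_bigr => i _; congr (_ * _).
rewrite -!addrA ![_ + (a + 1)]addrC !Gamma_poch//.
by rewrite /lag_coef; field; rewrite !fact_neq0 !gt_eqF ?Gamma_gt0 ?poch_gt0//; lra.
Qed.

End bessel.

(** * Bessel inequalities for the Laguerre and Hankel transforms *)

Section density.
Context d (T : measurableType d) (R : realType).
Variables (mu nu : {measure set T -> \bar R}) (w : T -> R).
Hypotheses (w0 : forall x, 0 <= w x) (mw : measurable_fun [set: T] w).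
Hypothesis nuE : forall A, measurable A -> (nu A = \int[mu]_(x in A) (w x)%:E)%E.

Import HBNNSimple.

Let integral_nnsfun_density (h : {nnsfun T >-> R}) :
  (\int[nu]_x (h x)%:E = \int[mu]_x ((h x)%:E * (w x)%:E))%E.
Proof.
have mh r : measurable (h @^-1` [set r]) by exact: measurable_sfunP.
transitivity (\int[mu]_x \sum_(r \in range h) (r%:E * (w x * \1_(h @^-1` [set r]) x)%:E))%E; last first.
  apply: eq_integral => x _; rewrite (fimfunE h x) -fsumEFin//.
  rewrite ge0_mule_fsuml => [|r]; last exact: nnfun_muleindic_ge0.
  by apply: eq_fsbigr => r _; rewrite -!EFinM; congr EFin; ring.
have r0 r : range h r -> 0 <= r by move=> [x _ <-].
have mwi r : measurable_fun [set: T] (fun x => (w x * \1_(h @^-1` [set r]) x)%:E).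
  by apply/measurable_EFinP; apply: measurable_funM => //; exact: measurable_indic.
rewrite ge0_integral_fsum//.
- rewrite integralT_nnsfun sintegralE; apply: eq_fsbigr => r /[!inE] rr.
  rewrite ge0_integralZl_EFin ?r0//; last by move=> x _; rewrite lee_fin mulr_ge0.
  congr (_ * _)%E; rewrite nuE// integral_mkcond; apply: eq_integral => x _.
  by rewrite patchE indicE; case: ifPn; rewrite ?mulr1 ?mulr0.
- by move=> r; apply: measurable_funeM.
- move=> r x _; rewrite muleC -EFinM mulrAC -mulrA EFinM muleC mule_ge0 ?lee_fin//.
  by have := nnfun_muleindic_ge0 h r x; rewrite lee_fin.
Qed.

Lemma ge0_integral_density (f : T -> \bar R) :
  measurable_fun [set: T] f -> (forall x, (0 <= f x)%E) ->
  (\int[nu]_x f x = \int[mu]_x (f x * (w x)%:E))%E.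
Proof.
move=> mf f0; pose h := nnsfun_approx measurableT mf.
have fE x : (h n x)%:E @[n --> \oo] --> f x by apply: cvg_nnsfun_approx.
have nd x : {homo (fun n => (h n x)%:E) : n m / (n <= m)%N >-> (n <= m)%E}.
  by move=> n m nm; rewrite lee_fin; exact/lefP/nd_nnsfun_approx.
have -> : (fun x => f x) = (fun x => limn (fun n => (h n x)%:E)).
  by apply/funext => x; apply/esym/cvg_lim => //; exact: fE.
transitivity (limn (fun n => \int[nu]_x (h n x)%:E)%E).
  apply: monotone_convergence; [by []|by move=> n; apply/measurable_EFinP| |].
    by move=> n x _; rewrite lee_fin.
  by move=> x _; exact: nd.
under eq_fun do rewrite integral_nnsfun_density.
rewrite -monotone_convergence//.
- apply: eq_integral => x _.
  by apply/cvg_lim => //; apply: cvgeZr => //; exact: fE.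
- move=> n; apply: emeasurable_funM; first exact/measurable_EFinP.
  exact/measurable_EFinP.
- by move=> n x _; rewrite mule_ge0// lee_fin.
- by move=> x _ i j ij; rewrite lee_wpmul2r ?lee_fin//; exact: nd.
Qed.
End density.

Section has_integral.
Context d (T : measurableType d) (R : realType) (mu : {measure set T -> \bar R}).
Implicit Types (f g u v : T -> R) (a b : R).

(** Carries integrability and value together, so that both follow at once through finite sums and
    products. *)
Definition has_integral f a :=
  mu.-integrable setT (EFin \o f) /\ (\int[mu]_x (f x)%:E = a%:E)%E.

Lemma integrable_has_integral f :
  mu.-integrable setT (EFin \o f) -> has_integral f (\int[mu]_x f x).
Proof.
by move=> fi; split => //; rewrite /Rintegral fineK//; exact: integrable_fin_num.
Qed.

Lemma ge0_has_integral f a : measurable_fun [set: T] f -> (forall x, 0 <= f x) ->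
  (\int[mu]_x (f x)%:E = a%:E)%E -> has_integral f a.
Proof.
move=> mf f0 fa; split => //; apply/integrableP; split; first exact/measurable_EFinP.
by under eq_integral do rewrite /= ger0_norm//; rewrite fa ltry.
Qed.

Lemma has_integral_ext f g a : f =1 g -> has_integral f a -> has_integral g a.
Proof. by move=> /funext ->. Qed.

Lemma has_integral_unique f a b : has_integral f a -> has_integral f b -> a = b.
Proof. by move=> [_ fa] [_ fb]; apply: EFin_inj; rewrite -fa -fb. Qed.

Lemma has_integral_Rintegral f a : has_integral f a -> \int[mu]_x f x = a.
Proof. by move=> [_]; rewrite /Rintegral => ->. Qed.

Lemma has_integralD f g a b : has_integral f a -> has_integral g b ->
  has_integral (fun x => f x + g x) (a + b).
Proof.
move=> [fi fa] [gi gb]; split; first exact: (integrableD _ fi gi).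
by under eq_integral do rewrite EFinD; rewrite (integralD _ fi gi)//= fa gb.
Qed.

Lemma has_integralZ k f a : has_integral f a -> has_integral (fun x => k * f x) (k * a).
Proof.
move=> [fi fa]; split; first exact: (integrableZl _ k fi).
by under eq_integral do rewrite EFinM; rewrite (integralZl _ fi)//= fa.
Qed.

Lemma has_integral0 : has_integral (fun=> 0) 0.
Proof. by split; [exact: integrable0|exact: integral0]. Qed.

Lemma has_integral_sum n (F : nat -> T -> R) (A : nat -> R) :
  (forall i, (i < n)%N -> has_integral (F i) (A i)) ->
  has_integral (fun x => \sum_(i < n) F i x) (\sum_(i < n) A i).
Proof.
elim: n => [_|n IH FA].
  by rewrite big_ord0; apply: has_integral_ext has_integral0 => x; rewrite big_ord0.
rewrite big_ord_recr; apply: has_integral_ext (has_integralD (IH _) (FA n _)) => //.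
  by move=> x; rewrite big_ord_recr.
by move=> i ni; apply: FA; rewrite ltnW.
Qed.

Lemma has_integral_le f g a b : has_integral f a -> has_integral g b ->
  (forall x, f x <= g x) -> a <= b.
Proof.
move=> [fi fa] [gi gb] fg; rewrite -lee_fin -fa -gb.
by apply: le_integral => // x _; rewrite lee_fin.
Qed.

(** Cauchy-Schwarz: the integral of (u - t v)^2 is a nonnegative quadratic polynomial in t.
    Integrability of the product comes from |u v| <= u^2 + v^2. *)
Lemma has_integral_mul u v a b : measurable_fun setT u -> measurable_fun setT v ->
  has_integral (fun x => u x ^+ 2) a -> has_integral (fun x => v x ^+ 2) b ->
  exists2 c, has_integral (fun x => u x * v x) c & c ^+ 2 <= a * b.
Proof.
move=> mu_ mv ua vb.
have ci : mu.-integrable setT (EFin \o (fun x => u x * v x)).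
  apply: (le_integrable measurableT _ _ (has_integralD ua vb).1).
    by apply/measurable_EFinP; exact: measurable_funM.
  move=> x _; rewrite /= lee_fin normrM [leRHS]ger0_norm ?addr_ge0 ?sqr_ge0//.
  by rewrite -(real_normK (num_real (u x))) -(real_normK (num_real (v x))); nra.
have uvc := integrable_has_integral ci; set c := Rintegral _ _ _ in uvc.
exists c => //.
have quad t : 0 <= a - 2 * t * c + t ^+ 2 * b.
  have -> : a - 2 * t * c = a + - (2 * t) * c by ring.
  have h := has_integralD (has_integralD ua (has_integralZ (- (2 * t)) uvc))
    (has_integralZ (t ^+ 2) vb).
  apply: (has_integral_le has_integral0 h) => x.
  rewrite (_ : _ + _ = (u x - t * v x) ^+ 2) ?sqr_ge0//; ring.
have b0 : 0 <= b by apply: (has_integral_le has_integral0 vb) => x; exact: sqr_ge0.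
have [b00|bn0] := eqVneq b 0.
  rewrite b00 mulr0; have [->|cn0] := eqVneq c 0; first by rewrite expr0n.
  (* For b = 0 the polynomial is affine in t, and this t would give it the value -1. *)
  have := quad ((a + 1) / (2 * c)); rewrite b00 mulr0 addr0.
  have -> : a - 2 * ((a + 1) / (2 * c)) * c = - 1 by field.
  by rewrite lerNr oppr0 ler10.
have bp : 0 < b by rewrite lt_neqAle eq_sym bn0.
(* The minimizer of the quadratic polynomial. *)
have := quad (c / b).
have -> : a - 2 * (c / b) * c + (c / b) ^+ 2 * b = (a * b - c ^+ 2) / b by field.
by rewrite pmulr_lge0 ?invr_gt0// subr_ge0.
Qed.

End has_integral.

Section power_measure_theory.
Context {R : realType}.
Implicit Types b : R.
Notation leb := (@lebesgue_measure R).

Lemma ge0_integral_power_measure b (f : R -> \bar R) :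
  measurable_fun setT f -> (forall x, (0 <= f x)%E) ->
  (\int[power_measure b]_x f x = \int[leb]_(x in `[0%R, +oo[) (f x * (x `^ b)%:E))%E.
Proof.
move=> mf f0; rewrite (@ge0_integral_density _ _ _ leb _ (fun x => \1_(`[0, +oo[%classic) x * x `^ b))//.
- rewrite [RHS]integral_mkcond; apply: eq_integral => x _.
  by rewrite patchE indicE; case: ifPn; rewrite ?mul1r// mul0r mule0.
- by move=> x; rewrite mulr_ge0 ?powR_ge0.
- by apply: measurable_funM; [exact: measurable_indic|exact: measurable_powR].
move=> A mA; transitivity (\int[leb]_(x in A `&` `[0%R, +oo[) (x `^ b)%:E)%E; first by [].
rewrite integral_mkcondr; apply: eq_integral => x _.
by rewrite patchE indicE; case: ifPn; rewrite ?mul1r// mul0r.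
Qed.

Lemma integral_power_measure_gauss b e : 2^-1 <= b -> 0 < e ->
  (\int[power_measure (2 * b - 1)]_x (expR (- (e * x ^+ 2)))%:E =
   (e `^ (- b) / 2 * Gamma b)%:E)%E.
Proof.
move=> b2 e0; rewrite ge0_integral_power_measure//; last first.
  by apply/measurable_EFinP; exact: measurable_gauss.
rewrite -gauss_moment_Gamma//; apply: eq_integral => x _.
by rewrite -EFinM mulrC.
Qed.

Lemma power_measure_gauss_moment b e k : 2^-1 <= b -> 0 < e ->
  (\int[power_measure (2 * b - 1)]_x ((e * x ^+ 2) ^+ k * expR (- (e * x ^+ 2)))%:E =
   (poch b k * (e `^ (- b) / 2 * Gamma b))%:E)%E.
Proof.
move=> b2 e0; case: k => [|k].
  rewrite poch0 mul1r -integral_power_measure_gauss//.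
  by apply: eq_integral => x _; rewrite expr0 mul1r.
have bk : 2^-1 <= b + k.+1%:R by rewrite (le_trans b2)// lerDl.
have b0 : 0 <= 2 * b - 1 by lra.
rewrite ge0_integral_power_measure//; last 2 first.
- apply/measurable_EFinP; apply: measurable_funM; last exact: measurable_gauss.
  by apply: measurable_funX; apply: measurable_funM => //; exact: measurable_funX.
- by move=> x; rewrite lee_fin mulr_ge0 ?expR_ge0// exprn_ge0// mulr_ge0 ?sqr_ge0// ltW.
transitivity ((e ^+ k.+1)%:E * gauss_moment (2 * (b + k.+1%:R) - 1) e)%E.
  rewrite /gauss_moment -ge0_integralZl_EFin//; last 3 first.
  - by move=> x _; rewrite lee_fin mulr_ge0 ?powR_ge0 ?expR_ge0.
  - by apply: measurable_funTS; apply/measurable_EFinP; exact: measurable_powR_gauss.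
  - by rewrite exprn_ge0// ltW.
  apply: eq_integral => x; rewrite mem_setE in_itv/= andbT => x0.
  rewrite -!EFinM; congr EFin.
  have -> : 2 * (b + k.+1%:R) - 1 = (2 * b - 1) + (2 * k.+1)%:R by rewrite natrM; ring.
  rewrite (@powRD _ x (2 * b - 1) (2 * k.+1)%:R); last first.
    by apply/implyP; rewrite gt_eqF// ltr_wpDl// ltr0n muln_gt0.
  by rewrite powR_mulrn// exprMn -exprM; ring.
rewrite (gauss_moment_Gamma bk e0) -EFinM; congr (_%:E).
rewrite Gamma_poch// opprD powRD; last by apply/implyP => _; rewrite gt_eqF.
rewrite [e `^ (- k.+1%:R)]powRN powR_mulrn ?ltW//; field.
by rewrite expf_neq0// gt_eqF.
Qed.

Let sigma_finite_power_measure b : sigma_finite [set: measurableTypeR R] (power_measure b).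
Proof.
(* Negative reals stay in [F n] since they carry no mass. The gap to the right of 0 is cut out
   because x^b may blow up there when b < 0. *)
pose F n : set R := ~` (`]0, n.+1%:R^-1[ `|` `]n.+1%:R, +oo[).
exists F.
  apply/esym/seteqP; split => // x _.
  have [x0|x0] := leP x 0.
    exists 0%N => //; rewrite /F /= !in_itv/= andbT => -[/andP[]|]; rewrite ltNge.
      by rewrite x0.
    by rewrite (le_trans x0).
  have [n hn] : exists n : nat, (x^-1 + x) < n%:R.
    by exists (Num.trunc (x^-1 + x)).+1; rewrite -truncn_lt_nat// addr_ge0// ?invr_ge0 ltW.
  have xV : 0 < x^-1 by rewrite invr_gt0.
  exists n => //; rewrite /F /= !in_itv/= andbT => -[/andP[_]|].
    rewrite -ltf_pV2 ?posrE ?invr_gt0// invrK -natr1; lra.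
  rewrite -natr1; lra.
move=> n; have mF : measurable (F n) by apply: measurableC; exact: measurableU.
split => //; rewrite /power_measure.
have M1 : 1 <= n.+1%:R `^ `|b| by rewrite -[leLHS](powRr0 n.+1%:R) ler_powR// ler1n.
apply: (@le_lt_trans _ _ (\int[leb]_(x in F n `&` `[0%R, +oo[) (n.+1%:R `^ `|b|)%:E)%E).
  apply: ge0_le_integral => //.
  - exact: measurableI.
  - by move=> x _; rewrite lee_fin powR_ge0.
  - by apply: measurable_funTS; apply/measurable_EFinP; exact: measurable_powR.
  move=> x [/not_orP[]] /=; rewrite !in_itv/= !andbT => h1 h2 x0; rewrite lee_fin.
  have xn : x <= n.+1%:R by rewrite leNgt; apply/negP.
  (* By convention the power of 0 is 0 or 1, even for a negative exponent. *)
  have [->|xn0] := eqVneq x 0.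
    by apply: le_trans M1; rewrite /powR eqxx; case: (b == 0).
  have xp : 0 < x by rewrite lt_neqAle eq_sym xn0.
  have xn' : n.+1%:R^-1 <= x by rewrite leNgt; apply/negP => xn'; apply: h1; rewrite xp.
  have [b0|b0] := leP 0 b.
    by rewrite ger0_norm// ge0_ler_powR ?nnegrE.
  have -> : x `^ b = x^-1 `^ (- b) by rewrite -powR_inv1 ?(ltW xp)// -powRrM mulrN mulN1r opprK.
  rewrite ltr0_norm// ge0_ler_powR ?nnegrE ?invr_ge0 ?oppr_ge0 ?(ltW b0) ?(ltW xp)//.
  by rewrite invf_ple ?posrE.
rewrite integral_cst; last exact: measurableI.
rewrite lte_mul_pinfty ?lee_fin ?powR_ge0//.
apply: (@le_lt_trans _ _ (leb `[0, n.+1%:R])).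
  apply: le_measure; rewrite ?inE//; first exact: measurableI.
  move=> x [/not_orP[_]] /=; rewrite !in_itv/= !andbT => h2 x0; rewrite x0 leNgt; exact/negP.
by rewrite lebesgue_measure_itv/=; case: ifPn => _; rewrite ?ltry// -EFinD ltry.
Qed.

HB.instance Definition _ b := @Measure_isSigmaFinite.Build _ _ _ (power_measure b)
  (sigma_finite_power_measure b).

End power_measure_theory.

(** * Bessel's inequality for scaled Laguerre functions *)

Section laguerre_bessel_inequality.
Context {R : realType}.
Variables b e : R.
Hypotheses (b2 : 2^-1 <= b) (e0 : 0 < e).
Notation mu := (power_measure (2 * b - 1)).
Notation M := (e `^ (- b) / 2 * Gamma b).

Let b0 : 0 < b. Proof. by rewrite (lt_le_trans _ b2). Qed.

Let M0 : 0 < M. Proof. by rewrite mulr_gt0 ?divr_gt0 ?powR_gt0 ?Gamma_gt0. Qed.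

Let L0 n : 0 < lag b n 0.
Proof. by rewrite lag_at0 divr_gt0 ?poch_gt0// ltr0n fact_gt0. Qed.

Lemma measurable_lag_sqr n : measurable_fun [set: R] (fun x : R => lag b n (e * x ^+ 2)).
Proof.
apply: measurable_sum => i; apply: measurable_funM => //.
by apply: measurable_funX; apply: measurable_funM => //; exact: measurable_funX.
Qed.

Lemma has_integral_lag_gauss m n :
  has_integral mu (fun x => lag b m (e * x ^+ 2) * lag b n (e * x ^+ 2) * expR (- (e * x ^+ 2)))
    ((m == n)%:R * (poch b n / n`!%:R) * M).
Proof.
have hm k : has_integral mu (fun x => (e * x ^+ 2) ^+ k * expR (- (e * x ^+ 2))) (poch b k * M).
  apply: ge0_has_integral.
  - apply: measurable_funM; last exact: measurable_gauss.
    by apply: measurable_funX; apply: measurable_funM => //; exact: measurable_funX.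
  - by move=> x; rewrite mulr_ge0 ?expR_ge0// exprn_ge0// mulr_ge0 ?sqr_ge0// ltW.
  - exact: power_measure_gauss_moment.
have h := @has_integral_sum _ _ _ mu m.+1 _ _ (fun i _ =>
  @has_integral_sum _ _ _ mu n.+1 _ _ (fun j _ =>
    has_integralZ (lag_coef b m i * lag_coef b n j) (hm (i + j)%N))).
rewrite -lag_orthogonality// mulr_suml.
under eq_bigr do rewrite mulr_suml; under eq_bigr do under eq_bigr do rewrite -mulrA.
apply: has_integral_ext h => x.
rewrite /lag mulr_suml mulr_suml; apply: eq_bigr => i _.
rewrite mulr_sumr mulr_suml; apply: eq_bigr => j _.
by rewrite exprD; ring.
Qed.

(** For b = alpha + 1 this is x -> [laguerre_fun alpha n (e * x ^+ 2)], the Laguerre factor of the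
    kernel at frequency e. *)
Definition laguerre_gauss n x : R :=
  expR (- (e * x ^+ 2 / 2)) * lag b n (e * x ^+ 2) / lag b n 0.

Lemma measurable_laguerre_gauss n : measurable_fun [set: R] (laguerre_gauss n).
Proof.
apply: measurable_funM => //; apply: measurable_funM; last exact: measurable_lag_sqr.
apply: measurableT_comp => //; apply: measurableT_comp => //.
by apply: measurable_funM => //; apply: measurable_funM => //; exact: measurable_funX.
Qed.

Lemma has_integral_laguerre_gauss m n :
  has_integral mu (fun x => laguerre_gauss m x * laguerre_gauss n x)
    ((m == n)%:R * (M / lag b n 0)).
Proof.
have -> : (m == n)%:R * (M / lag b n 0) =
    (lag b m 0 * lag b n 0)^-1 * ((m == n)%:R * (poch b n / n`!%:R) * M).
  rewrite -lag_at0; case: eqP => [->|_]; last by rewrite !mul0r mulr0.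
  by field; rewrite gt_eqF.
apply: has_integral_ext (has_integralZ _ (has_integral_lag_gauss m n)) => x.
rewrite /laguerre_gauss.
have -> : expR (- (e * x ^+ 2)) = expR (- (e * x ^+ 2 / 2)) * expR (- (e * x ^+ 2 / 2)).
  by rewrite -expRD -opprD -splitr.
by field; rewrite !gt_eqF.
Qed.

(** The functions have squared norm M / L_m(0). With [G] equal to M times the projection of [F] and
    [Q] the left side, the pairing of F with G is Q and the squared norm of G is M Q, so
    Cauchy-Schwarz gives Q^2 <= M Q times the squared norm of F. *)
Lemma laguerre_bessel_ineq (F : R -> R) N : measurable_fun setT F ->
  ((\sum_(m < N) lag b m 0 * (\int[mu]_x (F x * laguerre_gauss m x)) ^+ 2)%:E <=
   M%:E * \int[mu]_x (F x ^+ 2)%:E)%E.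
Proof.
move=> mF; have : (0 <= \int[mu]_x (F x ^+ 2)%:E)%E.
  by apply: integral_ge0 => x _; rewrite lee_fin sqr_ge0.
case Ea : (\int[mu]_x (F x ^+ 2)%:E)%E => [a| |]// a0; last first.
  by rewrite gt0_muley ?leey// lte_fin.
have Fa : has_integral mu (fun x => F x ^+ 2) a.
  apply: ge0_has_integral => //; last by move=> x; exact: sqr_ge0.
  exact: measurable_funX.
pose c m := \int[mu]_x (F x * laguerre_gauss m x).
have hc m : has_integral mu (fun x => F x * laguerre_gauss m x) (c m).
  have h2 : has_integral mu (fun x => laguerre_gauss m x ^+ 2) (M / lag b m 0).
    by have := has_integral_laguerre_gauss m m; rewrite eqxx mul1r.
  have [c' hc' _] := @has_integral_mul _ _ _ mu _ _ _ _ mF (measurable_laguerre_gauss m) Fa h2.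
  by rewrite /c (has_integral_Rintegral hc').
pose G x := \sum_(m < N) lag b m 0 * c m * laguerre_gauss m x.
pose Q := \sum_(m < N) lag b m 0 * c m ^+ 2.
have mG : measurable_fun setT G.
  by apply: measurable_sum => i; apply: measurable_funM => //; exact: measurable_laguerre_gauss.
have FG : has_integral mu (fun x => F x * G x) Q.
  have h := @has_integral_sum _ _ _ mu N _ _ (fun m _ => has_integralZ (lag b m 0 * c m) (hc m)).
  rewrite /Q; under eq_bigr do rewrite expr2 mulrA.
  by apply: has_integral_ext h => x; rewrite /G mulr_sumr; apply: eq_bigr => i _; ring.
have GG : has_integral mu (fun x => G x ^+ 2) (M * Q).
  have h := @has_integral_sum _ _ _ mu N _ _ (fun m _ =>
    @has_integral_sum _ _ _ mu N _ _ (fun n _ =>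
      has_integralZ (lag b m 0 * c m * (lag b n 0 * c n)) (has_integral_laguerre_gauss m n))).
  have -> : M * Q = \sum_(m < N) \sum_(n < N)
      lag b m 0 * c m * (lag b n 0 * c n) * ((nat_of_ord m == n)%:R * (M / lag b n 0)).
    rewrite /Q mulr_sumr; apply: eq_bigr => m _.
    rewrite (bigD1 m)//= eqxx mul1r big1 => [|n nm]; last first.
      by rewrite (_ : (_ == _) = false) ?mul0r ?mulr0// eq_sym; exact: negbTE.
    by move: (M) => K; field; rewrite gt_eqF.
  apply: has_integral_ext h => x; rewrite /G expr2 mulr_suml; apply: eq_bigr => m _.
  by rewrite mulr_sumr; apply: eq_bigr => n _; ring.
have [Q' hQ'] := @has_integral_mul _ _ _ mu _ _ _ _ mF mG Fa GG.
rewrite (has_integral_unique hQ' FG) => QQ.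
have Q0 : 0 <= Q by apply: sumr_ge0 => i _; rewrite mulr_ge0 ?sqr_ge0// ltW.
rewrite -EFinM lee_fin -/Q.
have [->|Qn0] := eqVneq Q 0; first by rewrite mulr_ge0// ltW.
have Qp : 0 < Q by rewrite lt_neqAle eq_sym Qn0.
by rewrite -(ler_pM2r Qp) -expr2 (le_trans QQ)//; nra.
Qed.

End laguerre_bessel_inequality.

Section limits_of_integrals.
Context d (T : measurableType d) (R : realType) (mu : {measure set T -> \bar R}).

Lemma cvg_Rintegral_dominated (f_ : nat -> T -> R) (f g : T -> R) :
  (forall n, measurable_fun setT (f_ n)) -> measurable_fun setT f ->
  (forall x, f_ n x @[n --> \oo] --> f x) ->
  mu.-integrable setT (EFin \o g) -> (forall n x, `|f_ n x| <= g x) ->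
  (\int[mu]_x f_ n x @[n --> \oo] --> \int[mu]_x f x).
Proof.
move=> mf_ mf ff gi fg.
have ff' x : (f_ n x)%:E @[n --> \oo] --> (f x)%:E.
  by apply: cvg_EFin; [exact: nearW|exact: ff].
have fg' : {ae mu, forall x n, [set: T] x -> (`|(f_ n x)%:E| <= (EFin \o g) x)%E}.
  by apply: aeW => x n _; rewrite lee_fin.
have [fi _ h] := @dominated_convergence _ _ _ mu _ measurableT
  (fun n x => (f_ n x)%:E) (EFin \o f) (EFin \o g)
  (fun n => proj2 (measurable_EFinP _ _) (mf_ n)) (proj2 (measurable_EFinP _ _) mf)
  (aeW _ (fun x _ => ff' x)) gi fg'.
apply: fine_cvg; rewrite fineK//; exact: integrable_fin_num.
Qed.

(** Lets an L2 inequality with a uniform right side survive a pointwise limit, first in the number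
    of terms, later in the Gaussian cutoff. *)
Lemma fatou_le (u_ : nat -> T -> R) (u : T -> R) (B : \bar R) :
  (forall n, measurable_fun setT (u_ n)) -> (forall n x, 0 <= u_ n x) ->
  (forall x, u_ n x @[n --> \oo] --> u x) ->
  (forall n, (\int[mu]_x (u_ n x)%:E <= B)%E) -> (\int[mu]_x (u x)%:E <= B)%E.
Proof.
move=> mu_ u0 uu uB.
apply: (@le_trans _ _ (\int[mu]_x (limn_einf (fun n => (u_ n x)%:E)))%E).
  rewrite le_eqVlt; apply/orP; left; apply/eqP; apply: eq_integral => x _.
  have h : (u_ n x)%:E @[n --> \oo] --> (u x)%:E by apply: cvg_EFin; [exact: nearW|exact: uu].
  rewrite is_cvg_limn_einfE; last by apply/cvg_ex; eexists; exact: h.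
  by apply/esym/cvg_lim.
apply: le_trans (fatou _ _ _ _) _ => //.
- by move=> n; apply/measurable_EFinP.
- by move=> n x _; rewrite lee_fin.
rewrite limn_einf_lim; apply: lime_le; first exact: is_cvg_einfs.
apply: nearW => n; apply: le_trans (uB n); apply: ereal_inf_lbound.
by exists n => /=.
Qed.

End limits_of_integrals.

Lemma measurable_Rintegral_param d1 d2 (T1 : measurableType d1) (T2 : measurableType d2)
    (R : realType) (m2 : {sigma_finite_measure set T2 -> \bar R}) (f : T1 -> T2 -> R) :
  measurable_fun setT (fun z : T1 * T2 => f z.1 z.2) ->
  measurable_fun setT (fun x => \int[m2]_y f x y).
Proof.
move=> mf; pose F z := (f z.1 z.2)%:E.
have mF : measurable_fun setT F by apply/measurable_EFinP.
rewrite /Rintegral; apply: (measurableT_comp (fine_measurable _)) => //.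
rewrite (_ : (fun x => _) = (fun x => \int[m2]_y F^\+ (x, y) - \int[m2]_y F^\- (x, y))%E).
  have h1 := @measurable_fun_fubini_tonelli_F _ _ _ _ _ m2 (F^\+)%E (measurable_funepos mF)
    (funepos_ge0 F).
  have h2 := @measurable_fun_fubini_tonelli_F _ _ _ _ _ m2 (F^\-)%E (measurable_funeneg mF)
    (funeneg_ge0 F).
  exact: emeasurable_funB h1 h2.
apply/funext => x. rewrite [LHS]integralE.
by congr (_ - _)%E; apply: eq_integral => y _; rewrite ?funeposE ?funenegE.
Qed.

Lemma cvgn_sqr {R : realType} (f : nat -> R) (a : R) :
  f n @[n --> \oo] --> a -> f n ^+ 2 @[n --> \oo] --> a ^+ 2.
Proof. by move=> fa; exact: (cvgM fa fa). Qed.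

(** * The L2 bound for the Hankel transform *)

Section hankel.
Context {R : realType}.
Variable b : R.
Hypothesis b2 : 2^-1 <= b.
Notation mu := (power_measure (2 * b - 1)).

Let b0 : 0 < b. Proof. by rewrite (lt_le_trans _ b2). Qed.

Definition hankel (h : R -> R) (l : R) : R :=
  \int[mu]_t (h t * bes b ((l * t / 2) ^+ 2)).

Lemma measurable_bes : measurable_fun [set: R] (bes b).
Proof. by apply: continuous_measurable_fun; exact: continuous_bes. Qed.

Lemma measurable_bes_prod : measurable_fun [set: R * R]
  (fun z => bes b ((z.1 * z.2 / 2) ^+ 2)).
Proof.
apply: (measurableT_comp measurable_bes); apply: measurable_funX.
by apply: measurable_funM => //; exact: measurable_funM.
Qed.

Lemma measurable_hankel h : measurable_fun [set: R] h -> measurable_fun [set: R] (hankel h).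
Proof.
move=> mh; apply: (@measurable_Rintegral_param _ _ (measurableTypeR R) (measurableTypeR R) R mu
  (fun l t => h t * bes b ((l * t / 2) ^+ 2))).
apply: measurable_funM; last exact: measurable_bes_prod.
exact: (measurableT_comp mh).
Qed.

Lemma measurable_bes_slice l : measurable_fun [set: R] (fun t => bes b ((l * t / 2) ^+ 2)).
Proof.
apply: (measurableT_comp measurable_bes); apply: measurable_funX.
by apply: measurable_funM => //; exact: measurable_funM.
Qed.

Lemma bes_sqr_le1 (x : R) : `|bes b (x ^+ 2)| <= 1.
Proof. by rewrite bes_le1// sqr_ge0. Qed.

(** The square of 2^(b-1) Gamma(b), the L2 normalization of the Hankel transform whose kernel is 1
    at 0. *)
Definition hankel_cst : R := 4 `^ b / 4 * Gamma b ^+ 2.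

(* The generating function \sum_n (T^n / (b)_n) L_n^(b-1)(y) = e^T bes b (y T), with
   y = e l^2 and T = t^2 / (4 e), expands the Hankel transform of h into Laguerre
   polynomials in e l^2, which are orthogonal for the weight e^(-e l^2). The compact
   support of h allows exchanging sum and integral, and e tends to 0 afterwards. *)
Section compact_support.
Variables (e K : R) (h : R -> R).
Hypotheses (e0 : 0 < e) (mh : measurable_fun [set: R] h).
Hypothesis hi : mu.-integrable setT (EFin \o h).
Hypothesis hK : forall t, K < `|t| -> h t = 0.

Let T (t : R) : R := (4 * e)^-1 * t ^+ 2.

Let T0 t : 0 <= T t.
Proof. by rewrite mulr_ge0 ?sqr_ge0// invr_ge0 mulr_ge0// ltW. Qed.

Let mT : measurable_fun [set: R] T.
Proof. by apply: measurable_funM => //; exact: measurable_funX. Qed.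

Let p n t := expR (- T t) * T t ^+ n.

Let p0 n t : 0 <= p n t.
Proof. by rewrite mulr_ge0 ?expR_ge0// exprn_ge0. Qed.

Let mp n : measurable_fun [set: R] (p n).
Proof.
apply: measurable_funM; last exact: measurable_funX.
by apply: measurableT_comp => //; exact: measurableT_comp.
Qed.

(** The numbers [p n t / n!] are the Poisson probabilities with mean T t, so they split h^2 into
    pieces whose sum never exceeds h^2. *)
Let sum_p N t : \sum_(n < N) p n t / n`!%:R <= 1.
Proof.
rewrite /p; under eq_bigr do rewrite -mulrA.
rewrite -mulr_sumr -[leRHS](expRxMexpNx_1 (T t)) mulrC ler_wpM2r ?expR_ge0//.
by have := series_exp_coeff_le N (T0 t); rewrite /series /= big_mkord.
Qed.

Notation M := (e `^ (- b) / 2 * Gamma b).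
Notation M' := ((4 * e)^-1 `^ (- b) / 2 * Gamma b).

Let MM' : M * M' = hankel_cst.
Proof.
have e4 : 0 <= 4 * e by rewrite mulr_ge0// ltW.
have -> : (4 * e)^-1 `^ (- b) = 4 `^ b * e `^ b.
  by rewrite -(powR_inv1 e4) -powRrM mulN1r opprK powRM// ltW.
by rewrite /hankel_cst powRN; field; rewrite gt_eqF// powR_gt0.
Qed.

Let coef n := \int[mu]_t (h t * (p n t / poch b n)).

(* Cauchy-Schwarz for the splitting h p / (b)_n = (h sqrt p) (sqrt p / (b)_n). *)
Let coef_bound n (a : R) : has_integral mu (fun t => h t ^+ 2) a ->
  exists A, [/\ has_integral mu (fun t => h t * (p n t / poch b n)) (coef n),
    has_integral mu (fun t => h t ^+ 2 * (p n t / n`!%:R)) A &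
    coef n ^+ 2 <= n`!%:R * A * (M' / poch b n)].
Proof.
move=> ha; have f0 : 0 < n`!%:R :> R by rewrite ltr0n fact_gt0.
have msp : measurable_fun [set: R] (fun t => Num.sqrt (p n t)).
  by apply: (measurableT_comp (continuous_measurable_fun (@sqrt_continuous R))).
have hA : has_integral mu (fun t => h t ^+ 2 * (p n t / n`!%:R))
    (\int[mu]_t (h t ^+ 2 * (p n t / n`!%:R))).
  apply: integrable_has_integral; apply: le_integrable ha.1 => //.
    apply/measurable_EFinP; apply: measurable_funM; first exact: measurable_funX.
    exact: (measurable_funM (mp n) (measurable_cst _)).
  move=> t _; rewrite /= lee_fin normrM ler_piMr// ger0_norm ?divr_ge0//.
  apply: le_trans (sum_p n.+1 t); rewrite big_ord_recr /= lerDr.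
  by apply: sumr_ge0 => i _; rewrite divr_ge0.
have hu : has_integral mu (fun t => (h t * Num.sqrt (p n t)) ^+ 2)
    (n`!%:R * \int[mu]_t (h t ^+ 2 * (p n t / n`!%:R))).
  apply: has_integral_ext (has_integralZ _ hA) => t.
  by rewrite exprMn sqr_sqrtr//; field; rewrite gt_eqF.
have hp : has_integral mu (p n) (poch b n * M').
  apply: ge0_has_integral; [exact: mp|exact: p0|].
  rewrite -(power_measure_gauss_moment _ b2) ?invr_gt0 ?mulr_gt0//.
  by apply: eq_integral => t _; rewrite mulrC.
have hv : has_integral mu (fun t => (Num.sqrt (p n t) / poch b n) ^+ 2) (M' / poch b n).
  have -> : M' / poch b n = (poch b n ^+ 2)^-1 * (poch b n * M').
    by move: M' => k; field; rewrite gt_eqF ?poch_gt0.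
  apply: has_integral_ext (has_integralZ _ hp) => t.
  by rewrite exprMn sqr_sqrtr// exprVn mulrC.
have [c hc cle] := @has_integral_mul _ _ _ mu _ _ _ _
  (measurable_funM mh msp) (measurable_funM msp (measurable_cst _)) hu hv.
have hc' : has_integral mu (fun t => h t * (p n t / poch b n)) c.
  apply: has_integral_ext hc => t.
  by rewrite /= -[in RHS](sqr_sqrtr (p0 n t)); ring.
exists (\int[mu]_t (h t ^+ 2 * (p n t / n`!%:R))).
by rewrite /coef (has_integral_Rintegral hc').
Qed.

Let partial N (l : R) := \sum_(n < N) coef n * lag b n (e * l ^+ 2).

Let mpartial N : measurable_fun [set: R] (partial N).
Proof.
by apply: measurable_sum => n; apply: measurable_funM => //; exact: measurable_lag_sqr.
Qed.

Let M0 : 0 < M. Proof. by rewrite mulr_gt0 ?divr_gt0 ?powR_gt0 ?Gamma_gt0. Qed.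

Let M'0 : 0 < M'.
Proof.
by rewrite mulr_gt0 ?divr_gt0 ?powR_gt0 ?Gamma_gt0 ?invr_gt0 ?mulr_gt0.
Qed.

Let partial_sqr N : has_integral mu (fun l => partial N l ^+ 2 * expR (- (e * l ^+ 2)))
  (M * \sum_(n < N) coef n ^+ 2 * (poch b n / n`!%:R)).
Proof.
have hs := @has_integral_sum _ _ _ mu N _ _ (fun m _ =>
  @has_integral_sum _ _ _ mu N _ _ (fun n _ =>
    has_integralZ (coef m * coef n) (has_integral_lag_gauss b2 e0 m n))).
have -> : M * (\sum_(n < N) coef n ^+ 2 * (poch b n / n`!%:R)) = \sum_(m < N) \sum_(n < N)
    coef m * coef n * ((nat_of_ord m == n)%:R * (poch b n / n`!%:R) * M).
  rewrite mulr_sumr; apply: eq_bigr => m _.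
  rewrite (bigD1 m)//= eqxx mul1r big1 => [|n nm]; last first.
    by rewrite (_ : (_ == _) = false) ?mul0r ?mulr0// eq_sym; exact: negbTE.
  by rewrite addr0; ring.
apply: has_integral_ext hs => l; rewrite [partial N l ^+ 2]expr2 /partial mulr_suml mulr_suml.
apply: eq_bigr => m _; rewrite mulr_sumr mulr_suml; apply: eq_bigr => n _; ring.
Qed.

(** By [coef_bound] each term is at most M' times the n-th Poisson piece of the integral of h^2, and
    these pieces sum to at most a. The product M M' is free of e. *)
Let partial_sqr_le N a : has_integral mu (fun t => h t ^+ 2) a ->
  M * \sum_(n < N) coef n ^+ 2 * (poch b n / n`!%:R) <= hankel_cst * a.
Proof.
move=> ha; rewrite -MM' -[leRHS]mulrA ler_pM2l//.
have [A hA] : exists A : nat -> R, forall n,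
    has_integral mu (fun t => h t ^+ 2 * (p n t / n`!%:R)) (A n) /\
    coef n ^+ 2 <= n`!%:R * A n * (M' / poch b n).
  have /choice [A hA] := fun n => coef_bound n ha.
  by exists A => n; have [_ ? ?] := hA n.
apply: (@le_trans _ _ (M' * \sum_(n < N) A n)).
  rewrite mulr_sumr; apply: ler_sum => n _.
  have pn : 0 < poch b n / n`!%:R by rewrite divr_gt0 ?poch_gt0// ltr0n fact_gt0.
  apply: le_trans (ler_wpM2r (ltW pn) (hA n).2) _.
  rewrite le_eqVlt; apply/orP; left; apply/eqP.
  by move: M' => k; field; rewrite fact_neq0 gt_eqF// poch_gt0.
rewrite ler_pM2l//.
apply: (has_integral_le (@has_integral_sum _ _ _ mu N _ _ (fun n _ => (hA n).1)) ha) => t.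
by rewrite -mulr_sumr ler_piMr ?sqr_ge0// sum_p.
Qed.

Let cvg_partial l a : has_integral mu (fun t => h t ^+ 2) a ->
  partial N l @[N --> \oo] --> hankel h l.
Proof.
move=> ha; set y := e * l ^+ 2.
have y0 : 0 <= y by rewrite mulr_ge0 ?sqr_ge0// ltW.
pose S N t := series (fun n => T t ^+ n / poch b n * lag b n y) N.
have partialE N : partial N l = \int[mu]_t (h t * (expR (- T t) * S N t)).
  have hc n : has_integral mu (fun t => h t * (p n t / poch b n)) (coef n).
    by have [? []] := coef_bound n ha.
  have -> : partial N l = \sum_(n < N) lag b n y * coef n.
    by apply: eq_bigr => n _; rewrite mulrC.
  apply/esym/has_integral_Rintegral.
  apply: has_integral_ext (@has_integral_sum _ _ _ mu N _ _ (fun n _ =>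
    has_integralZ (lag b n y) (hc n))) => t.
  rewrite /S /series /= big_mkord !mulr_sumr; apply: eq_bigr => n _; rewrite /p.
  ring.
have mS N : measurable_fun [set: R] (S N).
  rewrite /S /series /=; apply: measurable_sum => n; apply: measurable_funM => //.
  by apply: measurable_funM => //; exact: measurable_funX.
have yT t : y * T t = (l * t / 2) ^+ 2 by rewrite /y /T; field; rewrite gt_eqF.
under eq_fun do rewrite partialE.
(* The partial sums are at most e^T e^(2yT). Multiplying by e^(-T) leaves e^(2yT), which is bounded
   where |t| <= K; outside, h vanishes. *)
apply: (@cvg_Rintegral_dominated _ _ _ mu (fun N t => h t * (expR (- T t) * S N t))
  (fun t => h t * bes b ((l * t / 2) ^+ 2))
  (fun t => expR (2 * (y * ((4 * e)^-1 * K ^+ 2))) * `|h t|)).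
- move=> N; apply: (measurable_funM mh); apply: measurable_funM; last exact: mS.
  by apply: measurableT_comp => //; exact: measurableT_comp.
- by apply: (measurable_funM mh); exact: measurable_bes_slice.
- move=> t; rewrite -yT; apply: cvgM; first exact: cvg_cst.
  have := cvgM (cvg_cst (expR (- T t))) (@cvg_lag_generating R b (T t) y b2).
  by rewrite mulrA [expR (- _) * _]mulrC expRxMexpNx_1 mul1r; apply.
- have hn : mu.-integrable setT (EFin \o (fun t => `|h t|)) by exact: integrable_norm hi.
  exact: (has_integralZ (expR (2 * (y * ((4 * e)^-1 * K ^+ 2)))) (integrable_has_integral hn)).1.
- move=> N t; have [tK|tK] := ltP K `|t|; first by rewrite hK// mul0r normr0 mulr0.
  rewrite normrM mulrC ler_wpM2r// normrM ger0_norm ?expR_ge0//.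
  apply: le_trans (ler_wpM2l (expR_ge0 _) (lag_generating_bound N b2 (T0 t) y0)) _.
  rewrite -!expRD addKr ler_expR ler_pM2l//.
  rewrite ler_wpM2l// /T ler_wpM2l ?invr_ge0 ?mulr_ge0 ?(ltW e0)//.
  by rewrite -(real_normK (num_real t)) lerXn2r// nnegrE (le_trans _ tK).
Qed.

Lemma hankel_compact_ineq :
  (\int[mu]_l (hankel h l ^+ 2 * expR (- (e * l ^+ 2)))%:E <=
   hankel_cst%:E * \int[mu]_t (h t ^+ 2)%:E)%E.
Proof.
have cst0 : 0 < hankel_cst by rewrite -MM' mulr_gt0.
have : (0 <= \int[mu]_t (h t ^+ 2)%:E)%E.
  by apply: integral_ge0 => x _; rewrite lee_fin sqr_ge0.
case Ea : (\int[mu]_t (h t ^+ 2)%:E)%E => [a| |]// a0; last first.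
  by rewrite gt0_muley ?leey// lte_fin.
have ha : has_integral mu (fun t => h t ^+ 2) a.
  by apply: ge0_has_integral => //; [exact: measurable_funX|move=> x; exact: sqr_ge0].
apply: (@fatou_le _ _ _ mu (fun N l => partial N l ^+ 2 * expR (- (e * l ^+ 2)))).
- move=> N; apply: measurable_funM; last exact: measurable_gauss.
  by apply: measurable_funX; exact: mpartial.
- by move=> N l; rewrite mulr_ge0 ?sqr_ge0 ?expR_ge0.
- move=> l; apply: cvgM; last exact: cvg_cst.
  by apply: cvgn_sqr; exact: cvg_partial ha.
- by move=> N; rewrite (partial_sqr N).2 -EFinM lee_fin partial_sqr_le.
Qed.

End compact_support.

Lemma hankel_ineq (h : R -> R) : measurable_fun [set: R] h ->
  mu.-integrable setT (EFin \o h) ->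
  (\int[mu]_l (hankel h l ^+ 2)%:E <= hankel_cst%:E * \int[mu]_t (h t ^+ 2)%:E)%E.
Proof.
move=> mh hi.
have cst0 : 0 <= hankel_cst by rewrite mulr_ge0 ?divr_ge0 ?powR_ge0 ?sqr_ge0.
pose I j : set R := [set t | `|t| <= j%:R].
pose hj (j : nat) t := h t * \1_(I j) t.
have mI j : measurable (I j).
  rewrite (_ : I j = `[- j%:R, j%:R]%classic); first exact: measurable_itv.
  by apply/seteqP; split => t; rewrite /I /= in_itv/= ler_norml.
have mhj j : measurable_fun [set: R] (hj j).
  by apply: measurable_funM => //; exact: measurable_indic.
have hjle j t : `|hj j t| <= `|h t|.
  by rewrite /hj indicE normrM ler_piMr// ger0_norm//; case: (_ \in _).
have hji j : mu.-integrable setT (EFin \o hj j).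
  apply: le_integrable hi => //; first by apply/measurable_EFinP; exact: mhj.
  by move=> t _; rewrite lee_fin.
have cvghj t : hj j t @[j --> \oo] --> h t.
  apply: (@cvg_trans _ (h t @[j --> \oo])); last exact: cvg_cst.
  apply: near_eq_cvg; exists (Num.trunc `|t|).+1 => // j /= tj.
  rewrite /hj indicE mem_set ?mulr1// /I /=.
  by rewrite ltW// (lt_le_trans (y := (Num.trunc `|t|).+1%:R)) ?ler_nat// -truncn_lt_nat.
(* A single index removes both restrictions: the support bound j grows while the Gaussian parameter
   1/(j+1) tends to 0. *)
apply: (@fatou_le _ _ _ mu (fun j l => hankel (hj j) l ^+ 2 * expR (- (j.+1%:R^-1 * l ^+ 2)))).
- move=> j; apply: measurable_funM; last exact: measurable_gauss.
  by apply: measurable_funX; exact: measurable_hankel.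
- by move=> j l; rewrite mulr_ge0 ?sqr_ge0 ?expR_ge0.
- move=> l; rewrite -[hankel h l ^+ 2]mulr1; apply: cvgM.
    apply: cvgn_sqr; apply: (@cvg_Rintegral_dominated _ _ _ mu
      (fun j t => hj j t * bes b ((l * t / 2) ^+ 2))
      (fun t => h t * bes b ((l * t / 2) ^+ 2)) (fun t => `|h t|)).
    + by move=> j; apply: (measurable_funM (mhj j)); exact: measurable_bes_slice.
    + by apply: (measurable_funM mh); exact: measurable_bes_slice.
    + by move=> t; apply: cvgM; [exact: cvghj|exact: cvg_cst].
    + exact: integrable_norm hi.
    + move=> j t; rewrite normrM (le_trans _ (hjle j t))//.
      by rewrite ler_piMr// bes_sqr_le1.
  have cl : expR (- (j.+1%:R^-1 * l ^+ 2)) @[j --> \oo] --> expR (- (0 * l ^+ 2)).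
    apply: continuous_cvg; first exact: continuous_expR.
    by apply: cvgN; apply: cvgM; [exact: (@cvg_harmonic R)|exact: cvg_cst].
  by rewrite mul0r oppr0 expR0 in cl.
move=> j; apply: (@le_trans _ _ (hankel_cst%:E * \int[mu]_t (hj j t ^+ 2)%:E)%E).
  apply: (@hankel_compact_ineq _ j%:R); [by rewrite invr_gt0|exact: mhj|exact: hji|].
  by move=> t tj; rewrite /hj indicE memNset ?mulr0// /I /=; apply/negP; rewrite -ltNge.
apply: lee_wpmul2l; first by rewrite lee_fin.
apply: ge0_le_integral => //.
- by move=> t _; rewrite lee_fin sqr_ge0.
- by apply/measurable_EFinP; apply: measurable_funX; exact: mhj.
- by apply/measurable_EFinP; exact: measurable_funX.
move=> t _; rewrite lee_fin -(real_normK (num_real (hj j t))) -(real_normK (num_real (h t))).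
by rewrite lerXn2r// nnegrE.
Qed.

End hankel.

(** * The Laguerre-Bessel transform *)

Section measurable_iterated_integral.
Context d d1 d2 (T : measurableType d) (T1 : measurableType d1) (T2 : measurableType d2)
  (R : realType) (m1 : {sigma_finite_measure set T1 -> \bar R})
  (m2 : {sigma_finite_measure set T2 -> \bar R}).

Let measurable_integral_prod (f : T * (T1 * T2) -> \bar R) :
  measurable_fun setT f -> (forall z, (0 <= f z)%E) ->
  measurable_fun setT (fun x => \int[(m1 \x m2)%E]_z f (x, z))%E.
Proof.
move=> mf f0.
pose g (w : T * T1 * T2) := f (w.1.1, (w.1.2, w.2)).
have mg : measurable_fun setT g.
  apply: (measurableT_comp mf); apply/measurable_fun_pairP; split => /=.
    exact: (measurableT_comp measurable_fst measurable_fst).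
  apply/measurable_fun_pairP; split => /=; last exact: measurable_snd.
  exact: (measurableT_comp measurable_snd measurable_fst).
have mG := @measurable_fun_fubini_tonelli_F _ _ _ _ _ m2 g mg (fun w => f0 _).
have mH := @measurable_fun_fubini_tonelli_F _ _ _ _ _ m1 _ mG
  (fun w => integral_ge0 _ (fun t _ => f0 _)).
under eq_fun => x.
  rewrite (fubini_tonelli1 (fun z => f (x, z))); last first.
  - by move=> z; exact: f0.
  - exact: (measurableT_comp mf (pair1_measurable x)).
  over.
exact: mH.
Qed.

Lemma measurable_Rintegral_prod (f : T -> T1 * T2 -> R) :
  measurable_fun setT (fun w : T * (T1 * T2) => f w.1 w.2) ->
  measurable_fun setT (fun x => \int[(m1 \x m2)%E]_z f x z).
Proof.
move=> mf; pose F w := (f w.1 w.2)%:E.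
have mF : measurable_fun setT F by apply/measurable_EFinP.
rewrite /Rintegral; apply: (measurableT_comp (fine_measurable _)) => //.
rewrite (_ : (fun x => _) = (fun x => \int[m1 \x m2]_z (F^\+)%E (x, z) -
    \int[m1 \x m2]_z (F^\-)%E (x, z))%E).
  apply: emeasurable_funB.
    by apply: measurable_integral_prod; [exact: measurable_funepos|exact: funepos_ge0].
  by apply: measurable_integral_prod; [exact: measurable_funeneg|exact: funeneg_ge0].
apply/funext => x; rewrite [LHS]integralE.
by congr (_ - _)%E; apply: eq_integral => y _; rewrite ?funeposE ?funenegE.
Qed.

End measurable_iterated_integral.

(** * Integrals over [mK] as iterated integrals with power weights *)

Section measure_on_K.
Context {R : realType}.
Variable alpha : R.
Hypothesis alpha0 : 0 <= alpha.
Notation leb := (@lebesgue_measure R).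
Notation mu1 := (power_measure (2 * alpha + 1)).
Notation mu2 := (power_measure (2 * alpha)).

Definition mK_cst : R := (pi * Gamma (alpha + 1))^-1.

Lemma mK_cst_gt0 : 0 < mK_cst.
Proof.
by rewrite invr_gt0 mulr_gt0 ?pi_gt0// Gamma_gt0//; move: alpha0; lra.
Qed.

Let w (z : measurableTypeR R * measurableTypeR R) : R := \1_KK z * K_density alpha z.

Let w0 z : 0 <= w z.
Proof. by rewrite mulr_ge0// K_density_ge0. Qed.

Let mw : measurable_fun setT w.
Proof.
apply: measurable_funM; last exact: measurable_K_density.
exact: measurable_indic measurable_KK.
Qed.

Lemma ge0_integral_mK (f : measurableTypeR R * measurableTypeR R -> \bar R) :
  measurable_fun setT f -> (forall z, (0 <= f z)%E) ->
  (\int[mK alpha]_z f z = mK_cst%:E * \int[mu1]_x \int[mu2]_t f (x, t))%E.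
Proof.
move=> mf f0.
rewrite (@ge0_integral_density _ _ _ (leb \x leb)%E _ w)//; last first.
  move=> A mA; transitivity (\int[leb \x leb]_(z in A `&` KK) (K_density alpha z)%:E)%E.
    by [].
  rewrite integral_mkcondr; apply: eq_integral => z _.
  by rewrite patchE /w indicE; case: ifPn; rewrite ?mul1r// mul0r.
have mfw : measurable_fun setT (fun z => f z * (w z)%:E)%E.
  by apply: emeasurable_funM => //; exact/measurable_EFinP.
rewrite (fubini_tonelli1 _ mfw); last by move=> z; rewrite mule_ge0 ?lee_fin.
have mG := @measurable_fun_fubini_tonelli_F _ _ _ _ _ mu2 f mf f0.
rewrite ge0_integral_power_measure; [|exact: mG|by move=> x; exact: integral_ge0].
rewrite -ge0_integralZl_EFin; last 4 first.
- exact: measurable_itv.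
- by move=> x _; rewrite mule_ge0 ?lee_fin ?powR_ge0//; exact: integral_ge0.
- apply: measurable_funTS; apply: emeasurable_funM; first exact: mG.
  by apply/measurable_EFinP; exact: measurable_powR.
- exact: ltW mK_cst_gt0.
rewrite [RHS]integral_mkcond; apply: eq_integral => x _.
rewrite patchE mem_setE in_itv/= andbT.
have mfx : measurable_fun setT (fun t => f (x, t)) by exact: measurableT_comp mf _.
rewrite /fubini_F; case: ifPn => x0; last first.
  rewrite integral0_eq// => t _; rewrite /w indicE memNset ?mul0r ?mule0// => -[/= + _].
  exact/negP.
rewrite ge0_integral_power_measure//.
rewrite muleC -muleA -EFinM -ge0_integralZr//; last 3 first.
- apply: measurable_funTS; apply: emeasurable_funM => //.
  by apply/measurable_EFinP; exact: measurable_powR.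
- by move=> t _; rewrite mule_ge0 ?lee_fin ?powR_ge0.
- by rewrite lee_fin mulr_ge0 ?powR_ge0// ltW// mK_cst_gt0.
rewrite [RHS]integral_mkcond; apply: eq_integral => t _.
rewrite patchE mem_setE in_itv/= andbT /w indicE; case: ifPn => t0; last first.
  by rewrite memNset ?mul0r ?mule0// => -[_ /= +]; exact/negP.
rewrite mem_set// mul1r /K_density /= -muleA -EFinM; congr (_ * _%:E)%E.
by rewrite /mK_cst; ring.
Qed.

Lemma ge0_integral_mK_prod (f : measurableTypeR R * measurableTypeR R -> \bar R) :
  measurable_fun setT f -> (forall z, (0 <= f z)%E) ->
  (\int[mK alpha]_z f z = mK_cst%:E * \int[mu1 \x mu2]_z f z)%E.
Proof. by move=> mf f0; rewrite ge0_integral_mK// fubini_tonelli1. Qed.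

Lemma Rintegral_mK_prod (f : measurableTypeR R * measurableTypeR R -> R) :
  measurable_fun setT f ->
  \int[mK alpha]_z f z = mK_cst * \int[(mu1 \x mu2)%E]_z f z.
Proof.
move=> mf; have k0 := mK_cst_gt0.
have mF : measurable_fun setT (EFin \o f) by exact/measurable_EFinP.
have mp := measurable_funepos mF; have mn := measurable_funeneg mF.
rewrite /Rintegral [X in fine X = _]integralE [X in _ = _ * fine X]integralE.
rewrite (ge0_integral_mK_prod mp (funepos_ge0 _)) (ge0_integral_mK_prod mn (funeneg_ge0 _)).
have := @integral_ge0 _ _ _ (mu1 \x mu2)%E setT _ (fun z _ => funepos_ge0 (EFin \o f) z).
have := @integral_ge0 _ _ _ (mu1 \x mu2)%E setT _ (fun z _ => funeneg_ge0 (EFin \o f) z).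
(* When a part is infinite, both sides are 0, as [fine] of an infinite value. *)
move: (integral _ _ (EFin \o f)^\+%E) (integral _ _ (EFin \o f)^\-%E) => [a| |] [c| |]//= _ _.
- by rewrite mulrBr.
- by rewrite gt0_muley ?lte_fin//= mulr0.
- by rewrite gt0_muley ?lte_fin//= mulr0.
- by rewrite gt0_muley ?lte_fin//= mulr0.
Qed.

Lemma integrable_mK_prod (f : measurableTypeR R * measurableTypeR R -> R) :
  (mK alpha).-integrable setT (EFin \o f) -> (mu1 \x mu2)%E.-integrable setT (EFin \o f).
Proof.
move=> /integrableP[mf fi]; apply/integrableP; split => //.
have mfa : measurable_fun setT (abse \o (EFin \o f)) by exact: measurableT_comp.
move: fi; rewrite (ge0_integral_mK_prod mfa (fun z => abse_ge0 ((EFin \o f) z))).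
have := @integral_ge0 _ _ _ (mu1 \x mu2)%E setT _ (fun z _ => abse_ge0 ((EFin \o f) z)).
case: (integral _ _ _) => [a| |]//=; first by move=> _ _; rewrite ltry.
by rewrite gt0_muley ?lte_fin ?mK_cst_gt0// ltxx.
Qed.

Lemma ae_integrable_mK (f : measurableTypeR R * measurableTypeR R -> R) :
  (mK alpha).-integrable setT (EFin \o f) ->
  {ae mu1, forall x, mu2.-integrable setT (fun t => (f (x, t))%:E)}.
Proof. by move=> /integrable_mK_prod /ae_integrable1. Qed.

Lemma Rintegral_mK (f : measurableTypeR R * measurableTypeR R -> R) :
  (mK alpha).-integrable setT (EFin \o f) ->
  \int[mK alpha]_z f z = mK_cst * \int[mu1]_x \int[mu2]_t f (x, t).
Proof.
move=> fi; have /integrableP[/measurable_EFinP mf _] := fi.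
have fi' := integrable_mK_prod fi.
rewrite Rintegral_mK_prod//; congr (_ * _).
rewrite {1}/Rintegral -integral12_prod_meas1// /Rintegral; congr (fine _).
have mF := measurable_fubini_F fi'.
(* The real-valued inner integral agrees with the extended one only for those x whose slice is
   integrable, which is almost every x. *)
apply: ae_eq_integral => //.
  apply/measurable_EFinP; apply: (measurableT_comp (fine_measurable measurableT)).
  exact: mF.
apply: filterS (ae_integrable_mK fi) => x fx _.
by rewrite fineK//; exact: integrable_fin_num.
Qed.

End measure_on_K.

Section measure_on_Khat.
Context {R : realType}.
Variable alpha : R.
Hypothesis alpha0 : 0 <= alpha.
Notation mu3 := (power_measure (3 * alpha + 1)).

Let push (m : nat) : {measure set (measurableTypeR R * nat) -> \bar R} :=
  measure_function_pushforward__canonical__measure_function_Measure mu3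
    (@pair2_measurable _ _ (measurableTypeR R) nat m).

Let slice m : {measure set (measurableTypeR R * nat) -> \bar R} :=
  mscale (NngNum (laguerre0_ge0 alpha m)) (push m).

(** [gammaK] unfolds to a scaled series of scaled pushforwards along l -> (l, m), and integration
    commutes with each of these constructions. *)
Lemma ge0_integral_gammaK (f : measurableTypeR R * nat -> \bar R) :
  measurable_fun setT f -> (forall z, (0 <= f z)%E) ->
  (\int[gammaK alpha]_z f z = (plancherel_cst alpha)%:E *
    \sum_(0 <= m <oo) ((laguerre alpha m).[0]%:E * \int[mu3]_l f (l, m)))%E.
Proof.
move=> mf f0.
transitivity (\int[mscale (NngNum (plancherel_cst_ge0 alpha)) (mseries slice 0)]_z f z)%E.
  by apply: eq_measure_integral => A mA _.
rewrite ge0_integral_mscale//; congr (_ * _)%E.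
rewrite ge0_integral_measure_series//; apply: eq_eseriesr => m _.
rewrite ge0_integral_mscale//; congr (_ * _)%E.
by rewrite ge0_integral_pushforward.
Qed.

End measure_on_Khat.

Lemma measurable_fun_nat_prod d d' (T : measurableType d) (U : measurableType d')
    (f : T * nat -> U) :
  (forall n, measurable_fun setT (fun x => f (x, n))) -> measurable_fun setT f.
Proof.
move=> mf _ Y mY; rewrite setTI.
have -> : f @^-1` Y = \bigcup_n (((fun x => f (x, n)) @^-1` Y) `*` [set n]).
  apply/seteqP; split => [[x n] /= fY|[x n] [m _ [/= fY nm]]]; first by exists n.
  by rewrite /preimage /= nm.
apply: bigcupT_measurable => n; apply: measurableX => //.
by rewrite -[X in measurable X]setTI; exact: mf.
Qed.

Section laguerre_bessel_transform.
Context {R : realType}.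
Variable alpha : R.
Hypothesis alpha0 : 0 <= alpha.
Notation b1 := (alpha + 1).
Notation b2 := (alpha + 2^-1).
Notation mu1 := (power_measure (2 * b1 - 1)).
Notation mu2 := (power_measure (2 * b2 - 1)).
Notation RR := (measurableTypeR R * measurableTypeR R)%type.

Let b1_ge : 2^-1 <= b1. Proof. by move: alpha0; lra. Qed.
Let b2_ge : 2^-1 <= b2. Proof. by move: alpha0; lra. Qed.
Let b1E : 2 * alpha + 1 = 2 * b1 - 1. Proof. by lra. Qed.
Let b2E : 2 * alpha = 2 * b2 - 1. Proof. by lra. Qed.

Lemma LB_kernelE lm z : LB_kernel alpha lm z =
  bes b2 ((lm.1 * z.2 / 2) ^+ 2) * laguerre_gauss b1 lm.1 lm.2 z.1.
Proof.
rewrite /LB_kernel (_ : alpha - 2^-1 = b2 - 1); last by lra.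
rewrite bessel_jE//; congr (_ * _).
by rewrite /laguerre_fun !laguerre_horner//; move: alpha0; lra.
Qed.

Lemma LB_kernel_le1 lm z : 0 <= lm.1 -> `|LB_kernel alpha lm z| <= 1.
Proof.
move=> l0; rewrite LB_kernelE normrM -[leRHS]mulr1 ler_pM ?bes_sqr_le1//.
have L0 : 0 < lag b1 lm.2 0.
  rewrite lag_at0 divr_gt0 ?poch_gt0// ?ltr0n ?fact_gt0//.
  by rewrite (lt_le_trans _ b1_ge).
have x0 : 0 <= lm.1 * z.1 ^+ 2 by rewrite mulr_ge0 ?sqr_ge0.
rewrite /laguerre_gauss normrM normrM (ger0_norm (expR_ge0 _)) normfV (gtr0_norm L0).
rewrite ler_pdivrMr// mul1r.
apply: le_trans (ler_wpM2l (expR_ge0 _) (lag_le lm.2 alpha0 x0)) _.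
by rewrite mulrA -expRD addNr expR0 mul1r.
Qed.

Lemma measurable_LB_kernel_fst m :
  measurable_fun setT (fun w : measurableTypeR R * RR => LB_kernel alpha (w.1, m) w.2).
Proof.
under eq_fun do rewrite LB_kernelE /=.
apply: measurable_funM.
  apply: (measurableT_comp (measurable_bes b2_ge)); apply: measurable_funX.
  apply: measurable_funM => //; apply: measurable_funM => //.
  exact: (measurableT_comp (measurable_snd) measurable_snd).
have m1 : measurable_fun setT (fun w : measurableTypeR R * RR => w.2.1).
  exact: (measurableT_comp (measurable_fst) measurable_snd).
have my : measurable_fun setT (fun w : measurableTypeR R * RR => w.1 * w.2.1 ^+ 2).
  by apply: measurable_funM => //; exact: measurable_funX.
rewrite /laguerre_gauss; apply: measurable_funM => //; apply: measurable_funM.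
  apply: measurableT_comp => //; apply: measurableT_comp => //.
  by apply: measurable_funM.
rewrite /lag; apply: measurable_sum => i; apply: measurable_funM => //.
exact: measurable_funX.
Qed.

Lemma measurable_LB_kernel lm : measurable_fun setT (fun z : RR => LB_kernel alpha lm z).
Proof.
case: lm => l m; exact: (measurableT_comp (measurable_LB_kernel_fst m) (pair1_measurable l)).
Qed.

(** The kernel is real, so [LB1] acts separately on real and imaginary parts; this is its action on
    each of them. *)
Definition LB_real (v : RR -> R) (lm : measurableTypeR R * nat) : R :=
  \int[mK alpha]_z (v z * LB_kernel alpha lm z).

Lemma measurable_LB_real v : measurable_fun setT v -> measurable_fun setT (LB_real v).
Proof.
move=> mv; apply: measurable_fun_nat_prod => m.
have mf : measurable_fun setT (fun w : measurableTypeR R * RR => v w.2 * LB_kernel alpha (w.1, m) w.2).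
  apply: measurable_funM; last exact: measurable_LB_kernel_fst.
  exact: measurableT_comp mv measurable_snd.
rewrite /LB_real; under eq_fun => l.
  rewrite Rintegral_mK_prod//; last first.
    by apply: measurable_funM => //; exact: measurable_LB_kernel.
  over.
have H := @measurable_Rintegral_prod _ _ _ (measurableTypeR R) (measurableTypeR R) (measurableTypeR R) R
  (power_measure (2 * alpha + 1)) (power_measure (2 * alpha))
  (fun l z => v z * LB_kernel alpha (l, m) z) mf.
exact: (measurable_funM (measurable_cst _) H).
Qed.

Lemma integrable_LB_kernel v lm : (mK alpha).-integrable setT (EFin \o v) -> 0 <= lm.1 ->
  (mK alpha).-integrable setT (EFin \o (fun z => v z * LB_kernel alpha lm z)).
Proof.
move=> vi l0; have /integrableP[/measurable_EFinP mv _] := vi.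
apply: le_integrable vi => //.
  by apply/measurable_EFinP; apply: measurable_funM => //; exact: measurable_LB_kernel.
by move=> z _; rewrite lee_fin normrM ler_piMr// LB_kernel_le1.
Qed.

Lemma LB_real_le v lm : (mK alpha).-integrable setT (EFin \o v) -> 0 <= lm.1 ->
  `|LB_real v lm| <= \int[mK alpha]_z `|v z|.
Proof.
move=> vi l0; have hk := integrable_LB_kernel vi l0.
apply: le_trans (le_normr_Rintegral measurableT hk) _.
apply: le_Rintegral => //; first exact: integrable_norm hk.
  exact: integrable_norm vi.
by move=> z _; rewrite normrM ler_piMr// LB_kernel_le1.
Qed.

End laguerre_bessel_transform.

(** * The transform does not increase L2 norms *)

Section bessel_inequality_LB.
Context {R : realType}.
Variable alpha : R.
Hypothesis alpha0 : 0 <= alpha.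
Notation b1 := (alpha + 1).
Notation b2 := (alpha + 2^-1).
Notation mu1 := (power_measure (2 * b1 - 1)).
Notation mu2 := (power_measure (2 * b2 - 1)).
Notation leb := (@lebesgue_measure R).
Notation RR := (measurableTypeR R * measurableTypeR R)%type.

Let b1_ge : 2^-1 <= b1. Proof. by move: alpha0; lra. Qed.
Let b2_ge : 2^-1 <= b2. Proof. by move: alpha0; lra. Qed.
Let b1E : 2 * alpha + 1 = 2 * b1 - 1. Proof. by lra. Qed.
Let b2E : 2 * alpha = 2 * b2 - 1. Proof. by lra. Qed.

Variable v : RR -> R.
Hypothesis vi : (mK alpha).-integrable setT (EFin \o v).

Let mv : measurable_fun setT v.
Proof. by have /integrableP[/measurable_EFinP] := vi. Qed.

Let H (x l : R) : R := hankel b2 (fun t => v (x, t)) l.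

Let mH : measurable_fun setT (fun w : measurableTypeR R * measurableTypeR R => H w.1 w.2).
Proof.
apply: (@measurable_Rintegral_param _ _ (measurableTypeR R * measurableTypeR R)%type
  (measurableTypeR R) R mu2 (fun w t => v (w.1, t) * bes b2 ((w.2 * t / 2) ^+ 2))).
apply: measurable_funM.
  apply: (measurableT_comp mv); apply/measurable_fun_pairP; split => /=.
    exact: (measurableT_comp measurable_fst measurable_fst).
  exact: measurable_snd.
apply: (measurableT_comp (measurable_bes b2_ge)); apply: measurable_funX.
apply: measurable_funM => //; apply: measurable_funM => //.
exact: (measurableT_comp measurable_snd measurable_fst).
Qed.

Let mHx (l : R) : measurable_fun setT (fun x : measurableTypeR R => H x l).
Proof. exact: (measurableT_comp mH (pair2_measurable l)). Qed.

(** The kernel is a product of a function of t and a function of x, so Fubini turns the transform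
    into a Laguerre coefficient in x of the Hankel transform in t. The inner factorization holds for
    almost every x. *)
Lemma LB_realE l m : 0 <= l -> LB_real alpha v (l, m) =
  mK_cst alpha * \int[mu1]_x (H x l * laguerre_gauss b1 l m x).
Proof.
move=> l0.
have vki := integrable_LB_kernel alpha0 vi (l0 : 0 <= (l, m).1).
have e := Rintegral_mK alpha0 vki.
transitivity (\int[mK alpha]_z (v z * LB_kernel alpha (l, m) z)); first by [].
rewrite {}e b1E b2E; congr (_ * _).
have := ae_integrable_mK alpha0 vi; rewrite b1E b2E => aev.
have mker := measurable_LB_kernel alpha0 (l, m).
rewrite /Rintegral; congr (fine _); apply: ae_eq_integral => //.
- apply/measurable_EFinP.
  apply: (@measurable_Rintegral_param _ _ (measurableTypeR R) (measurableTypeR R) R mu2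
    (fun x t => v (x, t) * LB_kernel alpha (l, m) (x, t))).
  apply: (@measurable_funM _ _ _ _ (fun z => v (z.1, z.2)) (fun z => LB_kernel alpha (l, m) (z.1, z.2))).
    by under eq_fun do rewrite -surjective_pairing.
  by under eq_fun do rewrite -surjective_pairing.
- apply/measurable_EFinP; apply: measurable_funM; first exact: mHx.
  exact: measurable_laguerre_gauss.
apply: filterS aev => x vx _; congr EFin; rewrite /H /hankel.
have hb : mu2.-integrable setT (EFin \o (fun t => v (x, t) * bes b2 ((l * t / 2) ^+ 2))).
  apply: le_integrable vx => //.
    apply/measurable_EFinP; apply: measurable_funM; last exact: measurable_bes_slice.
    exact: (measurableT_comp mv (pair1_measurable x)).
  by move=> t _; rewrite lee_fin normrM ler_piMr// bes_sqr_le1.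
rewrite -RintegralZr//; apply: eq_Rintegral => t _.
by rewrite LB_kernelE//= mulrA.
Qed.

Let laguerre_at0 m : (laguerre alpha m).[0] = lag b1 m 0.
Proof. by rewrite laguerre_horner//; move: alpha0; lra. Qed.

Let lag_ge0 m : 0 <= lag b1 m 0.
Proof. by rewrite -laguerre_at0 laguerre0_ge0. Qed.

(** Bessel's inequality in x for the Laguerre functions of scale e = l, applied to the Hankel
    transforms of the slices; the partial sums in m are bounded uniformly. *)
Let sum_LB l : 0 < l ->
  (\sum_(0 <= m <oo) ((lag b1 m 0)%:E * ((LB_real alpha v (l, m)) ^+ 2)%:E) <=
   (mK_cst alpha ^+ 2 * (l `^ (- b1) / 2 * Gamma b1))%:E * \int[mu1]_x (H x l ^+ 2)%:E)%E.
Proof.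
move=> l0; apply: lime_le.
  by apply: is_cvg_nneseries => m _ _; rewrite -EFinM lee_fin mulr_ge0 ?sqr_ge0.
apply: nearW => N.
have := laguerre_bessel_ineq b1_ge l0 N (mHx l) => h.
rewrite big_mkord; under eq_bigr => m _.
  rewrite LB_realE ?(ltW l0)// -EFinM exprMn mulrCA; over.
rewrite sumEFin -mulr_sumr (EFinM _ (\sum_(_ < N) _)) (EFinM _ (_ * Gamma b1)) -muleA.
by apply: lee_wpmul2l => //; rewrite lee_fin sqr_ge0.
Qed.

Let hankel_x : (\int[mu1]_x \int[mu2]_l (H x l ^+ 2)%:E <=
  (hankel_cst b2)%:E * \int[mu1]_x \int[mu2]_t (v (x, t) ^+ 2)%:E)%E.
Proof.
have := ae_integrable_mK alpha0 vi; rewrite b1E b2E => aev.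
have hc0 : 0 <= hankel_cst b2 by rewrite mulr_ge0 ?divr_ge0 ?powR_ge0 ?sqr_ge0.
have mv2 : measurable_fun setT (fun z : RR => (v z ^+ 2)%:E).
  by apply/measurable_EFinP; exact: measurable_funX.
have v20 z : (0 <= (v z ^+ 2)%:E)%E by rewrite lee_fin sqr_ge0.
have mV := @measurable_fun_fubini_tonelli_F _ _ _ _ _ mu2 _ mv2 v20.
have mH2 : measurable_fun setT (fun w : RR => (H w.1 w.2 ^+ 2)%:E).
  by apply/measurable_EFinP; exact: measurable_funX.
have mHH := @measurable_fun_fubini_tonelli_F _ _ _ _ _ mu2 _ mH2 (fun w => ltac:(by rewrite lee_fin sqr_ge0)).
rewrite -ge0_integralZl_EFin//.
- apply: ae_ge0_le_integral => //.
  + by move=> x _; apply: integral_ge0 => l _; rewrite lee_fin sqr_ge0.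
  + by move=> x _; rewrite mule_ge0 ?lee_fin//; apply: integral_ge0 => t _.
  + exact: measurable_funeM.
  apply: filterS aev => x vx _; apply: hankel_ineq => //.
  exact: (measurableT_comp mv (pair1_measurable x)).
- by move=> x _; apply: integral_ge0 => t _.
Qed.

Lemma LB_real_plancherel_le :
  (\int[gammaK alpha]_lm ((LB_real alpha v lm ^+ 2) * \1_Khat lm)%:E <=
   \int[mK alpha]_z (v z ^+ 2)%:E)%E.
Proof.
have mLB := measurable_LB_real alpha0 mv.
have mKhat : measurable (Khat : set (measurableTypeR R * nat)).
  rewrite (_ : Khat = `[0, +oo[%classic `*` setT); first exact: measurableX.
  by apply/seteqP; split => -[l m]; rewrite /Khat /= in_itv/= andbT// => -[].
rewrite ge0_integral_gammaK; last 2 first.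
- apply/measurable_EFinP; apply: measurable_funM; first exact: measurable_funX.
  exact: measurable_indic.
- by move=> lm; rewrite lee_fin mulr_ge0 ?sqr_ge0.
have mLBm m : measurable_fun setT (fun l : measurableTypeR R => LB_real alpha v (l, m) ^+ 2).
  by apply: measurable_funX; exact: (measurableT_comp mLB (pair2_measurable m)).
have mKm m : measurable_fun setT (fun l : measurableTypeR R => \1_Khat (l, m) : R).
  have mi : measurable_fun setT (\1_Khat : measurableTypeR R * nat -> R).
    exact: measurable_indic.
  exact: (measurableT_comp mi (pair2_measurable m)).
have mpow c : measurable_fun (`]0%R, +oo[ : set (measurableTypeR R)) (fun l : R => (l `^ c)%:E).
  by apply: measurable_funTS; apply/measurable_EFinP; exact: measurable_powR.
have gammaE m : (\int[power_measure (3 * alpha + 1)]_l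
    ((LB_real alpha v (l, m) ^+ 2) * \1_Khat (l, m))%:E =
    \int[leb]_(l in `]0%R, +oo[) ((LB_real alpha v (l, m) ^+ 2)%:E * (l `^ (3 * alpha + 1))%:E))%E.
  rewrite ge0_integral_power_measure; last 2 first.
  - apply/measurable_EFinP; apply: measurable_funM; first exact: mLBm.
    exact: mKm.
  - by move=> l; rewrite lee_fin mulr_ge0 ?sqr_ge0.
  (* The null point l = 0 is dropped, since scale l = 0 is excluded from [sum_LB]. *)
  rewrite -integral_itv_obnd_cbnd; last first.
    apply: measurable_funTS; apply: emeasurable_funM; apply/measurable_EFinP.
      apply: measurable_funM; first exact: mLBm.
      exact: mKm.
    exact: measurable_powR.
  apply: eq_integral => l; rewrite mem_setE in_itv/= andbT => l0.
  by rewrite indicE mem_set ?mulr1// /Khat /= ltW.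
under eq_eseriesr do rewrite gammaE laguerre_at0.
have termE m : ((lag b1 m 0)%:E * \int[leb]_(l in `]0%R, +oo[)
    ((LB_real alpha v (l, m) ^+ 2)%:E * (l `^ (3 * alpha + 1))%:E) =
    \int[leb]_(l in `]0%R, +oo[) ((lag b1 m 0)%:E * ((LB_real alpha v (l, m) ^+ 2)%:E) *
       (l `^ (3 * alpha + 1))%:E))%E.
  rewrite -ge0_integralZl_EFin//.
  - by apply: eq_integral => l _; rewrite muleA.
  - by move=> l _; rewrite mule_ge0// lee_fin ?sqr_ge0 ?powR_ge0.
  - apply: emeasurable_funM; last exact: mpow.
    by apply: measurable_funTS; apply/measurable_EFinP; exact: mLBm.
under eq_eseriesr do rewrite termE.
rewrite -integral_nneseries//; last 2 first.
- move=> m; apply: emeasurable_funM; last exact: mpow.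
  by apply: measurable_funTS; apply/measurable_EFinP; apply: measurable_funM => //; exact: mLBm.
- by move=> m l _; rewrite !mule_ge0// lee_fin ?sqr_ge0 ?powR_ge0.
pose D := mK_cst alpha ^+ 2 / 2 * Gamma b1.
have D0 : 0 <= D by rewrite mulr_ge0 ?Gamma_ge0// divr_ge0 ?sqr_ge0.
have mH2 : measurable_fun setT (fun w : RR => (H w.1 w.2 ^+ 2)%:E).
  by apply/measurable_EFinP; exact: measurable_funX.
have mHG := @measurable_fun_fubini_tonelli_G _ _ _ _ _ mu1 _ mH2 (fun w => ltac:(by rewrite lee_fin sqr_ge0)).
apply: (@le_trans _ _ ((plancherel_cst alpha)%:E * (D%:E *
    \int[mu2]_l \int[mu1]_x (H x l ^+ 2)%:E)))%E.
  apply: lee_wpmul2l; first by rewrite lee_fin plancherel_cst_ge0.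
  rewrite ge0_integral_power_measure; last 2 first.
  - exact: mHG.
  - by move=> l; apply: integral_ge0 => x _; rewrite lee_fin sqr_ge0.
  have mR : measurable_fun setT (fun l : measurableTypeR R =>
      (\int[mu1]_x (H x l ^+ 2)%:E) * (l `^ (2 * b2 - 1))%:E)%E.
    by apply: emeasurable_funM; [exact: mHG|apply/measurable_EFinP; exact: measurable_powR].
  have R0 l : (0 <= (\int[mu1]_x (H x l ^+ 2)%:E) * (l `^ (2 * b2 - 1))%:E)%E.
    by rewrite mule_ge0 ?lee_fin ?powR_ge0//; apply: integral_ge0 => x _; rewrite lee_fin sqr_ge0.
  rewrite -integral_itv_obnd_cbnd; last exact: measurable_funTS.
  rewrite -ge0_integralZl_EFin//; last exact: measurable_funTS.
  apply: ge0_le_integral => //.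
  - move=> l _; apply: nneseries_ge0 => m _ _.
    by rewrite !mule_ge0// lee_fin ?sqr_ge0 ?powR_ge0.
  - apply: ge0_emeasurable_sum => m; last first.
      move=> _; apply: emeasurable_funM; last exact: mpow.
      by apply: measurable_funTS; apply/measurable_EFinP; apply: measurable_funM => //; exact: mLBm.
    by move=> l _ _; rewrite !mule_ge0// lee_fin ?sqr_ge0 ?powR_ge0.
  - by apply: measurable_funeM; exact: measurable_funTS.
  move=> l; rewrite /= in_itv/= andbT => l0.
  under eq_eseriesr do rewrite muleC.
  rewrite nneseriesZl; last by move=> m _; rewrite -EFinM lee_fin mulr_ge0 ?sqr_ge0.
  apply: le_trans (lee_wpmul2l _ (sum_LB l0)) _; first by rewrite lee_fin powR_ge0.
  (* The weight of [gammaK] times the cost of Bessel's inequality at scale l is exactly the weight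
     of the Hankel transform. *)
  have lE : l `^ (2 * b2 - 1) = l `^ (3 * alpha + 1) * l `^ (- b1).
    by rewrite -powRD; [congr (_ `^ _); lra|apply/implyP => _; rewrite gt_eqF].
  rewrite lE; move: (\int[mu1]_x _)%E => I.
  rewrite [(I * _)%E]muleC !muleA -!EFinM.
  suff -> : l `^ (3 * alpha + 1) * (mK_cst alpha ^+ 2 * (l `^ (- b1) / 2 * Gamma b1)) =
    D * (l `^ (3 * alpha + 1) * l `^ (- b1)) by [].
  by rewrite /D; ring.
rewrite -(@EFin_tonelli _ _ _ _ _ mu1 mu2 (fun x l => H x l ^+ 2)); last 2 first.
- exact: measurable_funX.
- by move=> x l; exact: sqr_ge0.
have mv2 : measurable_fun setT (fun z : RR => (v z ^+ 2)%:E).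
  by apply/measurable_EFinP; exact: measurable_funX.
have v20 z : (0 <= (v z ^+ 2)%:E)%E by rewrite lee_fin sqr_ge0.
have eK := ge0_integral_mK alpha0 mv2 v20.
rewrite b1E b2E in eK.
rewrite [leRHS]eK.
rewrite muleA -(EFinM _ D).
have c0 : 0 <= plancherel_cst alpha * D by rewrite mulr_ge0 ?plancherel_cst_ge0.
apply: le_trans (lee_wpmul2l _ hankel_x) _; first by rewrite lee_fin.
(* The constants match exactly because 4^(b2)/4 = 2^(2 alpha - 1), so no factor is lost. *)
rewrite muleA -EFinM (_ : plancherel_cst alpha * D * hankel_cst b2 = mK_cst alpha)//.
have g1 := Gamma_gt0 b1_ge; have g2 := Gamma_gt0 b2_ge; have p0 := pi_gt0 R.
rewrite /plancherel_cst /D /hankel_cst /mK_cst.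
have -> : 4 `^ b2 / 4 = 2 `^ (2 * alpha - 1) :> R.
  have -> : 4 = 2 `^ 2 :> R by rewrite powR_mulrn// -natrX.
  rewrite -powRrM -powRB; last by apply/implyP => _; rewrite pnatr_eq0.
  by congr (_ `^ _); lra.
have q0 : 0 < 2 `^ (2 * alpha - 1) :> R by rewrite powR_gt0.
move: (Gamma b1) (Gamma b2) (pi : R) (2 `^ _) g1 g2 p0 q0 => G1 G2 p q g1 g2 p0 q0.
by field; rewrite !gt_eqF.
Qed.

End bessel_inequality_LB.

(** * The constant *)

Section beta_bounds.
Context {R : realType}.
Notation mu := (@lebesgue_measure R).
Implicit Types (a b x y : R).

(** A majorant of the Beta integrand when both exponents are at least -1/2. It serves to show that
    the integral defining [Beta] is finite, without which no lower bound could be read off its real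
    value. *)
Let h (y : R) : R := y `^ (- 2^-1) + (1 - y) `^ (- 2^-1).

Lemma is_derive_sqrt_sub_sqrt_onem y : 0 < y < 1 ->
  is_derive y 1 (fun y : R => 2 * (y `^ 2^-1 - (1 - y) `^ 2^-1)) (h y).
Proof.
move=> /andP[y0 y1].
have y10 : 0 < 1 - y by rewrite subr_gt0.
have d1 := is_derive1_powR (2^-1 : R) y0.
have d2 := is_derive1_powR (2^-1 : R) y10.
have d3 : is_derive y 1 (fun y : R => 1 - y) (-1).
  by apply: is_derive_eq; rewrite add0r mul1r.
have d4 := @is_derive1_comp _ (@powR R ^~ 2^-1) (fun y : R => 1 - y) y _ _ d2 d3.
apply: is_derive_eq.
by rewrite /GRing.scale /= /h (_ : 2^-1 - 1 = - 2^-1 :> R); [field|lra].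
Qed.

Lemma integral_inv_sqrt_le (d : R) : 0 < d -> d <= 3^-1 ->
  (\int[mu]_(y in `[d, (1 - d)%R]) (h y)%:E <= 4%:E)%E.
Proof.
move=> d0 d3.
have dF y : y \in `[d, 1 - d] ->
    is_derive y 1 (fun y : R => 2 * (y `^ 2^-1 - (1 - y) `^ 2^-1)) (h y).
  rewrite in_itv/= => /andP[? ?]; apply: is_derive_sqrt_sub_sqrt_onem.
  by apply/andP; split; move: d0; lra.
have cF y : y \in `[d, 1 - d] ->
    {for y, continuous (fun y : R => 2 * (y `^ 2^-1 - (1 - y) `^ 2^-1))}.
  move=> yI; apply: differentiable_continuous; apply/derivable1_diffP.
  by have hd := dF _ yI; apply: ex_derive.
have dI : d < 1 - d by move: d0 d3; lra.
rewrite (@continuous_FTC2 _ _ (fun y : R => 2 * (y `^ 2^-1 - (1 - y) `^ 2^-1)))//.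
- rewrite -EFinB lee_fin opprB addrCA subrr addr0.
  have p1 (x : R) : 0 <= x <= 1 -> 0 <= x `^ 2^-1 <= 1.
    move=> /andP[x0 x1]; rewrite powR_ge0/=.
    have := @ge0_ler_powR R 2^-1 _ x 1; rewrite powR1 => -> //=; rewrite ?nnegrE//.
  have /andP[? ?] : 0 <= d `^ 2^-1 <= 1 by apply: p1; move: d0 d3 dI; lra.
  have /andP[? ?] : 0 <= (1 - d) `^ 2^-1 <= 1 by apply: p1; move: d0 d3 dI; lra.
  lra.
- apply: continuous_in_subspaceT => y /[!inE]/= yI.
  have /andP[y0 y1] : 0 < y < 1.
    by move: yI; rewrite in_itv/= => /andP[? ?]; apply/andP; split; move: d0; lra.
  apply: (@continuousD _ _ _ (fun y : R => y `^ (- 2^-1)) (fun y : R => (1 - y) `^ (- 2^-1))).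
    exact: gt0_continuous_powR.
  apply: (@continuous_comp _ _ _ (fun y : R => 1 - y) (fun y : R => y `^ (- 2^-1))).
    by apply: cvgB; [exact: cvg_cst|exact: cvg_id].
  by apply: gt0_continuous_powR; rewrite subr_gt0.
- split.
  + move=> y yI; have hd := dF y (subset_itv_oo_cc yI); exact: ex_derive.
  + by apply: cvg_at_right_filter; apply: cF; rewrite in_itv/= lexx ltW.
  + by apply: cvg_at_left_filter; apply: cF; rewrite in_itv/= lexx ltW.
- move=> y yI; have hd := dF y (subset_itv_oo_cc yI).
  by rewrite derive1E derive_val.
Qed.

Let measurable_onem : measurable_fun [set: R] (fun y : R => 1 - y).
Proof. exact: measurable_funB. Qed.

Let measurable_beta a b :
  measurable_fun [set: R] (fun y : R => y `^ a * (1 - y) `^ b).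
Proof.
apply: measurable_funM; first exact: measurable_powR.
exact: (measurableT_comp (measurable_powR _) measurable_onem).
Qed.

Lemma integral_inv_sqrt_itv01_le : (\int[mu]_(y in `]0%R, 1%R[) (h y)%:E <= 4%:E)%E.
Proof.
have mh : measurable_fun [set: R] h.
  apply: measurable_funD; first exact: measurable_powR.
  exact: (measurableT_comp (measurable_powR _) measurable_onem).
have h0 y : 0 <= h y by rewrite addr_ge0 ?powR_ge0.
(* The offset 3 keeps the endpoint at most 1/3, so that the truncated interval is never
   degenerate. *)
pose u n (y : R) : R := h y * \1_(`[n.+3%:R^-1, 1 - n.+3%:R^-1]) y.
rewrite (_ : (\int[mu]_(y in `]0%R, 1%R[) (h y)%:E =
    \int[mu]_y (h y * \1_(`]0%R, 1%R[ : set R) y)%:E)%E); last first.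
  rewrite [LHS]integral_mkcond; apply: eq_integral => y _.
  by rewrite patchE indicE; case: (y \in _); rewrite ?mulr1 ?mulr0.
apply: (@fatou_le _ _ _ mu u) => [n|n x|x|n].
- apply: measurable_funM => //.
- by rewrite mulr_ge0.
- apply: cvg_near_cst.
  have [/andP[x0 x1]|x01] := boolP (0 < x < 1).
    have m0 : 0 < Num.min x (1 - x) by rewrite lt_min x0 subr_gt0.
    have /cvgr0Pnorm_lt/(_ _ m0)[N _ hN] := @cvg_harmonic R.
    exists N => // n Nn.
    have := hN n.+2 (leq_trans Nn (leq_addl 2 n)).
    rewrite /harmonic/= ger0_norm ?invr_ge0// lt_min => /andP[n1 n2].
    rewrite /u !indicE !mem_set//=; rewrite in_itv/=; first by rewrite x0.
    by rewrite (ltW n1) lerBrDr addrC -lerBrDr ltW.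
  apply: nearW => n; rewrite /u !indicE !memNset//=; rewrite in_itv/=; first exact/negP.
  have : 0 < n.+3%:R^-1 :> R by rewrite invr_gt0.
  move: (n.+3%:R^-1 : R) x x01 => d x x01 d0.
  by move=> /andP[? ?]; case/negP: x01; apply/andP; split; move: d0; lra.
- rewrite (_ : (\int[mu]_y (u n y)%:E =
      \int[mu]_(y in `[(n.+3%:R^-1)%R, (1 - n.+3%:R^-1)%R]) (h y)%:E)%E).
    by apply: integral_inv_sqrt_le; rewrite ?lef_pV2 ?posrE ?invr_gt0 ?ltr0n// ler_nat.
  rewrite [RHS]integral_mkcond; apply: eq_integral => y _.
  by rewrite patchE /u indicE; case: (y \in _); rewrite ?mulr1 ?mulr0.
Qed.

(** On ]0, 1[ each power is at most the inverse square root. With u, v the square roots of y and 1 -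
    y, it remains to see 1 <= u + v, which follows from u^2 + v^2 = 1. *)
Lemma beta_integrand_le a b y : - 2^-1 <= a -> - 2^-1 <= b -> 0 < y < 1 ->
  y `^ a * (1 - y) `^ b <= h y.
Proof.
move=> a2 b2 /andP[y0 y1].
have z0 : 0 < 1 - y by rewrite subr_gt0.
have le_p (c x : R) : - 2^-1 <= c -> 0 < x -> x < 1 -> x `^ c <= (Num.sqrt x)^-1.
  move=> c2 x0 x1; rewrite -powR12_sqrt ?(ltW x0)// -powRN.
  by rewrite ger_powR// x0 ltW.
apply: le_trans (ler_pM _ _ (le_p _ _ a2 y0 y1) (le_p _ _ b2 z0 _)) _; rewrite ?powR_ge0//; first by lra.
rewrite /h !powRN !powR12_sqrt ?(ltW y0) ?(ltW z0)//.
set u := Num.sqrt y; set v := Num.sqrt (1 - y).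
have u0 : 0 < u by rewrite sqrtr_gt0.
have v0 : 0 < v by rewrite sqrtr_gt0.
have uv : u ^+ 2 + v ^+ 2 = 1 by rewrite !sqr_sqrtr ?(ltW y0) ?(ltW z0)//; lra.
rewrite -(ler_pM2r (mulr_gt0 u0 v0)).
rewrite (_ : _ * (u * v) = 1); last by field; rewrite !gt_eqF.
rewrite (_ : (u^-1 + v^-1) * (u * v) = u + v); last by field; rewrite !gt_eqF.
nra.
Qed.

Lemma Beta_ge a b : 2^-1 <= a -> 2^-1 <= b -> 2 * 4 `^ (- (a + b)) <= Beta a b.
Proof.
move=> a2 b2.
have mB := measurable_beta (a - 1) (b - 1).
have lty : (\int[mu]_(y in `]0%R, 1%R[) (y `^ (a - 1) * (1 - y) `^ (b - 1))%:E < +oo)%E.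
  apply: (@le_lt_trans _ _ 4%:E); last by rewrite ltry.
  apply: le_trans integral_inv_sqrt_itv01_le; apply: ge0_le_integral => //.
  - by move=> y _; rewrite lee_fin mulr_ge0 ?powR_ge0.
  - by apply: measurable_funTS; apply/measurable_EFinP.
  - apply: measurable_funTS; apply/measurable_EFinP; apply: measurable_funD.
      exact: measurable_powR.
    exact: (measurableT_comp (measurable_powR _) measurable_onem).
  move=> y; rewrite /= in_itv/= => y01; rewrite lee_fin.
  by apply: beta_integrand_le => //; move: a2 b2; lra.
rewrite -lee_fin /Beta /Rintegral fineK; last first.
  by rewrite ge0_fin_numE//; apply: integral_ge0 => y _; rewrite lee_fin mulr_ge0 ?powR_ge0.
(* Factoring 1/(y(1-y)) >= 4 out of the integrand leaves y^a (1-y)^b >= 4^(-(a+b)) on an interval of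
   length 1/2. *)
apply: (@le_trans _ _ (\int[mu]_(y in `[(4^-1)%R, (3 / 4)%R]) (4 * 4 `^ (- (a + b)))%:E)%E).
  rewrite integral_cst//= lebesgue_measure_itv/= lte_fin ifT; last by lra.
  by rewrite -EFinB -EFinM lee_fin; have := powR_ge0 (4 : R) (- (a + b)); lra.
apply: (@le_trans _ _ (\int[mu]_(y in `[(4^-1)%R, (3 / 4)%R]) (y `^ (a - 1) * (1 - y) `^ (b - 1))%:E)%E); last first.
  apply: ge0_subset_integral => //.
  - by apply: measurable_funTS; apply/measurable_EFinP.
  - by move=> y _; rewrite lee_fin mulr_ge0 ?powR_ge0.
  - by move=> y; rewrite /= !in_itv/=; lra.
apply: ge0_le_integral => //.
- by apply: measurable_funTS; apply/measurable_EFinP.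
move=> y; rewrite /= in_itv/= => /andP[y1 y2]; rewrite lee_fin.
have y0 : 0 < y by lra.
have z0 : 0 < 1 - y by lra.
rewrite !powRB ?(gt_eqF y0) ?(gt_eqF z0) ?implybT// !powRr1 ?(ltW y0) ?(ltW z0)//.
have ge_p (c x : R) : 0 <= c -> 4^-1 <= x -> 4 `^ (- c) <= x `^ c.
  move=> c0 x4; rewrite -mulN1r powRrM powR_inv1//.
  by apply: ge0_ler_powR; rewrite ?nnegrE//; lra.
rewrite opprD powRD ?pnatr_eq0 ?implybT//.
have -> : y `^ a / y * ((1 - y) `^ b / (1 - y)) =
  (y * (1 - y))^-1 * (y `^ a * (1 - y) `^ b) by field; rewrite (gt_eqF y0) (gt_eqF z0).
apply: ler_pM; rewrite ?mulr_ge0 ?powR_ge0//.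
- rewrite -[leLHS]invrK lef_pV2 ?posrE ?invr_gt0 ?mulr_gt0//.
  have := sqr_ge0 (y - 2^-1); rewrite expr2; nra.
by apply: ler_pM; rewrite ?powR_ge0//; apply: ge_p; lra.
Qed.

End beta_bounds.

Section constant.
Context {R : realType}.
Variable alpha : R.
Hypothesis alpha0 : 0 <= alpha.
Notation a := (3 * alpha + 1).
Notation s := (3 * alpha + 2).

(* mK_cst alpha * 4 `^ (- (alpha + 2^-1)) * r `^ (2 * (3 * alpha + 2)) bounds the mass
   of the homogeneous ball of radius r. *)
Lemma C_alpha_gt :
  (16 * (mK_cst alpha * 4 `^ (- (alpha + 2^-1)))) `^ (2 * s)^-1 < C_alpha alpha.
Proof.
have a1 : 1 <= a by move: alpha0; lra.
have s2 : 2 <= s by move: alpha0; lra.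
have a0 : 0 < a by apply: lt_le_trans a1.
have s0 : 0 < s by apply: lt_le_trans s2.
set e := (2 * s)^-1.
have e0 : 0 < e by rewrite invr_gt0 mulr_gt0.
have kap := mK_cst_gt0 alpha0.
have B_ge : 2 * 4 `^ (- (s / 2)) <= Beta ((alpha + 1) / 2) ((2 * alpha + 1) / 2).
  have -> : s / 2 = (alpha + 1) / 2 + (2 * alpha + 1) / 2 by lra.
  by apply: Beta_ge; move: alpha0; lra.
have p4 x : 0 < 4 `^ x :> R by rewrite powR_gt0.
set B := Beta _ _ in B_ge *.
pose D := B / (4 `^ (alpha + 1) * pi * Gamma (alpha + 1)).
have DE : D = B * mK_cst alpha * 4 `^ (- (alpha + 1)).
  by rewrite /D /mK_cst powRN -!mulrA -!invfM; congr (_ * _^-1); ring.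
have B0 : 0 < B by apply: lt_le_trans B_ge; rewrite mulr_gt0.
have D0 : 0 < D by rewrite DE !mulr_gt0.
have t0 : 0 < s ^+ 2 / a by rewrite divr_gt0 ?exprn_gt0.
(* Both constants become powers with exponent e, so only the bases need comparing. *)
have -> : C_alpha alpha = ((s ^+ 2 / a) `^ (2 * s) * a^-1 * D) `^ e.
  rewrite (@powRM _ _ D) ?(ltW D0) ?mulr_ge0 ?powR_ge0 ?invr_ge0 ?(ltW a0)//.
  rewrite (@powRM _ _ a^-1) ?powR_ge0 ?invr_ge0 ?(ltW a0)//.
  rewrite -powRrM (_ : 2 * s * e = 1); last by rewrite divff// gt_eqF// mulr_gt0.
  rewrite powRr1 ?(ltW t0)// -powR_inv1 ?(ltW a0)// -powRrM mulN1r.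
  rewrite /C_alpha -/B -/D -/e; congr (_ * _); rewrite -mulrA; congr (_ * _).
  by rewrite powRB ?(gt_eqF a0) ?implybT// powRr1 ?(ltW a0)// mulrC powR_inv1 ?(ltW a0).
apply: (gt0_ltr_powR e0); rewrite ?nnegrE.
- by apply: mulr_ge0 => //; apply: mulr_ge0; [exact: ltW|exact: powR_ge0].
- by apply: mulr_ge0; [apply: mulr_ge0; [exact: powR_ge0|rewrite invr_ge0 ltW]|exact: ltW].
(* Here a = s - 1, so this is (s - 2)^2 >= 0. All but one of the 2s factors s^2/a are then replaced
   by 4. *)
have t4 : 4 <= s ^+ 2 / a by rewrite ler_pdivlMr//; nra.
have ts : 4 `^ (2 * s - 1) * (s ^+ 2 / a) <= (s ^+ 2 / a) `^ (2 * s).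
  rewrite -(mulr_powRB1 (ltW t0) (_ : 0 < 2 * s)) ?mulr_gt0// mulrC.
  apply: ler_wpM2l; first exact: ltW.
  by apply: ge0_ler_powR; rewrite ?nnegrE//; lra.
(* The one factor s^2/a kept aside, divided by a, provides the strict inequality. *)
have sa : 1 < s ^+ 2 / a ^+ 2.
  by rewrite ltr_pdivlMr ?exprn_gt0// mul1r ltr_pXn2r// ?nnegrE; lra.
apply: (@lt_le_trans _ _ (4 `^ (2 * s - 1) * (s ^+ 2 / a) * a^-1 * D)); last first.
  by rewrite ler_wpM2r ?(ltW D0)// ler_wpM2r// invr_ge0 ltW.
rewrite DE.
apply: (@lt_le_trans _ _ (4 `^ (2 * s - 1) * (s ^+ 2 / a) * a^-1 *
    (2 * 4 `^ (- (s / 2)) * mK_cst alpha * 4 `^ (- (alpha + 1))))); last first.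
  apply: ler_wpM2l; first by rewrite !mulr_ge0 ?invr_ge0 ?powR_ge0// ltW.
  by apply: ler_wpM2r; [exact: powR_ge0|apply: ler_wpM2r; [exact: ltW|]].
have -> : 4 `^ (- (alpha + 2^-1)) = 2 * 4 `^ (- (alpha + 1)) :> R.
  have -> : - (alpha + 2^-1) = 2^-1 - (alpha + 1) by lra.
  by rewrite powRB ?pnatr_eq0 ?implybT// -powRN powR12_sqrt// (_ : 4 = 2 ^+ 2) ?sqrtr_sqr ?ger0_norm// -natrX.
(* The exponent 3s/2 - 1 is at least 2 because s >= 2. *)
have E : 16 <= 4 `^ (2 * s - 1) * 4 `^ (- (s / 2)) :> R.
  rewrite -powRD ?pnatr_eq0 ?implybT//.
  apply: (@le_trans _ _ (4 `^ 2)); first by rewrite powR_mulrn// -natrX.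
  by apply: ler_powR; [lra|move: alpha0; lra].
have -> : 4 `^ (2 * s - 1) * (s ^+ 2 / a) / a * (2 * 4 `^ (- (s / 2)) * mK_cst alpha * 4 `^ (- (alpha + 1)))
  = (4 `^ (2 * s - 1) * 4 `^ (- (s / 2))) * (s ^+ 2 / a ^+ 2) * (mK_cst alpha * (2 * 4 `^ (- (alpha + 1)))).
  by field; rewrite gt_eqF.
rewrite ltr_pM2r; last by rewrite !mulr_gt0.
by apply: le_lt_trans E _; rewrite ltr_pMr// mulr_gt0.
Qed.

End constant.

(** * The uncertainty inequality *)

Local Open Scope complex_scope.

(** * L2 norms of complex-valued functions *)

Section complex_L2.
Context d (T : measurableType d) (R : realType).
Variable mu : {measure set T -> \bar R}.
Implicit Types f g : T -> R[i].

Definition cmeasurable f :=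
  measurable_fun setT (fun x => complex.Re (f x)) /\
  measurable_fun setT (fun x => complex.Im (f x)).

Lemma cmod_sqr (w : R[i]) : cmod w ^+ 2 = complex.Re w ^+ 2 + complex.Im w ^+ 2.
Proof. by case: w => a b; rewrite /cmod/= sqr_sqrtr// addr_ge0 ?sqr_ge0. Qed.

Lemma cmod_ge0 (w : R[i]) : 0 <= cmod w.
Proof. by case: w => a b; rewrite /cmod/= sqrtr_ge0. Qed.

Lemma le_cmodD (w z : R[i]) : cmod (w + z) <= cmod w + cmod z.
Proof. exact: le_normcD. Qed.

Lemma measurable_cmod f : cmeasurable f -> measurable_fun setT (cmod \o f).
Proof.
move=> [mr mi]; rewrite (_ : _ \o _ = @Num.sqrt R \o
    (fun x => complex.Re (f x) ^+ 2 + complex.Im (f x) ^+ 2)); last first.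
  by apply/funext => x /=; rewrite -cmod_sqr sqrtr_sqr ger0_norm ?cmod_ge0.
apply: measurableT_comp; first by apply: continuous_measurable_fun; exact: sqrt_continuous.
by apply: measurable_funD; exact: measurable_funX.
Qed.

Lemma cmeasurableD f g : cmeasurable f -> cmeasurable g ->
  cmeasurable (fun x => f x + g x).
Proof.
move=> [fr fi] [gr gi]; split.
  by under eq_fun do rewrite raddfD/=; exact: measurable_funD.
by under eq_fun do rewrite raddfD/=; exact: measurable_funD.
Qed.

Lemma cmeasurableZ f (h : T -> R) : cmeasurable f -> measurable_fun setT h ->
  cmeasurable (fun x => f x * (h x)%:C).
Proof.
move=> [fr fi] mh; split.
  rewrite (_ : (fun _ => _) = fun x => complex.Re (f x) * h x).
    exact: measurable_funM.
  by apply/funext => x; case: (f x) => a b /=; rewrite mulr0 subr0.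
rewrite (_ : (fun _ => _) = fun x => complex.Im (f x) * h x).
  exact: measurable_funM.
by apply/funext => x; case: (f x) => a b /=; rewrite mulr0 add0r mulrC.
Qed.

Lemma cmeasurableB f g : cmeasurable f -> cmeasurable g ->
  cmeasurable (fun x => f x - g x).
Proof.
move=> [fr fi] [gr gi]; split.
  by under eq_fun do rewrite raddfB/=; exact: measurable_funB.
by under eq_fun do rewrite raddfB/=; exact: measurable_funB.
Qed.

Definition L2sq f : \bar R := (\int[mu]_x (cmod (f x) ^+ 2)%:E)%E.

Lemma L2sq_ge0 f : (0 <= L2sq f)%E.
Proof. by apply: integral_ge0 => x _; rewrite lee_fin sqr_ge0. Qed.

Lemma Lnorm2E (h : T -> R) : (forall x, 0 <= h x) ->
  'N[mu]_2%:E[EFin \o h]%E = ((\int[mu]_x (h x ^+ 2)%:E) `^ 2^-1)%E.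
Proof.
move=> h0; rewrite unlock; congr poweR; apply: eq_integral => x _ /=.
by rewrite ger0_norm// powR_mulrn.
Qed.

Lemma cLnorm2E f : cLnorm mu 2%:E f = (L2sq f `^ 2^-1)%E.
Proof. by rewrite /cLnorm Lnorm2E// => x; exact: cmod_ge0. Qed.

Lemma cLnorm2_ge0 f : (0 <= cLnorm mu 2%:E f)%E.
Proof. exact: Lnorm_ge0. Qed.

Lemma cLnorm2_sqr f : (cLnorm mu 2%:E f `^ 2)%E = L2sq f.
Proof. by rewrite cLnorm2E -poweRrM mulVf// poweRe1// L2sq_ge0. Qed.

Lemma L2sqE f : cmeasurable f -> L2sq f =
  (\int[mu]_x (complex.Re (f x) ^+ 2)%:E + \int[mu]_x (complex.Im (f x) ^+ 2)%:E)%E.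
Proof.
move=> [fr fi]; rewrite -ge0_integralD//.
- by apply: eq_integral => x _; rewrite cmod_sqr.
- by move=> x _; rewrite lee_fin sqr_ge0.
- by apply/measurable_EFinP; exact: measurable_funX.
- by move=> x _; rewrite lee_fin sqr_ge0.
- by apply/measurable_EFinP; exact: measurable_funX.
Qed.

Lemma le_L2sq f g : cmeasurable f -> cmeasurable g ->
  (forall x, cmod (f x) <= cmod (g x)) -> (L2sq f <= L2sq g)%E.
Proof.
move=> mf mg fg; apply: ge0_le_integral => //.
- by move=> x _; rewrite lee_fin sqr_ge0.
- by apply/measurable_EFinP; apply: measurable_funX; exact: measurable_cmod.
- by apply/measurable_EFinP; apply: measurable_funX; exact: measurable_cmod.
by move=> x _; rewrite lee_fin lerXn2r ?nnegrE ?cmod_ge0.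
Qed.

Lemma cLnorm2_triangle f g : cmeasurable f -> cmeasurable g ->
  (cLnorm mu 2%:E (fun x => (f x + g x)%R) <= cLnorm mu 2%:E f + cLnorm mu 2%:E g)%E.
Proof.
move=> mf mg.
have := minkowski_EFin mu (measurable_cmod mf) (measurable_cmod mg) (_ : 1 <= 2).
move=> /(_ (ltW (ltr1n R 2))); apply: le_trans.
rewrite cLnorm2E Lnorm2E; last by move=> x; rewrite addr_ge0 ?cmod_ge0.
have mfg := measurable_cmod (cmeasurableD mf mg).
have m2 := measurable_funD (measurable_cmod mf) (measurable_cmod mg).
apply: gt0_ler_poweR; rewrite ?invr_ge0// ?in_itv/= ?andbT ?leey ?L2sq_ge0//.
  by rewrite integral_ge0// => x _; rewrite lee_fin sqr_ge0.
apply: ge0_le_integral => //.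
- by move=> x _; rewrite lee_fin sqr_ge0.
- by apply/measurable_EFinP; exact: measurable_funX.
- by apply/measurable_EFinP; exact: measurable_funX.
by move=> x _; rewrite lee_fin lerXn2r ?nnegrE ?addr_ge0 ?cmod_ge0 ?le_cmodD.
Qed.

End complex_L2.

Section complex_L2_compare.
Context d1 (T1 : measurableType d1) d2 (T2 : measurableType d2) (R : realType).
Variables (mu : {measure set T1 -> \bar R}) (nu : {measure set T2 -> \bar R}).

Lemma cLnorm2_le_scale (f : T1 -> R[i]) (g : T2 -> R[i]) (c : R) : 0 <= c ->
  (L2sq mu f <= (c ^+ 2)%:E * L2sq nu g)%E ->
  (cLnorm mu 2%:E f <= c%:E * cLnorm nu 2%:E g)%E.
Proof.
move=> c0 fg; rewrite !cLnorm2E.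
have -> : c%:E = ((c ^+ 2)%:E `^ 2^-1)%E.
  by rewrite poweR_EFin powR12_sqrt ?sqr_ge0// sqrtr_sqr ger0_norm.
rewrite -poweRM ?lee_fin ?sqr_ge0 ?L2sq_ge0//.
by apply: gt0_ler_poweR; rewrite ?invr_ge0// ?in_itv/= ?andbT ?leey ?mule_ge0 ?lee_fin ?sqr_ge0 ?L2sq_ge0.
Qed.

End complex_L2_compare.

Section complex_integrable.
Context d (T : measurableType d) (R : realType).
Variable mu : {measure set T -> \bar R}.

Lemma cLp_cmeasurable p (f : T -> R[i]) : cLp mu p f -> cmeasurable f.
Proof. by case. Qed.

Lemma le_Re_cmod (w : R[i]) : `|complex.Re w| <= cmod w.
Proof.
rewrite -(ler_pXn2r (ltn0Sn 1)) ?nnegrE ?cmod_ge0// real_normK ?num_real//.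
by rewrite cmod_sqr lerDl sqr_ge0.
Qed.

Lemma le_Im_cmod (w : R[i]) : `|complex.Im w| <= cmod w.
Proof.
rewrite -(ler_pXn2r (ltn0Sn 1)) ?nnegrE ?cmod_ge0// real_normK ?num_real//.
by rewrite cmod_sqr lerDr sqr_ge0.
Qed.

Lemma cLp1_integrable (f : T -> R[i]) : cLp mu 1%:E f ->
  mu.-integrable setT (EFin \o (fun x => complex.Re (f x))) /\
  mu.-integrable setT (EFin \o (fun x => complex.Im (f x))).
Proof.
move=> [mr mi]; rewrite /cLnorm Lnorm1 => fi.
have hi : mu.-integrable setT (EFin \o (cmod \o f)).
  apply/integrableP; split => //.
  by apply/measurable_EFinP; exact: measurable_cmod.
split; apply: le_integrable hi => //; try exact/measurable_EFinP.
- by move=> x _; rewrite lee_fin [leRHS]ger0_norm ?cmod_ge0// le_Re_cmod.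
- by move=> x _; rewrite lee_fin [leRHS]ger0_norm ?cmod_ge0// le_Im_cmod.
Qed.

End complex_integrable.

(** * Estimates of the transform on integrable functions *)

Section transform_estimates.
Context {R : realType}.
Variable alpha : R.
Hypothesis alpha0 : 0 <= alpha.
Notation RR := (measurableTypeR R * measurableTypeR R)%type.
Notation RN := (measurableTypeR R * nat)%type.
Notation mK := (mK alpha).
Notation gammaK := (gammaK alpha).

Lemma LB_realD (u v : RR -> R) lm :
  mK.-integrable setT (EFin \o u) -> mK.-integrable setT (EFin \o v) -> 0 <= lm.1 ->
  LB_real alpha (fun z => u z + v z) lm = LB_real alpha u lm + LB_real alpha v lm.
Proof.
move=> ui vi l0; rewrite /LB_real -RintegralD//; try exact: integrable_LB_kernel.
by apply: eq_Rintegral => z _; rewrite mulrDl.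
Qed.

(** Since the kernel is bounded by 1, the transform is at most the L1 norm of v, which
    Cauchy-Schwarz against the indicator of U bounds by the L2 norm. *)
Lemma LB_real_sqr_le (U : set RR) (M b : R) (v : RR -> R) lm :
  measurable U -> (mK U <= M%:E)%E -> (forall z, ~ U z -> v z = 0) ->
  mK.-integrable setT (EFin \o v) -> has_integral mK (fun z => v z ^+ 2) b ->
  0 <= lm.1 -> LB_real alpha v lm ^+ 2 <= M * b.
Proof.
move=> mU UM vU vi vb l0.
have /integrableP[/measurable_EFinP mv _] := vi.
have mUf : mK U \is a fin_num.
  by rewrite ge0_fin_numE//; apply: le_lt_trans UM _; rewrite ltry.
have mI : measurable_fun setT (\1_U : RR -> R) by exact: measurable_indic.
have Ui : has_integral mK (fun z => \1_U z ^+ 2) (fine (mK U)).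
  apply: ge0_has_integral; first exact: measurable_funX.
    by move=> z; rewrite sqr_ge0.
  transitivity (\int[mK]_z (\1_U z)%:E)%E.
    by apply: eq_integral => z _; rewrite indicE; case: (_ \in _); rewrite ?expr1n ?expr0n.
  by rewrite integral_indic// setIT fineK.
have mav : measurable_fun setT (fun z : RR => `|v z|) by exact: measurableT_comp.
have vb' : has_integral mK (fun z => `|v z| ^+ 2) b.
  by apply: has_integral_ext vb => z; rewrite real_normK ?num_real.
have [c hc cMb] := @has_integral_mul _ _ _ mK _ _ _ _ mI mav Ui vb'.
have b0 : 0 <= b.
  by apply: (has_integral_le (has_integral0 mK) vb) => z; exact: sqr_ge0.
have cE : \int[mK]_z `|v z| = c.
  rewrite -(has_integral_Rintegral hc); apply: eq_Rintegral => z _.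
  by rewrite indicE; case: (boolP (z \in U)) => [|/negP]; rewrite inE ?mul1r// => /vU ->; rewrite normr0 mulr0.
apply: (@le_trans _ _ (c ^+ 2)).
  rewrite -(real_normK (num_real (LB_real alpha v lm))) -cE lerXn2r ?nnegrE//.
    by apply: Rintegral_ge0 => z _.
  exact: LB_real_le.
apply: le_trans cMb _; apply: ler_wpM2r => //.
by rewrite -lee_fin fineK.
Qed.

Variable E : set RN.
Hypotheses (EK : E `<=` Khat) (mE : measurable E).

Let mIE : measurable_fun setT (\1_E : RN -> R).
Proof. exact: measurable_indic. Qed.

Let cutE (h : RN -> R[i]) : RN -> R[i] := fun lm => h lm * (\1_E lm)%:C.

Lemma cmeasurable_LB1 w : cmeasurable w -> cmeasurable (LB1 alpha w : RN -> R[i]).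
Proof. by move=> [wr wi]; split; exact: measurable_LB_real. Qed.

Lemma L2sq_LB1_cut w : cmeasurable w -> L2sq gammaK (cutE (LB1 alpha w)) =
  (\int[gammaK]_lm (LB_real alpha (fun z => complex.Re (w z)) lm ^+ 2 * \1_E lm)%:E +
   \int[gammaK]_lm (LB_real alpha (fun z => complex.Im (w z)) lm ^+ 2 * \1_E lm)%:E)%E.
Proof.
move=> mw; have mc : cmeasurable (cutE (LB1 alpha w)).
  by apply: cmeasurableZ => //; exact: cmeasurable_LB1.
rewrite (L2sqE _ mc).
congr (_ + _)%E; apply: eq_integral => lm _; rewrite /cutE indicE/=.
  by case: (_ \in _); rewrite ?mulr1 ?mulr0 ?subr0// ?expr0n.
by case: (_ \in _); rewrite ?mulr1 ?mulr0 ?add0r ?addr0// ?expr0n.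
Qed.

Lemma LB1_bessel w : cLp mK 1%:E w ->
  (cLnorm gammaK 2%:E (cutE (LB1 alpha w)) <= cLnorm mK 2%:E w)%E.
Proof.
move=> w1; have mw := cLp_cmeasurable w1; have [wr wi] := cLp1_integrable w1.
rewrite -[leRHS]mul1e; apply: cLnorm2_le_scale => //.
rewrite expr1n mul1e L2sq_LB1_cut// L2sqE//.
have cut v : mK.-integrable setT (EFin \o v) ->
    (\int[gammaK]_lm (LB_real alpha v lm ^+ 2 * \1_E lm)%:E <= \int[mK]_z (v z ^+ 2)%:E)%E.
  move=> vi; apply: le_trans (LB_real_plancherel_le alpha0 vi).
  have /integrableP[/measurable_EFinP mv _] := vi.
  have mKhat : measurable (Khat : set RN).
    rewrite (_ : Khat = `[0, +oo[%classic `*` setT); first exact: measurableX.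
    by apply/seteqP; split => -[l m]; rewrite /Khat /= in_itv/= andbT// => -[].
  have mLB := measurable_LB_real alpha0 mv.
  apply: ge0_le_integral => //.
  - by move=> lm _; rewrite lee_fin mulr_ge0 ?sqr_ge0.
  - by apply/measurable_EFinP; apply: measurable_funM => //; exact: measurable_funX.
  - apply/measurable_EFinP; apply: measurable_funM; first exact: measurable_funX.
    exact: measurable_indic.
  move=> lm _; rewrite lee_fin; apply: ler_wpM2l; first exact: sqr_ge0.
  rewrite !indicE; case: (boolP (lm \in E)) => // /set_mem/EK lK.
  by rewrite mem_set.
by apply: leeD; exact: cut.
Qed.

(** Integrates the pointwise bound of [LB_real_sqr_le] over E, for the real and imaginary parts
    separately. *)
Lemma LB1_supp (U : set RR) (M G : R) w :
  measurable U -> (mK U <= M%:E)%E -> (gammaK E <= G%:E)%E -> 0 <= M -> 0 <= G ->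
  (forall z, ~ U z -> w z = 0) -> cLp mK 1%:E w -> cLp mK 2%:E w ->
  (cLnorm gammaK 2%:E (cutE (LB1 alpha w)) <= (Num.sqrt (G * M))%:E * cLnorm mK 2%:E w)%E.
Proof.
move=> mU UM EG M0 G0 wU w1 [mr mi w2]; have mw := cLp_cmeasurable w1.
have [wr wi] := cLp1_integrable w1.
apply: cLnorm2_le_scale => //; rewrite sqr_sqrtr ?mulr_ge0//.
have Lfin : (L2sq mK w < +oo)%E.
  by move: w2; rewrite cLnorm2E; apply: lty_poweRy; rewrite invr_eq0.
have vr0 : (0 <= \int[mK]_z (complex.Re (w z) ^+ 2)%:E)%E.
  by apply: integral_ge0 => z _; rewrite lee_fin sqr_ge0.
have vi0 : (0 <= \int[mK]_z (complex.Im (w z) ^+ 2)%:E)%E.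
  by apply: integral_ge0 => z _; rewrite lee_fin sqr_ge0.
rewrite L2sq_LB1_cut// [L2sq _ w]L2sqE// ge0_muleDr//.
have cut v : mK.-integrable setT (EFin \o v) -> (forall z, ~ U z -> v z = 0) ->
    (\int[mK]_z (v z ^+ 2)%:E < +oo)%E ->
    (\int[gammaK]_lm (LB_real alpha v lm ^+ 2 * \1_E lm)%:E <=
     (G * M)%:E * \int[mK]_z (v z ^+ 2)%:E)%E.
  move=> vi vU vfin; have /integrableP[/measurable_EFinP mv _] := vi.
  have mLB := measurable_LB_real alpha0 mv.
  have v20 : (0 <= \int[mK]_z (v z ^+ 2)%:E)%E.
    by apply: integral_ge0 => z _; rewrite lee_fin sqr_ge0.
  have vE : (\int[mK]_z (v z ^+ 2)%:E = (fine (\int[mK]_z (v z ^+ 2)%:E))%:E)%E.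
    by rewrite fineK// ge0_fin_numE.
  have vb : has_integral mK (fun z => v z ^+ 2) (fine (\int[mK]_z (v z ^+ 2)%:E)).
    apply: ge0_has_integral vE; first exact: measurable_funX.
    by move=> z; exact: sqr_ge0.
  rewrite vE; set b := fine _ in vb *.
  have b0 : 0 <= b by rewrite fine_ge0.
  apply: (@le_trans _ _ (\int[gammaK]_lm ((M * b)%:E * (\1_E lm)%:E))%E).
    apply: ge0_le_integral => //.
    - by move=> lm _; rewrite lee_fin mulr_ge0 ?sqr_ge0.
    - by apply/measurable_EFinP; apply: measurable_funM => //; exact: measurable_funX.
    - by apply: emeasurable_funM => //; exact/measurable_EFinP.
    move=> lm _; rewrite -EFinM lee_fin indicE.
    case: (boolP (lm \in E)) => [/set_mem/EK l0|_]; last by rewrite !mulr0.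
    by rewrite !mulr1; apply: (LB_real_sqr_le mU UM vU).
  rewrite ge0_integralZl_EFin ?mulr_ge0//; last exact/measurable_EFinP.
  rewrite integral_indic// setIT -EFinM -mulrA (EFinM G) muleC.
  by rewrite lee_wpmul2r// lee_fin mulr_ge0.
move: Lfin; rewrite L2sqE// => Lfin.
apply: leeD; apply: cut => //.
- by move=> z /wU ->.
- by apply: le_lt_trans Lfin; rewrite leeDl.
- by move=> z /wU ->.
- by apply: le_lt_trans Lfin; rewrite leeDr.
Qed.

End transform_estimates.

Section complex_cut.
Context d (T : measurableType d) (R : realType).
Variable mu : {measure set T -> \bar R}.
Implicit Types (f g : T -> R[i]) (A : set T).

Definition cut A f : T -> R[i] := fun x => f x * (\1_A x)%:C.

Lemma cmodZ (w : R[i]) (x : R) : cmod (w * x%:C) = cmod w * `|x|.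
Proof. by rewrite /cmod ComplexField.Normc.normcM/= expr0n addr0 sqrtr_sqr. Qed.

Lemma cmod_cut A f x : cmod (cut A f x) = cmod (f x) * \1_A x.
Proof. by rewrite cmodZ ger0_norm. Qed.

Lemma le_cmod_cut A f x : cmod (cut A f x) <= cmod (f x).
Proof.
by rewrite cmod_cut ler_piMr ?cmod_ge0// indicE; case: (_ \in _); rewrite ?ler01.
Qed.

Lemma cmeasurable_cut A f : measurable A -> cmeasurable f -> cmeasurable (cut A f).
Proof. by move=> mA mf; apply: cmeasurableZ => //; exact: measurable_indic. Qed.

Lemma cutC A f x : f x = cut A f x + cut (~` A) f x.
Proof.
rewrite /cut -mulrDr !indicE in_setC.
by case: (x \in A); rewrite ?addr0 ?add0r mulr1.
Qed.

Lemma cLnorm2_le f g : cmeasurable f -> cmeasurable g ->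
  (forall x, cmod (f x) <= cmod (g x)) -> (cLnorm mu 2%:E f <= cLnorm mu 2%:E g)%E.
Proof.
move=> mf mg fg; rewrite !cLnorm2E; apply: gt0_ler_poweR.
- by rewrite invr_ge0.
- by rewrite in_itv/= L2sq_ge0 leey.
- by rewrite in_itv/= L2sq_ge0 leey.
- exact: le_L2sq.
Qed.

Lemma cLp2_cut A f : measurable A -> cLp mu 2%:E f -> cLp mu 2%:E (cut A f).
Proof.
move=> mA f2; have mf := cLp_cmeasurable f2; have mc := cmeasurable_cut mA mf.
split; [exact: mc.1|exact: mc.2|].
case: f2 => _ _; apply: le_lt_trans; apply: cLnorm2_le => // x; exact: le_cmod_cut.
Qed.

Lemma cLp1_cut A f : measurable A -> cLp mu 1%:E f -> cLp mu 1%:E (cut A f).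
Proof.
move=> mA f1; have mf := cLp_cmeasurable f1; have mc := cmeasurable_cut mA mf.
split; [exact: mc.1|exact: mc.2|].
case: f1 => _ _; apply: le_lt_trans; rewrite /cLnorm !Lnorm1.
apply: ge0_le_integral => //.
- by apply: measurableT_comp => //; apply/measurable_EFinP; exact: measurable_cmod.
- by apply: measurableT_comp => //; apply/measurable_EFinP; exact: measurable_cmod.
by move=> x _; rewrite lee_fin !ger0_norm ?cmod_ge0 ?le_cmod_cut.
Qed.

End complex_cut.

Lemma cvge0_le_add (R : realType) (P L : \bar R) (d e : nat -> \bar R) (A : R) :
  0 <= A -> (0 <= L)%E -> d n @[n --> \oo] --> 0%E -> e n @[n --> \oo] --> 0%E ->
  (forall n, (P <= e n + (A%:E * d n + L))%E) -> (P <= L)%E.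
Proof.
move=> A0 L0 d0 e0 PL.
have cv : (e n + (A%:E * d n + L))%E @[n --> \oo] --> L.
  rewrite -[X in _ --> X]add0e; apply: cvgeD => //.
  rewrite -[X in _ --> X]add0e -(mule0 A%:E); apply: cvgeD.
  - by rewrite mule0; exact: fin_num_adde_defr.
  - exact: cvgeZl.
  - exact: cvg_cst.
rewrite -(cvg_lim _ cv)//; apply: lime_ge; first by apply/cvg_ex; exists L.
exact: nearW.
Qed.

Section key_inequality.
Context {R : realType}.
Variable alpha : R.
Hypothesis alpha0 : 0 <= alpha.
Notation RR := (measurableTypeR R * measurableTypeR R)%type.
Notation RN := (measurableTypeR R * nat)%type.
Notation mK := (mK alpha).
Notation gammaK := (gammaK alpha).

Lemma LB1_cutC (U : set RR) (u : RR -> R[i]) lm : measurable U -> cLp mK 1%:E u ->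
  0 <= lm.1 -> LB1 alpha u lm = LB1 alpha (cut U u) lm + LB1 alpha (cut (~` U) u) lm.
Proof.
move=> mU u1 l0.
have [r1 i1] := cLp1_integrable (cLp1_cut mU u1).
have [r2 i2] := cLp1_integrable (cLp1_cut (measurableC mU) u1).
transitivity ((LB_real alpha (fun z => complex.Re (u z)) lm) +i*
  (LB_real alpha (fun z => complex.Im (u z)) lm)) => //.
rewrite (_ : (fun z => complex.Re (u z)) =
    fun z => complex.Re (cut U u z) + complex.Re (cut (~` U) u z)); last first.
  by apply/funext => z; rewrite [in LHS](cutC U u z) raddfD.
rewrite (_ : (fun z => complex.Im (u z)) =
    fun z => complex.Im (cut U u z) + complex.Im (cut (~` U) u z)); last first.
  by apply/funext => z; rewrite [in LHS](cutC U u z) raddfD.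
by rewrite (LB_realD alpha0 r1 r2 l0) (LB_realD alpha0 i1 i2 l0).
Qed.

(** On E the function g splits into the error g - LB1 u, the transform of u cut to U, bounded by
    [LB1_supp], and that of u cut off U, bounded by [LB1_bessel]. Letting the approximant u tend to
    f removes the errors. *)
Lemma LB2_cut_le (f : RR -> R[i]) (g : RN -> R[i]) (E : set RN) (U : set RR) (M G : R) :
  cLp mK 2%:E f -> is_LB2 alpha f g -> E `<=` Khat -> measurable E -> measurable U ->
  (mK U <= M%:E)%E -> (gammaK E <= G%:E)%E -> 0 <= M -> 0 <= G ->
  (cLnorm gammaK 2%:E (cut E g) <=
   (Num.sqrt (G * M))%:E * cLnorm mK 2%:E f + cLnorm mK 2%:E (cut (~` U) f))%E.
Proof.
move=> f2 [g2 [u u12 [uf ug]]] EK mE mU UM EG M0 G0.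
have mf := cLp_cmeasurable f2; have mg := cLp_cmeasurable g2.
have mUC := measurableC mU.
set A := Num.sqrt _; have A0 : 0 <= A by exact: sqrtr_ge0.
(* Replacing u by f costs the L2 distance between them, A times for the part in U and once for the
   part off U. *)
apply: (@cvge0_le_add _ _ _ _ _ (A + 1) _ _ uf ug); first by rewrite addr_ge0.
  by rewrite adde_ge0 ?mule_ge0 ?cLnorm2_ge0.
move=> n; have [u1 u2] := u12 n; have mu_ := cLp_cmeasurable u1.
have mLB h : cmeasurable h -> cmeasurable (cut E (LB1 alpha h)).
  by move=> mh; apply: cmeasurable_cut => //; exact: cmeasurable_LB1.
have mLu := cmeasurable_LB1 alpha0 mu_.
have mLg := cmeasurableB mLu mg.
have muf := cmeasurableB mu_ mf.
have uU1 := cLp1_cut mU u1; have uU2 := cLp2_cut mU u2; have uV1 := cLp1_cut mUC u1.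
have mcU := mLB _ (cLp_cmeasurable uU1); have mcV := mLB _ (cLp_cmeasurable uV1).
have mN : cmeasurable (cut E (fun lm => g lm - LB1 alpha (u n) lm)).
  by apply: cmeasurable_cut => //; exact: cmeasurableB.
have -> : cut E g = fun lm => cut E (fun lm => g lm - LB1 alpha (u n) lm) lm +
    (cut E (LB1 alpha (cut U (u n))) lm + cut E (LB1 alpha (cut (~` U) (u n))) lm).
  apply/funext => lm; rewrite /cut indicE; case: (boolP (lm \in E)) => [/set_mem/EK l0|_].
    by rewrite !mulr1 -(LB1_cutC mU u1 l0) subrK.
  by rewrite !mulr0 !addr0.
apply: le_trans (cLnorm2_triangle _ mN (cmeasurableD mcU mcV)) _.
apply: leeD.
  apply: cLnorm2_le => // lm; apply: le_trans (le_cmod_cut _ _ _) _.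
  by rewrite -[X in cmod X <= _]opprB /cmod normcN.
apply: le_trans (cLnorm2_triangle _ mcU mcV) _.
have leU : (cLnorm mK 2%:E (cut U (u n)) <=
    cLnorm mK 2%:E (fun z => (u n z - f z)%R) + cLnorm mK 2%:E f)%E.
  apply: le_trans (cLnorm2_triangle _ muf mf); apply: cLnorm2_le.
  - exact: cLp_cmeasurable uU1.
  - exact: cmeasurableD.
  by move=> z; rewrite subrK le_cmod_cut.
have leV : (cLnorm mK 2%:E (cut (~` U) (u n)) <=
    cLnorm mK 2%:E (fun z => (u n z - f z)%R) + cLnorm mK 2%:E (cut (~` U) f))%E.
  apply: (@le_trans _ _ (cLnorm mK 2%:E (cut (~` U) (fun z => (u n z - f z)%R)) +
      cLnorm mK 2%:E (cut (~` U) f))%E); last first.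
    rewrite leeD2r//; apply: cLnorm2_le => //; first exact: cmeasurable_cut.
    by move=> z; exact: le_cmod_cut.
  rewrite (_ : cut (~` U) (u n) = fun z =>
    (cut (~` U) (fun z => (u n z - f z)%R) z + cut (~` U) f z)%R).
    by apply: cLnorm2_triangle; exact: cmeasurable_cut.
  by apply/funext => z; rewrite /cut -mulrDl subrK.
have cU0 z : ~ U z -> cut U (u n) z = 0.
  by move=> Uz; rewrite /cut indicE memNset// mulr0.
apply: le_trans (leeD (LB1_supp alpha0 EK mE mU UM EG M0 G0 cU0 uU1 uU2)
  (LB1_bessel alpha0 EK mE uV1)) _.
apply: le_trans (leeD (lee_wpmul2l _ leU) leV) _; first by rewrite lee_fin.
have arith (x y z : \bar R) : (0 <= x)%E -> (0 <= y)%E ->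
    (A%:E * (x + y) + (x + z) = (A + 1)%:E * x + (A%:E * y + z))%E.
  move=> x0 y0; rewrite ge0_muleDr// EFinD ge0_muleDl// ?lee_fin// mul1e.
  by rewrite addeACA.
by rewrite arith ?cLnorm2_ge0.
Qed.

End key_inequality.

Section homogeneous_ball.
Context {R : realType}.
Variable alpha : R.
Hypothesis alpha0 : 0 <= alpha.
Notation s := (3 * alpha + 2).
Notation RR := (measurableTypeR R * measurableTypeR R)%type.
Notation mK := (mK alpha).
Notation leb := (@lebesgue_measure R).

Lemma hnorm_base_ge0 (z : RR) : 0 <= z.1 ^+ 4 + 4 * z.2 ^+ 2.
Proof. by rewrite addr_ge0// ?exprn_even_ge0// mulr_ge0 ?sqr_ge0. Qed.

Lemma hnorm_exp4 (z : RR) : hnorm z ^+ 4 = z.1 ^+ 4 + 4 * z.2 ^+ 2.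
Proof.
by rewrite /hnorm -powR_mulrn ?powR_ge0// -powRrM mulVf// powRr1// hnorm_base_ge0.
Qed.

Lemma measurable_hnorm : measurable_fun setT (hnorm : RR -> R).
Proof.
apply: (measurableT_comp (measurable_powR _)).
by apply: measurable_funD; [|apply: measurable_funM => //]; exact: measurable_funX.
Qed.

(* Points outside KK are included so that hnorm z >= r holds everywhere off the
   ball; they do not change its mK-mass. *)
Definition hball (r : R) : set RR := ~` (KK `&` [set z | r <= hnorm z]).

Lemma measurable_hball r : measurable (hball r).
Proof.
apply: measurableC; apply: measurableI; first exact: measurable_KK.
rewrite (_ : [set _ | _] = setT `&` hnorm @^-1` `[r, +oo[%classic).
  exact: measurable_hnorm.
by apply/seteqP; split => z /=; rewrite in_itv/= andbT // => -[].
Qed.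

(** Within [KK] the ball lies in the rectangle [0, r] x [0, r^2/2], on which the density is largest
    at the far corner. This gives 2^(-(2 alpha + 1)) r^(6 alpha + 4), up to the constant of [mK]. *)
Lemma mK_hball_le r : 0 < r ->
  (mK (hball r) <= (mK_cst alpha * 4 `^ (- (alpha + 2^-1)) * r `^ (2 * s))%:E)%E.
Proof.
move=> r0; pose h := r ^+ 2 / 2.
have h0 : 0 < h by rewrite divr_gt0 ?exprn_gt0.
pose c := mK_cst alpha * (r `^ (2 * alpha + 1) * h `^ (2 * alpha)).
have c0 : 0 <= c by rewrite !mulr_ge0 ?powR_ge0// ltW// mK_cst_gt0.
pose Q : set RR := `[0, r]%classic `*` `[0, h]%classic.
have mQ : measurable Q by exact: measurableX.
have sub : hball r `&` KK `<=` Q.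
  move=> z [/= nz kz]; have zr : hnorm z < r.
    by rewrite ltNge; apply/negP => rz; apply: nz.
  have : hnorm z ^+ 4 < r ^+ 4 by rewrite ltrXn2r// ?powR_ge0.
  rewrite hnorm_exp4; case: kz => x0 t0 zr4.
  split; rewrite /= in_itv/= ?x0 ?t0/=.
    rewrite -(ler_pXn2r (ltn0Sn 3)) ?nnegrE ?(ltW r0)//; apply: le_trans (ltW zr4).
    by rewrite lerDl mulr_ge0 ?sqr_ge0.
  rewrite -(ler_pXn2r (ltn0Sn 1)) ?nnegrE ?(ltW h0)// /h.
  have -> : (r ^+ 2 / 2) ^+ 2 = r ^+ 4 / 4 by field.
  by rewrite ler_pdivlMr// mulrC; apply: le_trans (ltW zr4); rewrite lerDr exprn_even_ge0.
have cE : (c%:E * (leb \x leb)%E Q = (mK_cst alpha * 4 `^ (- (alpha + 2^-1)) * r `^ (2 * s))%:E)%E.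
  rewrite /Q product_measure1E//= !lebesgue_measure_itv/= !lte_fin r0 h0 !oppr0 !adde0 -!EFinM.
  congr EFin; rewrite /c /h.
  have -> : (r ^+ 2 / 2) `^ (2 * alpha) = r `^ (4 * alpha) * 2 `^ (- (2 * alpha)).
    rewrite powRM ?sqr_ge0 ?invr_ge0// -[r ^+ 2]powR_mulrn ?(ltW r0)// -powRrM.
    by rewrite -[2^-1]powR_inv1// -powRrM mulN1r; congr (_ `^ _ * _); lra.
  have -> : 4 `^ (- (alpha + 2^-1)) = 2 `^ (- (2 * alpha)) / 2 :> R.
    have -> : 4 = 2 `^ 2 :> R by rewrite powR_mulrn// -natrX.
    rewrite -powRrM -[X in _ / X]powRr1// -powRB ?pnatr_eq0 ?implybT//.
    by congr (_ `^ _); lra.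
  have -> : r `^ (2 * s) = r `^ (2 * alpha + 1) * r `^ (4 * alpha) * r ^+ 3.
    rewrite -powR_mulrn ?(ltW r0)// -!powRD ?(gt_eqF r0) ?implybT//.
    by congr (_ `^ _); lra.
  by field.
rewrite -cE /Defs.mK -integral_cst//.
apply: (@le_trans _ _ (\int[leb \x leb]_(z in hball r `&` KK) (cst c%:E z))%E).
  apply: ge0_le_integral => //.
  - by apply: measurableI; [exact: measurable_hball|exact: measurable_KK].
  - by move=> z _; rewrite lee_fin K_density_ge0.
  - by apply: measurable_funTS; apply/measurable_EFinP; exact: measurable_K_density.
  move=> z /sub[/=]; rewrite !in_itv/= => /andP[x0 xr] /andP[t0 th].
  rewrite lee_fin /K_density ler_wpM2l ?(ltW (mK_cst_gt0 alpha0))//.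
  by apply: ler_pM; rewrite ?powR_ge0//; apply: ge0_ler_powR; rewrite ?nnegrE ?(ltW r0) ?(ltW h0)//; move: alpha0; lra.
apply: ge0_subset_integral => //.
by apply: measurableI; [exact: measurable_hball|exact: measurable_KK].
Qed.

Variable f : RR -> R[i].
Hypothesis mf : cmeasurable f.

Let w : RR -> R[i] := fun z => ((hnorm z `^ s)%:C * f z)%R.

Lemma cmeasurable_weight : cmeasurable w.
Proof.
rewrite /w; under eq_fun do rewrite mulrC; apply: cmeasurableZ => //.
exact: (measurableT_comp (measurable_powR _) measurable_hnorm).
Qed.

Lemma cLnorm2_off_hball r : 0 < r ->
  (cLnorm mK 2%:E (cut (~` hball r) f) <= (r `^ (- s))%:E * cLnorm mK 2%:E w)%E.
Proof.
move=> r0; have mw := cmeasurable_weight; have mb := measurable_hball r.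
apply: cLnorm2_le_scale; first exact: powR_ge0.
have mcw : measurable_fun setT (fun z => (cmod (w z) ^+ 2)%:E).
  by apply/measurable_EFinP; apply: measurable_funX; exact: measurable_cmod.
rewrite -ge0_integralZl_EFin ?sqr_ge0//; last by move=> z _; rewrite lee_fin sqr_ge0.
apply: ge0_le_integral => //.
- by move=> z _; rewrite lee_fin sqr_ge0.
- apply/measurable_EFinP; apply: measurable_funX; apply: measurable_cmod.
  by apply: cmeasurable_cut => //; exact: measurableC.
- exact: measurable_funeM.
move=> z _; rewrite -EFinM lee_fin -exprMn lerXn2r ?nnegrE ?mulr_ge0 ?powR_ge0 ?cmod_ge0//.
rewrite cmod_cut /w [X in _ * cmod X]mulrC cmodZ ger0_norm ?powR_ge0// indicE in_setC.
case: (boolP (z \in hball r)) => [_|]; first by rewrite mulr0 !mulr_ge0 ?powR_ge0 ?cmod_ge0.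
move=> /negP; rewrite inE /hball /= => /contrapT[_ rz].
rewrite mulr1 mulrCA ler_peMr ?cmod_ge0//.
rewrite powRN ler_pdivlMl ?powR_gt0// mulr1; apply: ge0_ler_powR; rewrite ?nnegrE ?powR_ge0 ?(ltW r0)//.
by move: alpha0; lra.
Qed.

Lemma cLnorm2_eq0 h : cmeasurable h -> cLnorm mK 2%:E h = 0%E ->
  {ae mK, forall z, h z = 0}.
Proof.
move=> mh h0.
have : L2sq mK h = 0%E by rewrite -cLnorm2_sqr h0 poweR0r.
have m2 : measurable_fun setT (fun z => (cmod (h z) ^+ 2)%:E).
  by apply/measurable_EFinP; apply: measurable_funX; exact: measurable_cmod.
move=> h2.
have/(ae_eq_integral_abs _ measurableT m2) :
    (\int[mK]_z `|(cmod (h z) ^+ 2)%:E| = 0)%E.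
  by rewrite -[RHS]h2; apply: eq_integral => z _; rewrite gee0_abs// lee_fin sqr_ge0.
apply: filterS => z /(_ I) /= [/eqP]; rewrite sqrf_eq0 => /eqP.
exact: ComplexField.Normc.eq0_normc.
Qed.

End homogeneous_ball.

(** Optimization over the radius, with A standing for (const * gamma(E))^(1/2). It yields P^2 <= 4 A
    F Y, and 16 A^2 appears because (4A)^(1/s) = (16 A^2)^(1/(2s)). *)
Lemma le_interpolation (R : realType) (P F Y A s : R) :
  2 <= s -> 0 <= P -> 0 < F -> 0 < Y -> 0 < A -> P <= F ->
  (forall r, 0 < r -> P <= A * r `^ s * F + r `^ (- s) * Y) ->
  P <= (16 * A ^+ 2) `^ (2 * s)^-1 * F `^ ((s - 1) / s) * Y `^ s^-1.
Proof.
move=> s2 P0 F0 Y0 A0 PF Pr; have s0 : 0 < s by apply: lt_le_trans s2.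
have [P_0|P_gt0] := leP P 0; first by apply: le_trans P_0 _; rewrite !mulr_ge0 ?powR_ge0.
have q0 : 0 < Y / (A * F) by rewrite divr_gt0 ?mulr_gt0.
(* The value of r^s at which the two terms are equal. *)
pose rho := Num.sqrt (Y / (A * F)).
have rho0 : 0 < rho by rewrite sqrtr_gt0.
have rho2 : rho ^+ 2 * (A * F) = Y.
  by rewrite sqr_sqrtr ?(ltW q0)// divfK// gt_eqF// mulr_gt0.
have := Pr (rho `^ s^-1) (powR_gt0 _ rho0).
rewrite powRN -powRrM mulVf ?gt_eqF// powRr1 ?(ltW rho0)// => Prho.
have P2 : P ^+ 2 <= 4 * A * F * Y.
  have -> : 4 * A * F * Y = (2 * (A * rho * F)) ^+ 2 by rewrite -rho2; ring.
  rewrite lerXn2r ?nnegrE ?mulr_ge0 ?(ltW A0) ?(ltW rho0) ?(ltW F0)//.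
  apply: le_trans Prho _; rewrite -rho2 (_ : _^-1 * _ = A * rho * F); last first.
    by field; rewrite gt_eqF.
  lra.
(* Here s >= 2 enters: a nonnegative exponent lets P <= F be raised to it. *)
have e0 : 0 <= 1 - 2 / s by rewrite subr_ge0 ler_pdivrMr// mul1r.
(* P = P^(1 - 2/s) (P^2)^(1/s), where P <= F and P^2 <= 4 A F Y. *)
have PE : P = P `^ (1 - 2 / s) * (P ^+ 2) `^ s^-1.
  rewrite -powR_mulrn// -powRrM -powRD ?(gt_eqF P_gt0) ?implybT//.
  by rewrite subrK powRr1.
rewrite [leLHS]PE; apply: (@le_trans _ _ (F `^ (1 - 2 / s) * (4 * A * F * Y) `^ s^-1)).
  apply: ler_pM; rewrite ?powR_ge0//; first by apply: ge0_ler_powR; rewrite ?nnegrE// ltW.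
  by apply: ge0_ler_powR; rewrite ?nnegrE ?invr_ge0 ?sqr_ge0 ?mulr_ge0// ltW.
have A00 := ltW A0; have A4 : 0 <= 4 * A by rewrite mulr_ge0// ltW.
have -> : (16 * A ^+ 2) `^ (2 * s)^-1 = (4 * A) `^ s^-1.
  rewrite (_ : 16 * A ^+ 2 = (4 * A) ^+ 2); last by ring.
  rewrite -powR_mulrn// -powRrM; congr (_ `^ _); rewrite invfM mulrA divff ?mul1r//.
rewrite (@powRM _ _ Y) ?(ltW Y0)// ?mulr_ge0 ?(ltW F0)//.
rewrite (@powRM _ _ F) ?(ltW F0)//.
have -> : F `^ ((s - 1) / s) = F `^ (1 - 2 / s) * F `^ s^-1.
  rewrite -powRD ?(gt_eqF F0) ?implybT//; congr (_ `^ _); field; rewrite gt_eqF//.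
by rewrite !mulrA [_ * (4 * A) `^ _]mulrC.
Qed.

Section hnorm_null.
Context {R : realType}.
Variable alpha : R.
Hypothesis alpha0 : 0 <= alpha.
Notation RR := (measurableTypeR R * measurableTypeR R)%type.

(** The origin is the only zero and is null because the density vanishes there. Hence a zero
    weighted norm would force f to vanish almost everywhere. *)
Lemma hnorm_neq0_ae : {ae mK alpha, forall z : RR, hnorm z != 0}.
Proof.
exists [set (0, 0)]; split.
- rewrite (_ : [set (0, 0)] = [set 0] `*` [set 0] :> set RR); first exact: measurableX.
  by apply/seteqP; split => -[x t] /= [-> ->].
- apply: integral0_eq => _ [/= -> _].
  by rewrite /K_density /= powR0 ?mul0r ?mulr0//; move: alpha0; lra.
- move=> [x t] /= /negP; rewrite negbK => /eqP h0.
  have := hnorm_exp4 (x, t); rewrite h0 expr0n/= => /esym/eqP.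
  have x4 : 0 <= x ^+ 4 by rewrite exprn_even_ge0.
  have t2 : 0 <= 4 * t ^+ 2 by rewrite mulr_ge0 ?sqr_ge0.
  rewrite (paddr_eq0 x4 t2) expf_eq0/= mulf_eq0 pnatr_eq0/= sqrf_eq0.
  by move=> /andP[/eqP-> /eqP->].
Qed.

End hnorm_null.

Theorem theorem4p3 (R : realType) (alpha s : R)
    (halpha : 0 <= alpha) (hs : s = 3 * alpha + 2)
    (f : R * R -> R[i]) (hf : cLp (mK alpha) 2%:E f)
    (hf0 : ~ {ae mK alpha, forall z, f z = 0})
    (g : R * nat -> R[i]) (hg : is_LB2 alpha f g)
    (E : set (measurableTypeR R * nat)) (hE : E `<=` Khat)
    (mE : measurable E) (hE0 : (0 < gammaK alpha E)%E)
    (hEoo : (gammaK alpha E < +oo)%E) :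
  (cLnorm (gammaK alpha) 2%:E (fun lm => (g lm * (\1_E lm)%:C)%R) <
   (C_alpha alpha)%:E
   * gammaK alpha E `^ (2 * (3 * alpha + 2))^-1
   * cLnorm (mK alpha) 2%:E f `^ ((3 * alpha + 1) / (3 * alpha + 2))
   * cLnorm (mK alpha) 2%:E (fun z => ((hnorm z `^ s)%:C * f z)%R)
       `^ (3 * alpha + 2)^-1)%E.
Proof.
rewrite {}hs; set t := 3 * alpha + 2; set e := (2 * t)^-1.
have t2 : 2 <= t by rewrite /t; move: halpha; lra.
have t0 : 0 < t by apply: lt_le_trans t2.
have mf := cLp_cmeasurable hf.
set P := (X in (X < _)%E); set F := cLnorm (mK alpha) 2%:E f.
set w := (fun z : R * R => ((hnorm z `^ t)%:C * f z)%R); set Y := cLnorm (mK alpha) 2%:E w.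
have mw : cmeasurable (w : measurableTypeR R * measurableTypeR R -> R[i]).
  exact: cmeasurable_weight.
have F0 : (0 < F)%E.
  rewrite lt_neqAle cLnorm2_ge0 andbT; apply/eqP => /esym F_0; apply: hf0.
  exact: cLnorm2_eq0 F_0.
have Foo : (F < +oo)%E by case: hf.
have Y0 : (0 < Y)%E.
  rewrite lt_neqAle cLnorm2_ge0 andbT; apply/eqP => /esym Y_0; apply: hf0.
  have := cLnorm2_eq0 mw Y_0; have := hnorm_neq0_ae halpha.
  apply: filterS2 => z hz /eqP; rewrite mulf_eq0 => /orP[|/eqP//].
  move=> /eqP [] /eqP; rewrite powR_eq0 => /andP[]; by rewrite (negPf hz).
have Gfin : gammaK alpha E \is a fin_num by rewrite ge0_fin_numE.
pose G := fine (gammaK alpha E).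
have GE : gammaK alpha E = G%:E by rewrite fineK.
have G0 : 0 < G by rewrite -lte_fin -GE.
have P0 : (0 <= P)%E by exact: cLnorm2_ge0.
have GG : (gammaK alpha E <= G%:E)%E by rewrite GE.
have key U M mU UM M0 :=
  @LB2_cut_le _ _ halpha f g E U M G hf hg hE mE mU UM GG M0 (ltW G0).
(* The splitting bound with U empty: the inner term disappears and the contraction remains. *)
have PF : (P <= F)%E.
  have m0 : (mK alpha set0 <= 0%:E)%E by rewrite measure0.
  have := key set0 0 measurable0 m0 (lexx 0).
  rewrite mulr0 sqrtr0 mul0e add0e setC0 => /le_trans; apply.
  apply: cLnorm2_le => //; first exact: cmeasurable_cut.
  by move=> z; exact: le_cmod_cut.
have C0 : 0 < C_alpha alpha := le_lt_trans (powR_ge0 _ _) (C_alpha_gt halpha).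
have Poo : (P < +oo)%E := le_lt_trans PF Foo.
have FE : F = (fine F)%:E by rewrite fineK// ge0_fin_numE// ltW.
(* If the weighted norm is infinite, so is the right side, its other factors being positive, while P
   <= F is finite. *)
have [Yoo|/negPf Yoo] := boolP (Y == +oo%E).
  rewrite (eqP Yoo) poweRyr ?invr_eq0 ?(gt_eqF t0)//.
  by rewrite gt0_muley// !mule_gt0 ?poweR_gt0.
have YE : Y = (fine Y)%:E by rewrite fineK// ge0_fin_numE ?(ltW Y0)// ltey Yoo.
have PE : P = (fine P)%:E by rewrite fineK// ge0_fin_numE.
have F0' : 0 < fine F by rewrite -lte_fin -FE.
have Y0' : 0 < fine Y by rewrite -lte_fin -YE.
pose m := mK_cst alpha * 4 `^ (- (alpha + 2^-1)).
have m0 : 0 < m by rewrite mulr_gt0 ?mK_cst_gt0 ?powR_gt0.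
have Gm0 : 0 <= G * m := mulr_ge0 (ltW G0) (ltW m0).
have Pr r : 0 < r -> fine P <= Num.sqrt (G * m) * r `^ t * fine F + r `^ (- t) * fine Y.
  move=> r0; have := key _ _ (measurable_hball r) (mK_hball_le halpha r0).
  rewrite -/m -/t (mulr_ge0 (ltW m0) (powR_ge0 _ _)) => /(_ isT) h.
  have := le_trans h (leeD2l _ (cLnorm2_off_hball halpha mf r0)).
  rewrite -/P -/F -/w -/Y -/t FE YE PE -!EFinM -EFinD lee_fin.
  rewrite mulrA (sqrtrM _ Gm0).
  by rewrite [2 * t]mulrC powRrM powR_mulrn ?powR_ge0// sqrtr_sqr ger0_norm ?powR_ge0.
have PF' : fine P <= fine F by rewrite -lee_fin -PE -FE.
have P0' : 0 <= fine P by rewrite fine_ge0.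
have A0 : 0 < Num.sqrt (G * m) by rewrite sqrtr_gt0 mulr_gt0.
have := le_interpolation t2 P0' F0' Y0' A0 PF' Pr.
rewrite (sqr_sqrtr Gm0) => PI.
have -> : 3 * alpha + 1 = t - 1 by rewrite /t; lra.
(* Strictness comes from the constants alone: the interpolated bound is not strict, but its constant
   is below [C_alpha] and the remaining factors are positive. *)
rewrite PE FE YE GE !poweR_EFin -!EFinM lte_fin; apply: le_lt_trans PI _.
rewrite !ltr_pM2r ?powR_gt0//.
rewrite (_ : 16 * (G * m) = 16 * m * G); last by ring.
rewrite (powRM _ (mulr_ge0 _ (ltW m0)) (ltW G0))// -/e.
by rewrite ltr_pM2r ?powR_gt0// /e /t /m C_alpha_gt.
Qed.
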